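(* 1. Every bounded ratio in Plücker coordinates of $\mathrm{Gr}(4,8)$ is bounded by $1$. 2. A bounded ratio in Plücker coordinates of $\mathrm{Gr}(4,8)$ which is a product of positive integer powers of generating ratios from the list $R_1,\dots,R_{20}$ (given in the context) is subtraction-free in face weights.
   Context: For a real $4\times 8$ matrix and a $4$-subset $I\subset[8]$, $[I]$ denotes the maximal minor with columns $I$ in increasing order (Plücker coordinate). A ratio in Plücker coordinates is a Laurent monomial $\prod_I[I]^{a_I}$, $a_I\in\mathbb Z$, considered as a function on real $4\times8$ matrices all of whose maximal minors are positive. It is bounded if it is bounded above there by a finite constant, and bounded by $1$ if its values there are all at most $1$. List of generating ratios (representatives of the extreme rays of the cone of bounded Plücker ratios of $\mathrm{Gr}(4,8)$ up to the dihedral action on indices and the duality $I\mapsto[8]\setminus I$): $R_1=\frac{[5678][1467]}{[4678][1567]}$, $R_2=\frac{[3578][1347]}{[3478][1357]}$, $R_3=\frac{[3568][2578]}{[3578][2568]}$, $R_4=\frac{[4578][3678]}{[4678][3578]}$, $R_5=\frac{[4578][1357]}{[3578][1457]}$, $R_6=\frac{[3578][1356]}{[3568][1357]}$, $R_7=\frac{[3568][3478]}{[3578][3468]}$, $R_8=\frac{[4678][1457]}{[4578][1467]}$, $R_9=\frac{[3568][3478][2578][1346][1247]}{[3578][3468][2478][1347][1256]}$, $R_{10}=\frac{[3578][3468][2478][1347][1256]}{[3568][3478][2468][1357][1247]}$, $R_{11}=\frac{[3568][3478][2578][1346][1256]}{[3578][3468][2568][1356][1247]}$, $R_{12}=\frac{[4578][3678][2458][2368][2357][1467][1358]}{[4678][3578][2468][2457][2358][1368][1357]}$,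 $R_{13}=\frac{[4578][3678][2458][2368][2357][1467][1358]}{[4678][3578][2468][2367][2358][1458][1357]}$, $R_{14}=\frac{[4678][4568][3578][2678][2456][2357][2348][2346][1457][1367][1356][1347][1258]}{[4578][3678][3568][2578][2457][2358][2356][2347][1467][1456][1348][1346][1267]}$, $R_{15}=\frac{[4678][4568][3578][2678][2456][2357][2348][2346][1457][1367][1356][1347][1258]^2}{[4578][3678][3568][2578][2457][2358][2356][2347][1467][1456][1357][1346][1268][1248]}$, $R_{16}=\frac{[4678][4568][3578][3468][2578][2456][2357][2348][2346][1457][1358][1356]^2[1347]^2[1267]^2[1248][1246]}{[4578][3568][3478][2678][2468][2457][2358][2356][2347][1467][1456][1357]^2[1348][1346]^2[1268][1256][1247]}$, $R_{17}=\frac{[4678][4568][3578][3468][2578][2456][2357][2348][2346][1457][1358][1356]^2[1347]^2[1267]^2[1248][1246]}{[4578][3568]^2[2678][2468][2457][2358][2356][2347][1467][1456][1357]^2[1348][1346]^2[1268][1247]^2}$, $R_{18}=\frac{[4678][4568][3578][3468][2578][2467][2458][2456][2357]^2[2348][2346][1457]^2[1368][1358][1356]^2[1347]^2[1267]^2[1248][1246]}{[4578][3568][3478][2678][2468]^2[2457]^2[2367][2358][2356][2347][1467][1458][1456][1357]^3[1348][1346]^2[1268][1256][1247]}$, $R_{19}=\frac{[4678][4568][3578][3468][2578][2467][2458][2456][2357]^2[2348][2346][1457]^2[1368][1358][1356]^2[1347]^2[1267]^2[1248][1246]}{[4578][3568]^2[2678][2468]^2[2457]^2[2358]^2[2356][2347][1467]^2[1456][1357]^3[1348][1346]^2[1268][1247]^2}$,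 $R_{20}=\frac{[4678][4568][3578][3468][2578][2467][2458][2456][2357]^2[2348][2346][1457]^2[1368][1358][1356]^2[1347]^2[1267]^2[1248][1246]}{[4578][3568][3478][2678][2468]^2[2457]^2[2358]^2[2356][2347][1467]^2[1456][1357]^3[1348][1346]^2[1268][1256][1247]}$. Face weights: the totally positive Grassmannian is parametrized by the positive face weights of a weighted planar network (Fomin–Zelevinsky, Postnikov). Explicitly, with $k=4$, $n=8$: take a $k\times(n-k)$ grid of vertices, with sources $1,\dots,k$ on the right side (one per row, top to bottom) and sinks $k+1,\dots,n$ on the bottom side (one per column, right to left); rows are directed leftwards and columns downwards. Each grid vertex is the upper left corner of a face, which is assigned a variable. The weight of a directed path from a source to a sink is the product of the weights of the faces lying to the south-east of the path. Normalizing $[1\,2\cdots k]=1$, $[I]$ is the sum, over all families of pairwise vertex-disjoint paths from the sources $[k]\setminus I$ to the sinks $I\setminus[k]$, of the products of their path weights. Thus each Plücker coordinate is a polynomial in face weights. A ratio $p/q$, with $p,q$ products of Plücker coordinates, is subtraction-free (in face weights) if $q-p$ is a polynomial in the face weights with all coefficients positive. *)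

(* Defs.v *)
From mathcomp Require Import all_boot all_order all_algebra.
From mathcomp Require Import reals.
From mathcomp Require Import mpoly.

Set Implicit Arguments.
Unset Strict Implicit.
Unset Printing Implicit Defensive.

Import Order.TTheory GRing.Theory Num.Theory.
Local Open Scope ring_scope.

(* The labels 1, ..., 8 are represented by the ordinals 0, ..., 7 of 'I_8. *)

Section Minors.
Variable R : realType.

(* [enum I] is increasing; only sets I of cardinality 4 are meant. *)
Definition plucker (A : 'M[R]_(4, 8)) (I : {set 'I_8}) : R :=
  \det (\matrix_(i < 4, j < 4) A i (nth ord0 (enum I) j)).

Definition minors_positive (A : 'M[R]_(4, 8)) : Prop :=
  forall I : {set 'I_8}, #|I| = 4%N -> 0 < plucker A I.

(* The Laurent monomial with exponents [a]; the values of [a] on sets that do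
   not have 4 elements play no role. *)
Definition plucker_ratio (a : {set 'I_8} -> int) (A : 'M[R]_(4, 8)) : R :=
  \prod_(I : {set 'I_8} | #|I| == 4%N) plucker A I ^ a I.

Definition ratio_le (a : {set 'I_8} -> int) (C : R) : Prop :=
  forall A : 'M[R]_(4, 8), minors_positive A -> plucker_ratio a A <= C.

Definition ratio_bounded (a : {set 'I_8} -> int) : Prop :=
  exists C : R, ratio_le a C.

Definition ratio_bounded_by_one (a : {set 'I_8} -> int) : Prop := ratio_le a 1.

End Minors.

(* A ratio written as a fraction p/q: the lists, with repetition, of the
   Plucker coordinates in p and in q.  Fractions are multiplied formally,
   without cancelling common factors. *)
Definition plucker_fraction : Type := (seq {set 'I_8} * seq {set 'I_8})%type.

Definition frac1 : plucker_fraction := ([::], [::]).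

Definition frac_mul (x y : plucker_fraction) : plucker_fraction :=
  (x.1 ++ y.1, x.2 ++ y.2).

Definition frac_pow (x : plucker_fraction) (n : nat) : plucker_fraction :=
  iter n (frac_mul x) frac1.

Definition laurent (x : plucker_fraction) (I : {set 'I_8}) : int :=
  (count_mem I x.1)%:Z - (count_mem I x.2)%:Z.

(* [pl a b c d] is {a, b, c, d} with 1-based labels. *)
Definition pl (a b c d : nat) : {set 'I_8} :=
  [set i : 'I_8 | i.+1 \in [:: a; b; c; d]].

Definition generating_ratios : seq plucker_fraction :=
  [::
    ([:: pl 5 6 7 8; pl 1 4 6 7],
     [:: pl 4 6 7 8; pl 1 5 6 7]);
    ([:: pl 3 5 7 8; pl 1 3 4 7],
     [:: pl 3 4 7 8; pl 1 3 5 7]);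
    ([:: pl 3 5 6 8; pl 2 5 7 8],
     [:: pl 3 5 7 8; pl 2 5 6 8]);
    ([:: pl 4 5 7 8; pl 3 6 7 8],
     [:: pl 4 6 7 8; pl 3 5 7 8]);
    ([:: pl 4 5 7 8; pl 1 3 5 7],
     [:: pl 3 5 7 8; pl 1 4 5 7]);
    ([:: pl 3 5 7 8; pl 1 3 5 6],
     [:: pl 3 5 6 8; pl 1 3 5 7]);
    ([:: pl 3 5 6 8; pl 3 4 7 8],
     [:: pl 3 5 7 8; pl 3 4 6 8]);
    ([:: pl 4 6 7 8; pl 1 4 5 7],
     [:: pl 4 5 7 8; pl 1 4 6 7]);
    ([:: pl 3 5 6 8; pl 3 4 7 8; pl 2 5 7 8; pl 1 3 4 6; pl 1 2 4 7],
     [:: pl 3 5 7 8; pl 3 4 6 8; pl 2 4 7 8; pl 1 3 4 7; pl 1 2 5 6]);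
    ([:: pl 3 5 7 8; pl 3 4 6 8; pl 2 4 7 8; pl 1 3 4 7; pl 1 2 5 6],
     [:: pl 3 5 6 8; pl 3 4 7 8; pl 2 4 6 8; pl 1 3 5 7; pl 1 2 4 7]);
    ([:: pl 3 5 6 8; pl 3 4 7 8; pl 2 5 7 8; pl 1 3 4 6; pl 1 2 5 6],
     [:: pl 3 5 7 8; pl 3 4 6 8; pl 2 5 6 8; pl 1 3 5 6; pl 1 2 4 7]);
    ([:: pl 4 5 7 8; pl 3 6 7 8; pl 2 4 5 8; pl 2 3 6 8; pl 2 3 5 7; pl 1 4 6 7;
       pl 1 3 5 8],
     [:: pl 4 6 7 8; pl 3 5 7 8; pl 2 4 6 8; pl 2 4 5 7; pl 2 3 5 8; pl 1 3 6 8;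
       pl 1 3 5 7]);
    ([:: pl 4 5 7 8; pl 3 6 7 8; pl 2 4 5 8; pl 2 3 6 8; pl 2 3 5 7; pl 1 4 6 7;
       pl 1 3 5 8],
     [:: pl 4 6 7 8; pl 3 5 7 8; pl 2 4 6 8; pl 2 3 6 7; pl 2 3 5 8; pl 1 4 5 8;
       pl 1 3 5 7]);
    ([:: pl 4 6 7 8; pl 4 5 6 8; pl 3 5 7 8; pl 2 6 7 8; pl 2 4 5 6; pl 2 3 5 7;
       pl 2 3 4 8; pl 2 3 4 6; pl 1 4 5 7; pl 1 3 6 7; pl 1 3 5 6; pl 1 3 4 7;
       pl 1 2 5 8],
     [:: pl 4 5 7 8; pl 3 6 7 8; pl 3 5 6 8; pl 2 5 7 8; pl 2 4 5 7; pl 2 3 5 8;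
       pl 2 3 5 6; pl 2 3 4 7; pl 1 4 6 7; pl 1 4 5 6; pl 1 3 4 8; pl 1 3 4 6;
       pl 1 2 6 7]);
    ([:: pl 4 6 7 8; pl 4 5 6 8; pl 3 5 7 8; pl 2 6 7 8; pl 2 4 5 6; pl 2 3 5 7;
       pl 2 3 4 8; pl 2 3 4 6; pl 1 4 5 7; pl 1 3 6 7; pl 1 3 5 6; pl 1 3 4 7;
       pl 1 2 5 8; pl 1 2 5 8],
     [:: pl 4 5 7 8; pl 3 6 7 8; pl 3 5 6 8; pl 2 5 7 8; pl 2 4 5 7; pl 2 3 5 8;
       pl 2 3 5 6; pl 2 3 4 7; pl 1 4 6 7; pl 1 4 5 6; pl 1 3 5 7; pl 1 3 4 6;
       pl 1 2 6 8; pl 1 2 4 8]);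
    ([:: pl 4 6 7 8; pl 4 5 6 8; pl 3 5 7 8; pl 3 4 6 8; pl 2 5 7 8; pl 2 4 5 6;
       pl 2 3 5 7; pl 2 3 4 8; pl 2 3 4 6; pl 1 4 5 7; pl 1 3 5 8; pl 1 3 5 6;
       pl 1 3 5 6; pl 1 3 4 7; pl 1 3 4 7; pl 1 2 6 7; pl 1 2 6 7; pl 1 2 4 8;
       pl 1 2 4 6],
     [:: pl 4 5 7 8; pl 3 5 6 8; pl 3 4 7 8; pl 2 6 7 8; pl 2 4 6 8; pl 2 4 5 7;
       pl 2 3 5 8; pl 2 3 5 6; pl 2 3 4 7; pl 1 4 6 7; pl 1 4 5 6; pl 1 3 5 7;
       pl 1 3 5 7; pl 1 3 4 8; pl 1 3 4 6; pl 1 3 4 6; pl 1 2 6 8; pl 1 2 5 6;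
       pl 1 2 4 7]);
    ([:: pl 4 6 7 8; pl 4 5 6 8; pl 3 5 7 8; pl 3 4 6 8; pl 2 5 7 8; pl 2 4 5 6;
       pl 2 3 5 7; pl 2 3 4 8; pl 2 3 4 6; pl 1 4 5 7; pl 1 3 5 8; pl 1 3 5 6;
       pl 1 3 5 6; pl 1 3 4 7; pl 1 3 4 7; pl 1 2 6 7; pl 1 2 6 7; pl 1 2 4 8;
       pl 1 2 4 6],
     [:: pl 4 5 7 8; pl 3 5 6 8; pl 3 5 6 8; pl 2 6 7 8; pl 2 4 6 8; pl 2 4 5 7;
       pl 2 3 5 8; pl 2 3 5 6; pl 2 3 4 7; pl 1 4 6 7; pl 1 4 5 6; pl 1 3 5 7;
       pl 1 3 5 7; pl 1 3 4 8; pl 1 3 4 6; pl 1 3 4 6; pl 1 2 6 8; pl 1 2 4 7;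
       pl 1 2 4 7]);
    ([:: pl 4 6 7 8; pl 4 5 6 8; pl 3 5 7 8; pl 3 4 6 8; pl 2 5 7 8; pl 2 4 6 7;
       pl 2 4 5 8; pl 2 4 5 6; pl 2 3 5 7; pl 2 3 5 7; pl 2 3 4 8; pl 2 3 4 6;
       pl 1 4 5 7; pl 1 4 5 7; pl 1 3 6 8; pl 1 3 5 8; pl 1 3 5 6; pl 1 3 5 6;
       pl 1 3 4 7; pl 1 3 4 7; pl 1 2 6 7; pl 1 2 6 7; pl 1 2 4 8; pl 1 2 4 6],
     [:: pl 4 5 7 8; pl 3 5 6 8; pl 3 4 7 8; pl 2 6 7 8; pl 2 4 6 8; pl 2 4 6 8;
       pl 2 4 5 7; pl 2 4 5 7; pl 2 3 6 7; pl 2 3 5 8; pl 2 3 5 6; pl 2 3 4 7;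
       pl 1 4 6 7; pl 1 4 5 8; pl 1 4 5 6; pl 1 3 5 7; pl 1 3 5 7; pl 1 3 5 7;
       pl 1 3 4 8; pl 1 3 4 6; pl 1 3 4 6; pl 1 2 6 8; pl 1 2 5 6; pl 1 2 4 7]);
    ([:: pl 4 6 7 8; pl 4 5 6 8; pl 3 5 7 8; pl 3 4 6 8; pl 2 5 7 8; pl 2 4 6 7;
       pl 2 4 5 8; pl 2 4 5 6; pl 2 3 5 7; pl 2 3 5 7; pl 2 3 4 8; pl 2 3 4 6;
       pl 1 4 5 7; pl 1 4 5 7; pl 1 3 6 8; pl 1 3 5 8; pl 1 3 5 6; pl 1 3 5 6;
       pl 1 3 4 7; pl 1 3 4 7; pl 1 2 6 7; pl 1 2 6 7; pl 1 2 4 8; pl 1 2 4 6],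
     [:: pl 4 5 7 8; pl 3 5 6 8; pl 3 5 6 8; pl 2 6 7 8; pl 2 4 6 8; pl 2 4 6 8;
       pl 2 4 5 7; pl 2 4 5 7; pl 2 3 5 8; pl 2 3 5 8; pl 2 3 5 6; pl 2 3 4 7;
       pl 1 4 6 7; pl 1 4 6 7; pl 1 4 5 6; pl 1 3 5 7; pl 1 3 5 7; pl 1 3 5 7;
       pl 1 3 4 8; pl 1 3 4 6; pl 1 3 4 6; pl 1 2 6 8; pl 1 2 4 7; pl 1 2 4 7]);
    ([:: pl 4 6 7 8; pl 4 5 6 8; pl 3 5 7 8; pl 3 4 6 8; pl 2 5 7 8; pl 2 4 6 7;
       pl 2 4 5 8; pl 2 4 5 6; pl 2 3 5 7; pl 2 3 5 7; pl 2 3 4 8; pl 2 3 4 6;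
       pl 1 4 5 7; pl 1 4 5 7; pl 1 3 6 8; pl 1 3 5 8; pl 1 3 5 6; pl 1 3 5 6;
       pl 1 3 4 7; pl 1 3 4 7; pl 1 2 6 7; pl 1 2 6 7; pl 1 2 4 8; pl 1 2 4 6],
     [:: pl 4 5 7 8; pl 3 5 6 8; pl 3 4 7 8; pl 2 6 7 8; pl 2 4 6 8; pl 2 4 6 8;
       pl 2 4 5 7; pl 2 4 5 7; pl 2 3 5 8; pl 2 3 5 8; pl 2 3 5 6; pl 2 3 4 7;
       pl 1 4 6 7; pl 1 4 6 7; pl 1 4 5 6; pl 1 3 5 7; pl 1 3 5 7; pl 1 3 5 7;
       pl 1 3 4 8; pl 1 3 4 6; pl 1 3 4 6; pl 1 2 6 8; pl 1 2 5 6; pl 1 2 4 7])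
  ].

Definition generator (i : 'I_20) : plucker_fraction := nth frac1 generating_ratios i.

Definition generator_product (e : 'I_20 -> nat) : plucker_fraction :=
  \big[frac_mul/frac1]_(i < 20) frac_pow (generator i) (e i).

(* Grid vertices as (row, column), rows from top to bottom and columns from
   left to right. *)
Definition vertex : Type := ('I_4 * 'I_4)%type.

(* One step leftwards along a row, or downwards along a column. *)
Definition step (u v : vertex) : bool :=
  ((v.1 == u.1 :> nat) && (v.2.+1 == u.2 :> nat))
  || ((v.1 == u.1.+1 :> nat) && (v.2 == u.2 :> nat)).

(* Directed paths have at most 7 vertices in the 4 x 4 grid. *)
Definition gpath : Type := {bseq 7 of vertex}.

(* [p] is a directed path from source [s] (label s + 1, entering the right end
   of row s) to sink [t] (label t + 1, leaving the bottom of column 7 - t). *)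
Definition routes (s t : 'I_8) (p : gpath) : bool :=
  if val p is u :: p' then
    [&& s < 4, 4 <= t,
        u == (inord s, inord 3) :> vertex,
        path step u p' &
        last u p' == (inord 3, inord (7 - t)) :> vertex]%N
  else false.

Definition sources (I : {set 'I_8}) : {set 'I_8} :=
  [set s : 'I_8 | (s < 4)%N & s \notin I].

Definition sinks (I : {set 'I_8}) : {set 'I_8} :=
  [set t : 'I_8 | (4 <= t)%N & t \in I].

(* Families of pairwise vertex-disjoint paths that use every source in [4] \ I
   and every sink in I \ [4]; by disjointness, each is used exactly once. *)
Definition disjoint_family (I : {set 'I_8}) (F : {set gpath}) : bool :=
  [&& [forall p in F, exists s in sources I, exists t in sinks I, routes s t p],
      [forall s in sources I, exists p in F, exists t in sinks I, routes s t p],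
      [forall t in sinks I, exists p in F, exists s in sources I, routes s t p] &
      [forall p in F, forall q in F, (p != q) ==> ~~ has (mem q) p]].

(* The face whose upper left corner is the vertex f. *)
Definition face_var (f : vertex) : {mpoly int[16]} :=
  'X_(inord (4 * f.1 + f.2)%N : 'I_16).

(* A face is south-east of a path when its upper left corner is weakly below
   and weakly to the right of some vertex of the path. *)
Definition south_east (p : gpath) (f : vertex) : bool :=
  has (fun v : vertex => (v.1 <= f.1)%N && (v.2 <= f.2)%N) p.

Definition path_weight (p : gpath) : {mpoly int[16]} :=
  \prod_(f : vertex | south_east p f) face_var f.

Definition face_plucker (I : {set 'I_8}) : {mpoly int[16]} :=
  \sum_(F : {set gpath} | disjoint_family I F) \prod_(p in F) path_weight p.

Definition subtraction_free (x : plucker_fraction) : Prop :=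
  let d := \prod_(I <- x.2) face_plucker I - \prod_(I <- x.1) face_plucker I in
  forall m, m \in msupp d -> 0 < d@_m.

(* Main.v *)
From HB Require Import structures.
Require Import Defs.
From mathcomp Require Import all_boot all_order all_algebra.
From mathcomp Require Import boolp reals sequences exp.
From mathcomp Require Import ring lra zify ssrZ.
From mathcomp Require mpoly.
From Stdlib Require BinNat BinInt.
Import -(notations) mpoly.

(** Second part. Write a fraction as p/q. The identity
    q q' - p p' = q (q' - p') + p' (q - p) reduces the claim to the single
    generators, for which q - p must have nonnegative coefficients in the face
    weights. Both p and q are expanded by three-term Plücker relations until every
    monomial of p can be cancelled against a different monomial of q; the
    remaining monomials of q are products of polynomials with nonnegative
    coefficients ([dominatesP]). The relations to be used form the tree
    [splittings], found by a computer search. For three generators no such tree is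
    used, and the polynomials are multiplied out. All of this takes place in an
    arbitrary commutative ring with a cone of nonnegative elements
    ([generator_subtraction_free]), since the same inequality is needed for real
    numbers in the first part.

    First part. The minors of a matrix satisfy the three-term relations, and
    positive solutions of these relations come from positive face weights
    ([face_weights_exist]); hence all generating ratios are at most 1 on matrices
    with positive minors. Rotation, reflection and duality permute the relations,
    so the same holds for the 332 ratios in the orbits of the generators
    ([orbit_ratio_le]). Let L be the vector of the logarithms of the minors, after
    the columns have been rescaled so that eight of the minors are 1; it lies in
    R^62 and satisfies 332 linear inequalities. The double description method
    computes generators of the cone that they define, 360 of them
    ([double_description], [final_rays]). Each one is a tropical vector: for some
    w in R^16, its entry at I is the maximum of <w, e> over the exponent vectors e
    of the terms of [I] in face weights.

    Now let the ratio with exponents a be bounded. Along the curve x = t^w of face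
    weights it grows like t to the power <a, v>, where v is the tropical vector of
    w; hence <a, v> <= 0 ([tropical_bounded]). As L is a combination of such
    vectors v with nonnegative coefficients, <a, L> <= 0, and the ratio is at most
    1 at the given matrix. The rescaling of the columns does no harm: a bounded
    ratio is homogeneous of degree 0 in each column ([bounded_degree]). *)

Set Implicit Arguments.
Unset Strict Implicit.
Unset Printing Implicit Defensive.

Import Order.TTheory GRing.Theory Num.Theory.
Local Open Scope ring_scope.

(** * Three-term Plücker relations *)

Fixpoint ksubsets (k : nat) (s : seq nat) : seq (seq nat) :=
  match k, s with
  | 0%N, _ => [:: [::]]
  | _, [::] => [::]
  | k'.+1, x :: s' => [seq x :: t | t <- ksubsets k' s'] ++ ksubsets k s'
  end.

Definition sets4 : seq (seq nat) := ksubsets 4 (iota 1 8).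

(** Plücker coordinates are numbered by the lexicographic rank of their index
    set: the data below consist of such ranks. *)
Definition rank4 (s : seq nat) : nat := index s sets4.

(** [((x, x'), (a, a'), (b, b'))] is the relation
    [P x * P x' = P a * P a' + P b * P b']. *)
Definition relation3 : Type := ((nat * nat) * (nat * nat) * (nat * nat))%type.

(** The relation [Sik][Sjl] = [Sij][Skl] + [Sil][Sjk] inside the 6-set [c]: the
    4-set [q] lists the positions of i < j < k < l in [c], and S consists of the
    two other labels. All signs are positive because the sets are sorted. *)
Definition relation_sets (c q : seq nat) : seq (seq nat) :=
  let pick a b :=
    [seq nth 0%N c i | i <- iota 0 6 &
       (i \notin q) || (i == nth 0 q a) || (i == nth 0 q b)]%N in
  [:: pick 0 2; pick 1 3; pick 0 1; pick 2 3; pick 0 3; pick 1 2]%N.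

Definition relation_ranks (r : seq (seq nat)) : relation3 :=
  let i k := rank4 (nth [::] r k) in
  ((i 0%N, i 1%N), (i 2%N, i 3%N), (i 4%N, i 5%N)).

Definition relations : seq relation3 :=
  [seq relation_ranks (relation_sets c q) |
     c <- ksubsets 6 (iota 1 8), q <- ksubsets 4 (iota 0 6)].

Definition three_term (A : comNzRingType) (P : nat -> A) (r : relation3) : Prop :=
  let: ((x, x'), (a, a'), (b, b')) := r in
  P x * P x' = P a * P a' + P b * P b'.

Definition plucker_function (A : comNzRingType) (P : nat -> A) : Prop :=
  forall r, r \in relations -> three_term P r.

(** * Minors of a matrix with four rows *)

Definition det2 (A : comNzRingType) (u v : nat -> A) (i j : nat) : A :=
  u i * v j - u j * v i.

(** The determinant with columns a, b, c, d, by Laplace expansion along the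
    first two columns. *)
Definition det4 (A : comNzRingType) (a b c d : nat -> A) : A :=
  det2 a b 0 1 * det2 c d 2 3 - det2 a b 0 2 * det2 c d 1 3
  + det2 a b 0 3 * det2 c d 1 2 + det2 a b 1 2 * det2 c d 0 3
  - det2 a b 1 3 * det2 c d 0 2 + det2 a b 2 3 * det2 c d 0 1.

Lemma det_col0 (A : comNzRingType) n (f : nat -> nat -> A) :
  \det (\matrix_(i < n.+1, j < n.+1) f i j) =
  \sum_(k < n.+1) (-1) ^+ k * f k 0%N *
     \det (\matrix_(i < n, j < n) f (bump k i) j.+1).
Proof.
rewrite (expand_det_col _ ord0); apply: eq_bigr => k _; rewrite !mxE /cofactor addn0.
rewrite mulrCA mulrA; congr (_ * \det _); apply/matrixP => i j; by rewrite !mxE.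
Qed.

Lemma det4E (A : comNzRingType) (f : nat -> nat -> A) :
  \det (\matrix_(i < 4, j < 4) f i j)
    = det4 (f^~ 0%N) (f^~ 1%N) (f^~ 2%N) (f^~ 3%N).
Proof.
have d2 (g : nat -> nat -> A) : \det (\matrix_(i < 2, j < 2) g i j) = det2 (g^~ 0%N) (g^~ 1%N) 0 1.
  by rewrite det_col0 !big_ord_recl big_ord0 !det_mx11 !mxE /det2 /=; ring.
have d3 (g : nat -> nat -> A) : \det (\matrix_(i < 3, j < 3) g i j)
    = \sum_(k < 3) (-1) ^+ k * g k 0%N *
        det2 (fun i => g (bump k i) 1%N) (fun i => g (bump k i) 2%N) 0 1.
  by rewrite det_col0; apply: eq_bigr => k _; rewrite (d2 (fun i j => g (bump k i) j.+1)).
rewrite det_col0; under eq_bigr => k _ do rewrite (d3 (fun i j => f (bump k i) j.+1)).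
rewrite !big_ord_recl !big_ord0 /bump /= /det4 /det2.
ring.
Qed.

(** Matrices are functions [u] here, with [u l i] the entry in row [i] of the
    column with label [l]; labels start with 1, rows with 0. *)
Definition minor (A : comNzRingType) (u : nat -> nat -> A) (s : seq nat) : A :=
  det4 (u (nth 0%N s 0)) (u (nth 0%N s 1)) (u (nth 0%N s 2)) (u (nth 0%N s 3)).

Definition minor_rank (A : comNzRingType) (u : nat -> nat -> A) (k : nat) : A :=
  minor u (nth [::] sets4 k).

(** The fifteen positions are treated one by one, each by polynomial
    arithmetic in the 24 entries of the six columns. *)
Lemma det4_three_term (A : comNzRingType) (u : nat -> nat -> A) (c q : seq nat) :
  q \in ksubsets 4 (iota 0 6) ->
  let m k := minor u (nth [::] (relation_sets c q) k) in
  m 0%N * m 1%N = m 2%N * m 3%N + m 4%N * m 5%N.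
Proof.
let qs := eval vm_compute in (ksubsets 4 (iota 0 6)) in
  rewrite (_ : ksubsets 4 _ = qs) // !inE => hq.
repeat (case/orP: hq => [/eqP -> | hq]); last move/eqP: hq => ->;
  by rewrite /minor /= /det4 /det2; ring.
Qed.

Lemma nth_rank4 s : s \in sets4 -> nth [::] sets4 (rank4 s) = s.
Proof. exact: nth_index. Qed.

Lemma relation_sets_sets4 c q k : c \in ksubsets 6 (iota 1 8) ->
  q \in ksubsets 4 (iota 0 6) -> (k < 6)%N ->
  nth [::] (relation_sets c q) k \in sets4.
Proof.
move=> hc hq hk.
have : all (fun c => all (fun q => all (mem sets4) (relation_sets c q))
         (ksubsets 4 (iota 0 6))) (ksubsets 6 (iota 1 8)) by vm_compute.
move/allP/(_ _ hc)/allP/(_ _ hq)/allP; apply.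
by rewrite mem_nth // /relation_sets.
Qed.

Opaque sets4 rank4 relation_sets.
Arguments sets4 : simpl never.

Lemma minor_plucker (A : comNzRingType) (u : nat -> nat -> A) :
  plucker_function (minor_rank u).
Proof.
move=> r /allpairsP[[c q] /= [hc hq ->]].
rewrite /relation_ranks /three_term /minor_rank.
have e k : (k < 6)%N ->
    nth [::] sets4 (rank4 (nth [::] (relation_sets c q) k))
      = nth [::] (relation_sets c q) k.
  by move=> hk; apply: nth_rank4; apply: relation_sets_sets4.
rewrite (e 0%N) // (e 1%N) // (e 2%N) // (e 3%N) // (e 4%N) // (e 5%N) //.
exact: (det4_three_term u c hq).
Qed.

Opaque relations.
Arguments relations : simpl never.


Definition plucker_set (k : nat) : {set 'I_8} :=
  [set i : 'I_8 | i.+1 \in nth [::] sets4 k].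

(** The passage to matrices that are functions with labels 1, ..., 8. *)
Definition entry (R : realType) (M : 'M[R]_(4, 8)) (l i : nat) : R :=
  M (inord i) (inord l.-1).

Lemma enum_plucker_set k : (k < 70)%N ->
  [seq (nat_of_ord i).+1 | i <- enum (plucker_set k)] = nth [::] sets4 k.
Proof.
move=> hk.
have -> : enum (plucker_set k) =
    [seq i <- enum 'I_8 | (nat_of_ord i).+1 \in nth [::] sets4 k].
  by rewrite [in RHS]enumT; apply: eq_filter => i; rewrite !inE.
rewrite -(filter_map (fun i : 'I_8 => i.+1) (mem (nth [::] sets4 k))).
rewrite (map_comp S val) val_enum_ord.
have : all (fun k => [seq i <- map S (iota 0 8) | i \in nth [::] sets4 k]
             == nth [::] sets4 k) (iota 0 70) by vm_compute.
by move/allP => h; apply/eqP/h; rewrite mem_iota.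
Qed.

Lemma plucker_minor (R : realType) (M : 'M[R]_(4, 8)) k : (k < 70)%N ->
  plucker M (plucker_set k) = minor_rank (entry M) k.
Proof.
move=> hk; rewrite /plucker /minor_rank /minor.
have es := enum_plucker_set hk.
have sz : size (enum (plucker_set k)) = 4%N.
  rewrite -(size_map (fun i : 'I_8 => i.+1)) es.
  have : all (fun k => size (nth [::] sets4 k) == 4)%N (iota 0 70).
    by vm_compute.
  by move/allP => h; apply/eqP/h; rewrite mem_iota.
rewrite -(det4E (fun i j => entry M (nth 0%N (nth [::] sets4 k) j) i)).
congr (\det _); apply/matrixP => i j; rewrite !mxE /entry inord_val.
by rewrite -es (nth_map ord0) ?sz //= inord_val.
Qed.

(** * Comparing products of Plücker coordinates *)

(** The instances of interest are the nonnegative real numbers and the polynomials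
    without negative coefficients. *)
Record nonneg_cone (A : comNzRingType) (N : A -> Prop) : Prop := NonnegCone {
  cone0 : N 0;
  cone1 : N 1;
  coneD : forall x y, N x -> N y -> N (x + y);
  coneM : forall x y, N x -> N y -> N (x * y) }.

Lemma cone_sum (A : comNzRingType) (N : A -> Prop) (I : Type) (s : seq I)
    (F : I -> A) :
  nonneg_cone N -> (forall i, N (F i)) -> N (\sum_(i <- s) F i).
Proof.
move=> hN hF; elim/big_ind: _ => //; [exact: cone0 hN | exact: coneD hN].
Qed.

Lemma cone_prod (A : comNzRingType) (N : A -> Prop) (I : Type) (s : seq I)
    (F : I -> A) :
  nonneg_cone N -> (forall i, N (F i)) -> N (\prod_(i <- s) F i).
Proof.
move=> hN hF; elim/big_ind: _ => //; [exact: cone1 hN | exact: coneM hN].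
Qed.

(** A monomial in the Plücker coordinates is the list of its factors. *)
Definition monomial (A : comNzRingType) (P : nat -> A) (m : seq nat) : A :=
  \prod_(i <- m) P i.

Lemma monomial_rem2 (A : comNzRingType) (P : nat -> A) x y m :
  x \in m -> y \in rem x m ->
  monomial P m = P x * P y * monomial P (rem y (rem x m)).
Proof.
move=> hx hy; rewrite /monomial (perm_big _ (perm_to_rem hx)) big_cons -mulrA.
by congr (_ * _); rewrite (perm_big _ (perm_to_rem hy)) big_cons.
Qed.

(** A plan for the expansion of a monomial. [L] leaves it alone; [Sp x y l r]
    replaces a factor [P x * P y] by the two terms of the relation with that
    left-hand side, and then expands these by [l] and [r]. *)
Inductive expansion : Type := L | Sp of nat & nat & expansion & expansion.

Definition find_relation (x y : nat) : option relation3 :=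
  ohead [seq e <- relations | e.1.1 == (x, y)].
Arguments find_relation : simpl never.

Lemma find_relationP x y e :
  find_relation x y = Some e -> e \in relations /\ e.1.1 = (x, y).
Proof.
rewrite /find_relation; case hf: [seq _ <- _ | _] => [//|e' s] /= [<-].
have: e' \in [seq e <- relations | e.1.1 == (x, y)] by rewrite hf mem_head.
by rewrite mem_filter => /andP[/eqP].
Qed.

Fixpoint expand (t : expansion) (m : seq nat) : option (seq (seq nat)) :=
  match t with
  | L => Some [:: m]
  | Sp x y l r =>
      let m' := rem y (rem x m) in
      if (x \in m) && (y \in rem x m) then
        if find_relation x y is Some (_, (a, a'), (b, b')) then
          match expand l [:: a, a' & m'], expand r [:: b, b' & m'] with
          | Some u, Some v => Some (u ++ v)
          | _, _ => None
          end
        else None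
      else None
  end.

Lemma expandP (A : comNzRingType) (P : nat -> A) t m s :
  plucker_function P -> expand t m = Some s ->
  monomial P m = \sum_(m' <- s) monomial P m'.
Proof.
move=> hP; elim: t m s => [|x y l IHl r IHr] m s /=.
  by case=> <-; rewrite big_seq1.
case: ifP => // /andP[hx hy].
case hf: (find_relation x y) => [[[e [a a']] [b b']]|//].
case hu: (expand l _) => [u|//]; case hv: (expand r _) => [v|//] [<-].
have [/hP hrel /= he] := find_relationP hf; rewrite he /= in hrel.
rewrite (monomial_rem2 P hx hy) hrel mulrDl big_cat /= -(IHl _ _ hu) -(IHr _ _ hv).
by rewrite /monomial !big_cons !mulrA.
Qed.

(** Each monomial of [u] is matched with a monomial of [v]; both are lists of
    sorted lists, so that equality of lists suffices. *)
Fixpoint multiset_sub (u v : seq (seq nat)) : bool :=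
  if u is m :: u' then if m \in v then multiset_sub u' (rem m v) else false
  else true.

Lemma multiset_subP (u v : seq (seq nat)) :
  multiset_sub u v -> exists w, perm_eq v (u ++ w).
Proof.
elim: u v => [|m u IHu] v /=; first by exists v.
case: ifP => // hm /IHu[w hw]; exists w.
by rewrite (perm_trans (perm_to_rem hm)) // perm_cons.
Qed.

Definition dominates (t : expansion * expansion) (r : seq nat * seq nat) : bool :=
  match expand t.1 r.1, expand t.2 r.2 with
  | Some u, Some v => multiset_sub [seq sort leq m | m <- u] [seq sort leq m | m <- v]
  | _, _ => false
  end.

(** The expansion of p is a part of the expansion of q, so that q - p is the sum
    of the other monomials of q. *)
Lemma dominatesP (A : comNzRingType) (N : A -> Prop) (P : nat -> A) t r :
  nonneg_cone N -> (forall k, N (P k)) -> plucker_function P ->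
  dominates t r -> N (monomial P r.2 - monomial P r.1).
Proof.
move=> hN hNP hP; rewrite /dominates.
case hu: (expand _ _) => [u|//]; case hv: (expand _ _) => [v|//].
move=> /multiset_subP[w hw].
have sortE s : \sum_(m <- s) monomial P m =
    \sum_(m <- [seq sort leq m | m <- s]) monomial P m.
  rewrite big_map; apply: eq_bigr => m _.
  by apply: perm_big; rewrite perm_sym perm_sort.
rewrite (expandP hP hu) (expandP hP hv) (sortE u) (sortE v) (perm_big _ hw) big_cat /=.
rewrite addrAC subrr add0r; apply: cone_sum => // m.
exact: cone_prod.
Qed.

Definition generator_ranks : seq (seq nat * seq nat) := [::
  ([:: 69; 28], [:: 68; 31]);
  ([:: 63; 17], [:: 60; 20]);
  ([:: 62; 53], [:: 63; 52]);
  ([:: 67; 64], [:: 68; 63]);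
  ([:: 67; 20], [:: 63; 26]);
  ([:: 63; 19], [:: 62; 20]);
  ([:: 62; 60], [:: 63; 59]);
  ([:: 68; 26], [:: 67; 28]);
  ([:: 62; 60; 53; 16; 7], [:: 63; 59; 50; 17; 9]);
  ([:: 63; 59; 50; 17; 9], [:: 62; 60; 49; 20; 7]);
  ([:: 62; 60; 53; 16; 9], [:: 63; 59; 52; 19; 7]);
  ([:: 67; 64; 47; 43; 40; 28; 21], [:: 68; 63; 49; 46; 41; 23; 20]);
  ([:: 67; 64; 47; 43; 40; 28; 21], [:: 68; 63; 49; 42; 41; 27; 20]);
  ([:: 68; 66; 63; 54; 45; 40; 38; 36; 26; 22; 19; 17; 11], [:: 67; 64; 62;
  53; 46; 41; 39; 37; 28; 25; 18; 16; 12]);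
  ([:: 68; 66; 63; 54; 45; 40; 38; 36; 26; 22; 19; 17; 11; 11], [:: 67; 64;
  62; 53; 46; 41; 39; 37; 28; 25; 20; 16; 13; 8]);
  ([:: 68; 66; 63; 59; 53; 45; 40; 38; 36; 26; 21; 19; 19; 17; 17; 12; 12; 8;
  6], [:: 67; 62; 60; 54; 49; 46; 41; 39; 37; 28; 25; 20; 20; 18; 16; 16; 13;
  9; 7]);
  ([:: 68; 66; 63; 59; 53; 45; 40; 38; 36; 26; 21; 19; 19; 17; 17; 12; 12; 8;
  6], [:: 67; 62; 62; 54; 49; 46; 41; 39; 37; 28; 25; 20; 20; 18; 16; 16; 13;
  7; 7]);
  ([:: 68; 66; 63; 59; 53; 48; 47; 45; 40; 40; 38; 36; 26; 26; 23; 21; 19;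
  19; 17; 17; 12; 12; 8; 6], [:: 67; 62; 60; 54; 49; 49; 46; 46; 42; 41; 39;
  37; 28; 27; 25; 20; 20; 20; 18; 16; 16; 13; 9; 7]);
  ([:: 68; 66; 63; 59; 53; 48; 47; 45; 40; 40; 38; 36; 26; 26; 23; 21; 19;
  19; 17; 17; 12; 12; 8; 6], [:: 67; 62; 62; 54; 49; 49; 46; 46; 41; 41; 39;
  37; 28; 28; 25; 20; 20; 20; 18; 16; 16; 13; 7; 7]);
  ([:: 68; 66; 63; 59; 53; 48; 47; 45; 40; 40; 38; 36; 26; 26; 23; 21; 19;
  19; 17; 17; 12; 12; 8; 6], [:: 67; 62; 60; 54; 49; 49; 46; 46; 41; 41; 39;
  37; 28; 28; 25; 20; 20; 20; 18; 16; 16; 13; 9; 7])].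

(** Expansions of p and q, for each generator p/q. For the first eight of them p
    itself is a monomial of the expansion of q. *)
Definition splittings : seq (option (expansion * expansion)) := [::
  Some (L,
    Sp 31 68 L L);
  Some (L,
    Sp 20 60 L L);
  Some (L,
    Sp 52 63 L L);
  Some (L,
    Sp 63 68 L L);
  Some (L,
    Sp 26 63 L L);
  Some (L,
    Sp 20 62 L L);
  Some (L,
    Sp 59 63 L L);
  Some (L,
    Sp 28 67 L L);
  None;
  None;
  None;
  Some (Sp 28 67 L (Sp 30 64 L (Sp 43 60 L L)),
    Sp 23 63 (Sp 41 49 (Sp 46 52 L (Sp 20 51 L (Sp 31 68 L L))) (Sp 20 46 L L)) (Sp
    49 62 (Sp 20 41 L (Sp 46 66 L L)) (Sp 46 52 L (Sp 20 41 L (Sp 51 68 L (Sp 24 54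
    L L))))));
  Some (Sp 28 67 (Sp 40 47 (Sp 53 68 L L) L) L,
    Sp 63 68 (Sp 20 27 L (Sp 41 49 L (Sp 42 60 (Sp 37 47 L L) L))) (Sp 42 49 (Sp 20
    27 L (Sp 36 41 L L)) (Sp 48 67 (Sp 20 27 L L) (Sp 20 41 L (Sp 27 50 L L)))));
  Some (Sp 17 40 (Sp 45 56 L (Sp 3 11 L L)) L,
    Sp 16 39 (Sp 2 37 L (Sp 3 41 (Sp 18 44 L (Sp 12 24 L (Sp 28 67 (Sp 25 62 (Sp 53
    64 L L) L) L))) L)) (Sp 18 41 (Sp 12 53 (Sp 37 57 L (Sp 25 56 L (Sp 62 67 L (Sp
    28 64 L L)))) L) (Sp 25 46 (Sp 5 21 (Sp 1 37 L (Sp 12 53 (Sp 10 27 L (Sp 62 67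
    L (Sp 28 64 L L))) L)) L) (Sp 12 53 (Sp 10 21 L (Sp 62 67 L (Sp 28 64 L L)))
    L))));
  Some (Sp 17 40 (Sp 45 56 L (Sp 3 11 L L)) L,
    Sp 8 41 (Sp 37 47 L (Sp 13 53 (Sp 16 39 L (Sp 25 46 L (Sp 19 45 (Sp 9 20 L (Sp 62
    67 L (Sp 28 64 L L))) L))) L)) (Sp 16 39 (Sp 2 37 L (Sp 3 13 (Sp 2 20 (Sp 28 67
    (Sp 25 62 (Sp 53 64 L L) L) L) L) L)) (Sp 25 46 (Sp 5 20 (Sp 1 37 L (Sp 13 53
    (Sp 62 67 L (Sp 28 64 L L)) L)) L) (Sp 13 53 (Sp 62 67 L (Sp 28 64 L L)) L))));
  Some (Sp 17 38 (Sp 12 53 L L) (Sp 53 68 L L),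
    Sp 20 41 (Sp 7 13 L (Sp 1 18 (Sp 9 20 L (Sp 39 46 L (Sp 16 37 L (Sp 16 49 (Sp 28
    67 (Sp 25 62 L L) L) L)))) L)) (Sp 7 13 (Sp 16 20 L (Sp 37 49 L (Sp 9 48 (Sp 6
    17 L (Sp 7 18 L (Sp 16 38 (Sp 16 39 L (Sp 25 46 L (Sp 62 67 L (Sp 28 54 L L))))
    L))) L))) (Sp 9 28 (Sp 16 20 L (Sp 16 39 L (Sp 25 46 L (Sp 49 60 L (Sp 62 67 L
    (Sp 31 54 L L)))))) (Sp 16 39 L (Sp 20 60 (Sp 25 46 L (Sp 16 49 (Sp 25 62 L L)
    L)) L)))));
  Some (Sp 12 53 L L,
    Sp 7 13 (Sp 16 20 L (Sp 7 18 L (Sp 37 41 L (Sp 16 39 L (Sp 25 46 L (Sp 62 67 L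
    (Sp 28 54 (Sp 49 62 L (Sp 40 52 L (Sp 20 41 L L))) L))))))) (Sp 7 20 L (Sp 39
    46 L (Sp 16 37 L (Sp 20 62 (Sp 18 41 L (Sp 16 49 (Sp 28 67 (Sp 25 62 L L) L)
    L)) L)))));
  Some (
    Sp 17 38 (Sp 19 59 (Sp 12 23 (Sp 2 21 (Sp 12 23 L (Sp 26 47 L L)) L) L) (Sp 12
    23 L (Sp 26 47 L L))) (Sp 12 53 (Sp 17 59 (Sp 12 23 L (Sp 26 48 L L)) (Sp 6 23
    L (Sp 26 58 L L))) L),
    Sp 20 41 (Sp 7 18 (Sp 9 20 L (Sp 39 46 L (Sp 16 37 L (Sp 25 49 (Sp 28 67 (Sp 30
    54 L (Sp 10 50 (Sp 7 49 (Sp 27 50 (Sp 6 46 (Sp 20 42 L L) L) (Sp 13 30 (Sp 6 42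
    (Sp 20 46 L L) L) L)) (Sp 20 42 L L)) L)) L) L)))) (Sp 46 49 (Sp 9 20 L (Sp 10
    13 L (Sp 1 37 (Sp 42 49 L (Sp 11 50 (Sp 8 43 (Sp 16 39 L (Sp 25 49 (Sp 28 67 (Sp
    20 46 L (Sp 27 53 L (Sp 33 54 L L))) L) L)) L) L)) L))) (Sp 20 27 L (Sp 1 37
    (Sp 9 49 (Sp 16 39 L (Sp 20 42 L (Sp 25 46 L (Sp 52 67 L (Sp 22 54 (Sp 28 64 L
    L) L))))) L) L)))) (Sp 16 39 (Sp 2 18 (Sp 9 20 L (Sp 7 49 (Sp 16 37 L (Sp 25 46
    L (Sp 62 67 L (Sp 28 54 (Sp 10 50 (Sp 7 49 (Sp 27 50 (Sp 6 46 (Sp 20 42 L L) L)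
    (Sp 13 30 (Sp 6 42 (Sp 20 46 L L) L) L)) (Sp 20 42 L L)) L) L)))) L)) L) (Sp
    28 49 (Sp 9 20 L (Sp 25 46 L (Sp 62 67 L (Sp 27 49 (Sp 20 42 L (Sp 46 66 L L))
    (Sp 7 29 (Sp 13 30 (Sp 6 42 (Sp 20 46 L L) L) L) (Sp 20 42 L L)))))) (Sp 29 60
    (Sp 9 20 L (Sp 25 46 L (Sp 62 67 L (Sp 27 49 (Sp 7 20 L (Sp 10 42 L (Sp 46 66 L
    L))) (Sp 20 46 (Sp 7 29 L (Sp 10 42 L L)) (Sp 7 13 L (Sp 16 42 L L))))))) (Sp
    16 20 L (Sp 7 27 L (Sp 13 30 L (Sp 46 49 L (Sp 9 48 (Sp 20 42 L (Sp 22 29 L (Sp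
    25 46 L (Sp 62 67 L (Sp 28 54 L L))))) L)))))))));
  Some (Sp 6 19 (Sp 23 63 (Sp 53 64 L L) (Sp 12 24 L L)) (Sp 12 23 L L),
    Sp 49 62 (Sp 7 20 (Sp 7 13 L (Sp 16 20 L (Sp 3 43 (Sp 46 49 L (Sp 39 46 L (Sp 16
    37 L (Sp 20 41 L (Sp 18 41 L (Sp 28 67 (Sp 28 54 (Sp 62 68 L L) L) L))))))
    L))) (Sp 7 13 L (Sp 10 28 L (Sp 46 49 L (Sp 39 46 L (Sp 16 37 L (Sp 20 41 L (Sp
    20 62 (Sp 16 43 (Sp 18 41 L (Sp 28 67 L L)) L) L)))))))) (Sp 7 20 (Sp 28 54 (Sp
    3 13 (Sp 16 20 L (Sp 7 18 L (Sp 19 28 L (Sp 37 41 L (Sp 46 49 L (Sp 20 41 L (Sp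
    16 39 L (Sp 25 46 L (Sp 52 67 L L))))))))) L) (Sp 7 13 L (Sp 16 20 L (Sp 39 46
    L (Sp 12 52 (Sp 41 49 L (Sp 9 43 (Sp 16 37 L (Sp 18 41 L (Sp 20 46 L (Sp 52 67 L
    (Sp 28 54 L L))))) L)) L))))) (Sp 28 54 (Sp 7 18 L (Sp 20 28 L (Sp 37 41 L (Sp
    46 49 L (Sp 10 52 (Sp 20 41 L (Sp 16 39 L (Sp 25 46 L (Sp 62 67 L L)))) L)))))
    (Sp 7 13 L (Sp 10 52 (Sp 39 46 L (Sp 41 49 L (Sp 9 43 (Sp 16 37 L (Sp 20 62 (Sp
    18 41 L (Sp 28 67 (Sp 19 52 (Sp 25 62 (Sp 20 46 L L) L) L) L)) L)) L))) L)))));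
  Some (Sp 12 23 L (Sp 17 59 L (Sp 12 53 L L)),
    Sp 7 49 (Sp 28 54 (Sp 9 20 L (Sp 20 28 L (Sp 37 41 L (Sp 46 49 L (Sp 10 50 (Sp 7
    18 L (Sp 20 41 L (Sp 16 39 L (Sp 25 46 L (Sp 62 67 L L))))) L))))) (Sp 9 20 L
    (Sp 10 13 L (Sp 39 46 L (Sp 11 50 (Sp 41 49 L (Sp 16 37 L (Sp 16 43 (Sp 20 60 (Sp
    18 41 L (Sp 28 67 (Sp 25 62 (Sp 20 46 L L) L) L)) L) L))) L))))) (Sp 28 60 (Sp
    9 20 L (Sp 20 28 L (Sp 37 41 L (Sp 46 49 L (Sp 20 41 L (Sp 16 39 L (Sp 25 46 L
    (Sp 16 48 (Sp 62 67 L L) L)))))))) (Sp 16 20 L (Sp 20 28 L (Sp 22 30 L (Sp 37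
    41 L (Sp 46 49 L (Sp 9 48 (Sp 20 41 L (Sp 16 39 L (Sp 25 46 L (Sp 62 67 L (Sp 28
    54 (Sp 12 24 L L) L))))) L))))))))].

Lemma splittings_dominate n t :
  nth None splittings n = Some t -> dominates t (nth ([::], [::]) generator_ranks n).
Proof.
move=> ht.
have : all (fun n => if nth None splittings n is Some t
    then dominates t (nth ([::], [::]) generator_ranks n) else true) (iota 0 20).
  by vm_compute.
move/allP/(_ n); rewrite ht; apply; rewrite mem_iota /= add0n.
by case: ltnP => // h; move: ht; rewrite nth_default.
Qed.

Lemma generating_ratiosE : generating_ratios =
  [seq ([seq plucker_set k | k <- r.1], [seq plucker_set k | k <- r.2]) | r <- generator_ranks].
Proof. reflexivity. Qed.

(** * Plücker coordinates in face weights *)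

Local Open Scope nat_scope.

(** Directed paths of the grid from (r, c) to (3, tc), as lists of vertices. The
    fuel [n] bounds the number of vertices, which is at most 7. *)
Fixpoint walks (n r c tc : nat) : seq (seq (nat * nat)) :=
  if n is n'.+1 then
    (if (r == 3) && (c == tc) then [:: [:: (r, c)]] else [::])
    ++ (if c is c'.+1 then [seq (r, c) :: w | w <- walks n' r c' tc] else [::])
    ++ (if r < 3 then [seq (r, c) :: w | w <- walks n' r.+1 c tc] else [::])
  else [::].

Definition paths_to (s : nat) (ts : seq nat) : seq (seq (nat * nat)) :=
  flatten [seq walks 7 s 3 (7 - t) | t <- ts].

(** A family of disjoint paths is listed in the order of its sources, so that it
    occurs only once. *)
Fixpoint families (ss ts : seq nat) : seq (seq (seq (nat * nat))) :=
  if ss is s :: ss' then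
    flatten [seq [seq p :: f | f <- families ss' ts &
                    all (fun q => ~~ has (mem q) p) f] | p <- paths_to s ts]
  else [:: [::]].

Definition source_list (s : seq nat) : seq nat :=
  [seq i <- iota 0 4 | i.+1 \notin s].
Definition sink_list (s : seq nat) : seq nat := [seq i <- iota 4 4 | i.+1 \in s].

Definition covers_sinks (ts : seq nat) (f : seq (seq (nat * nat))) : bool :=
  all (fun t => has (fun p => last (0, 0)%N p == (3, 7 - t)%N) f) ts.

Definition disjoint_families (s : seq nat) : seq (seq (seq (nat * nat))) :=
  [seq f <- families (source_list s) (sink_list s) | covers_sinks (sink_list s) f].

(** The faces on the right and on the bottom side come first. Their exponents
    are the same in all terms of a given Plücker coordinate, so that the nested
    representation of polynomials used below stays small in this order. *)
Definition face_order : seq (nat * nat) :=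
  let fs := [seq (r, c) | r <- iota 0 4, c <- iota 0 4] in
  let side f := (f.1 == 3) || (f.2 == 3) in
  [seq f <- fs | side f] ++ [seq f <- fs | ~~ side f].

Definition below_right (p : seq (nat * nat)) (f : nat * nat) : bool :=
  has (fun v => (v.1 <= f.1) && (v.2 <= f.2))%N p.

Definition family_exponents (f : seq (seq (nat * nat))) : seq nat :=
  [seq count (below_right^~ v) f | v <- face_order].

Definition exponents (s : seq nat) : seq (seq nat) :=
  [seq family_exponents f | f <- disjoint_families s].

Definition exponent_table : seq (seq (seq nat)) :=
  Eval vm_compute in [seq exponents s | s <- sets4].

Lemma exponent_tableE : exponent_table = [seq exponents s | s <- sets4].
Proof. by vm_compute. Qed.

Definition terms (k : nat) : seq (seq nat) := nth [::] exponent_table k.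

Local Open Scope ring_scope.

Definition term_value (A : comNzRingType) (x : nat -> A) (e : seq nat) : A :=
  \prod_(j < 16) x j ^+ nth 0%N e j.

(** The Plücker coordinate of rank [k] at the face weights [x]. *)
Definition face_value (A : comNzRingType) (x : nat -> A) (k : nat) : A :=
  \sum_(e <- terms k) term_value x e.

(** * Polynomials with natural coefficients *)

(** Recursively, a polynomial in n + 1 variables is a polynomial in the first
    variable with coefficients in the others; this makes products fast. *)
Fixpoint hpoly (n : nat) : Type := if n is m.+1 then seq (hpoly m) else BinNums.N.

Fixpoint hzero (n : nat) : hpoly n := if n is m.+1 then [::] else BinNums.N0.

Fixpoint hadd (n : nat) : hpoly n -> hpoly n -> hpoly n :=
  match n with
  | 0%N => BinNat.N.add
  | m.+1 => fix add p q := match p, q with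
      | [::], _ => q
      | _, [::] => p
      | a :: p', b :: q' => hadd a b :: add p' q'
      end
  end.

Fixpoint hmul (n : nat) : hpoly n -> hpoly n -> hpoly n :=
  match n with
  | 0%N => BinNat.N.mul
  | m.+1 => fix mul p q := match p with
      | [::] => [::]
      | a :: p' => @hadd m.+1 [seq hmul a b | b <- q] (hzero m :: mul p' q)
      end
  end.

Fixpoint hle (n : nat) : hpoly n -> hpoly n -> bool :=
  match n with
  | 0%N => BinNat.N.leb
  | m.+1 => fix le p q := match p, q with
      | [::], _ => true
      | a :: p', [::] => hle a (hzero m) && le p' [::]
      | a :: p', b :: q' => hle a b && le p' q'
      end
  end.

Fixpoint hmono (n : nat) (e : seq nat) : hpoly n :=
  if n is m.+1 then ncons (head 0%N e) (hzero m) [:: hmono m (behead e)]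
  else BinNums.Npos BinNums.xH.

Fixpoint heval (A : comNzRingType) (n : nat) (x : nat -> A) : hpoly n -> A :=
  match n with
  | 0%N => fun c => (nat_of_bin c)%:R
  | m.+1 => foldr (fun a v => heval (x \o succn) a + x 0%N * v) 0
  end.

Lemma nat_of_bin_add p q :
  nat_of_bin (BinNat.N.add p q) = (nat_of_bin p + nat_of_bin q)%N.
Proof. lia. Qed.

Lemma nat_of_bin_mul p q :
  nat_of_bin (BinNat.N.mul p q) = (nat_of_bin p * nat_of_bin q)%N.
Proof. lia. Qed.

Lemma nat_of_bin_leb p q : BinNat.N.leb p q -> (nat_of_bin p <= nat_of_bin q)%N.
Proof. lia. Qed.

Section Evaluation.
Variable A : comNzRingType.
Implicit Type x : nat -> A.

Lemma heval_zero n x : heval x (hzero n) = 0.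
Proof. by case: n. Qed.

Lemma heval_add n x (p q : hpoly n) : heval x (hadd p q) = heval x p + heval x q.
Proof.
elim: n x p q => [|n IHn] x /=; first by move=> p q; rewrite nat_of_bin_add natrD.
elim=> [|a p IHp] [|b q] /=; rewrite ?add0r ?addr0 // IHn IHp; ring.
Qed.

Lemma heval_cons n x (a : hpoly n) (p : hpoly n.+1) :
  heval x (a :: p : hpoly n.+1) = heval (x \o succn) a + x 0%N * heval x p.
Proof. by []. Qed.

Lemma heval_mul n x (p q : hpoly n) : heval x (hmul p q) = heval x p * heval x q.
Proof.
elim: n x p q => [|n IHn] x; first by move=> p q /=; rewrite nat_of_bin_mul natrM.
elim=> [|a p IHp] q; first by rewrite /= mul0r.
have hmap : heval x ([seq hmul a b | b <- q] : hpoly n.+1)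
    = heval (x \o succn) a * heval x (q : hpoly n.+1).
  elim: q => [|b q IHq]; first by rewrite /= mulr0.
  by rewrite map_cons !heval_cons IHn IHq; ring.
have -> : hmul (a :: p : hpoly n.+1) q
    = hadd ([seq hmul a b | b <- q] : hpoly n.+1) (hzero n :: hmul (p : hpoly n.+1) q).
  by [].
rewrite heval_add hmap !heval_cons heval_zero IHp; ring.
Qed.

Lemma heval_mono n x e : heval x (hmono n e) = \prod_(j < n) x j ^+ nth 0%N e j.
Proof.
elim: n x e => [|n IHn] x e; first by rewrite big_ord0.
have hn k (p : hpoly n) : heval x (ncons k (hzero n) [:: p] : hpoly n.+1)
    = x 0%N ^+ k * heval (x \o succn) p.
  elim: k => [|k IHk]; first by rewrite /= mulr0 addr0 mul1r.
  by rewrite -[ncons _ _ _]/(hzero n :: ncons k (hzero n) [:: p]) heval_cons IHk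
    heval_zero add0r exprS mulrA.
rewrite [hmono _ _]/= hn IHn big_ord_recl -nth0; congr (_ * _).
by apply: eq_bigr => j _; rewrite /= nth_behead.
Qed.

Variable N : A -> Prop.
Hypothesis hN : nonneg_cone N.

Lemma cone_nat k : N k%:R.
Proof.
elim: k => [|k IHk]; first exact: cone0 hN.
by rewrite -natr1; apply: (coneD hN) => //; apply: cone1 hN.
Qed.

Lemma heval_ge0 n x (p : hpoly n) : (forall j, N (x j)) -> N (heval x p).
Proof.
elim: n x p => [|n IHn] x p hx /=; first exact: cone_nat.
elim: p => [|a p IHp] /=; first exact: cone0 hN.
by apply: (coneD hN); [apply: IHn => j; apply: hx | apply: (coneM hN)].
Qed.

Lemma heval_le n x (p q : hpoly n) :
  (forall j, N (x j)) -> hle p q -> N (heval x q - heval x p).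
Proof.
elim: n x p q => [|n IHn] x p q hx.
  by move=> /= /nat_of_bin_leb h; rewrite -natrB //; apply: cone_nat.
elim: p q => [|a p IHp] q; first by rewrite /= subr0 => _; apply: (@heval_ge0 n.+1).
case: q => [|b q] /= /andP[hab hpq].
  have := IHp [::] hpq; have := IHn (x \o succn) _ _ (fun j => hx j.+1) hab.
  rewrite heval_zero /= => h1 h2.
  have -> : 0 - (heval (x \o succn) a + x 0%N * heval x (p : hpoly n.+1))
     = (0 - heval (x \o succn) a) + x 0%N * (0 - heval x (p : hpoly n.+1)) by ring.
  by apply: (coneD hN) => //; apply: (coneM hN).
have := IHp q hpq; have := IHn (x \o succn) _ _ (fun j => hx j.+1) hab.
move=> h1 h2.
have -> : heval (x \o succn) b + x 0%N * heval x (q : hpoly n.+1)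
   - (heval (x \o succn) a + x 0%N * heval x (p : hpoly n.+1))
   = (heval (x \o succn) b - heval (x \o succn) a)
     + x 0%N * (heval x (q : hpoly n.+1) - heval x (p : hpoly n.+1)) by ring.
by apply: (coneD hN) => //; apply: (coneM hN).
Qed.

End Evaluation.

Definition face_poly (k : nat) : hpoly 16 :=
  foldr (@hadd 16) (hzero 16) [seq hmono 16 e | e <- terms k].

Lemma heval_face_poly (A : comNzRingType) (x : nat -> A) k :
  heval x (face_poly k) = face_value x k.
Proof.
rewrite /face_poly /face_value; elim: (terms k) => [|e es IHe].
  by rewrite big_nil heval_zero.
by rewrite big_cons -IHe /term_value -heval_mono -heval_add.
Qed.

Definition face_polys : seq (hpoly 16) := [seq face_poly k | k <- iota 0 70].

Definition hprod (tab : seq (hpoly 16)) (m : seq nat) : hpoly 16 :=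
  foldr (fun k p => hmul (nth (hzero 16) tab k) p) (hmono 16 [::]) m.

Definition heq (n : nat) (p q : hpoly n) : bool := hle p q && hle q p.

Definition relation_holds (tab : seq (hpoly 16)) (r : relation3) : bool :=
  let: ((x, x'), (a, a'), (b, b')) := r in
  heq (hprod tab [:: x; x']) (hadd (hprod tab [:: a; a']) (hprod tab [:: b; b'])).

Definition ratio_subtraction_free (tab : seq (hpoly 16)) (r : seq nat * seq nat) :=
  hle (hprod tab r.1) (hprod tab r.2).

(** The only expansions of polynomials that are needed: the three-term relations
    and the three generators that [splittings] leaves out. *)
Lemma face_poly_checks :
  all (relation_holds face_polys) relations
  && all (ratio_subtraction_free face_polys) (take 3 (drop 8 generator_ranks)).
Proof. by vm_compute. Qed.

Lemma hle0 n (p : hpoly n) : hle (hzero n) p.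
Proof. by case: n p => [|n] // []. Qed.

Lemma heq_eval (A : comNzRingType) n (x : nat -> A) (p q : hpoly n) :
  heq p q -> heval x p = heval x q.
Proof.
elim: n x p q => [|n IHn] x.
  by move=> p q /andP[/= /nat_of_bin_leb h1 /nat_of_bin_leb h2]; congr _%:R; lia.
have z (p : hpoly n.+1) : hle p [::] -> heval x p = 0.
  elim: p => [//|a p IHp] /= /andP[ha /IHp]; rewrite /= => ->.
  by rewrite (IHn _ a (hzero n)) ?heval_zero ?mulr0 ?addr0 // /heq ha hle0.
elim=> [|a p IHp] [|b q] // /andP[h1 h2].
- by rewrite (z _ h2).
- by rewrite (z _ h1).
case/andP: h1 => ha1 hp1; case/andP: h2 => ha2 hp2.
by rewrite !heval_cons (IHn _ a b) ?(IHp q) //; apply/andP.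
Qed.

Lemma heval_face_table (A : comNzRingType) (x : nat -> A) k :
  heval x (nth (hzero 16) face_polys k) = face_value x k.
Proof.
rewrite /face_polys; case: (ltnP k 70) => hk.
  by rewrite (nth_map 0%N) ?size_iota // nth_iota // heval_face_poly.
rewrite nth_default ?size_map ?size_iota // heval_zero /face_value /terms.
by rewrite nth_default ?big_nil // exponent_tableE size_map.
Qed.

Lemma heval_hprod (A : comNzRingType) (x : nat -> A) tab (F : nat -> A) m :
  (forall k, heval x (nth (hzero 16) tab k) = F k) ->
  heval x (hprod tab m) = monomial F m.
Proof.
move=> hF; rewrite /monomial; elim: m => [|k m IHm].
  by rewrite big_nil heval_mono big1 // => j _; rewrite nth_nil.
by rewrite big_cons -IHm -hF -heval_mul.
Qed.

Lemma relation_holdsP (A : comNzRingType) (x : nat -> A) tab (F : nat -> A) r :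
  (forall k, heval x (nth (hzero 16) tab k) = F k) ->
  relation_holds tab r -> three_term F r.
Proof.
case: r => [[[k k'] [a a']] [b b']] hF; rewrite /relation_holds => /(heq_eval x).
by rewrite heval_add !(heval_hprod _ hF) /monomial !big_cons !big_nil !mulr1.
Qed.

Lemma ratio_subtraction_freeP (A : comNzRingType) (N : A -> Prop) (x : nat -> A)
    tab (F : nat -> A) r :
  (forall k, heval x (nth (hzero 16) tab k) = F k) ->
  nonneg_cone N -> (forall j, N (x j)) -> ratio_subtraction_free tab r ->
  N (monomial F r.2 - monomial F r.1).
Proof. 
move=> hF hN hx; rewrite /ratio_subtraction_free -!(heval_hprod _ hF) => hr.
exact: (heval_le hN hx hr).
Qed.

(** These are identities between polynomials with natural coefficients, so that one
    computation settles them in all commutative rings. *)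
Lemma face_value_plucker (A : comNzRingType) (x : nat -> A) :
  plucker_function (face_value x).
Proof.
have /andP[/allP h _] := face_poly_checks.
by move=> r /h; apply: relation_holdsP; apply: heval_face_table.
Qed.

Lemma face_value_ge0 (A : comNzRingType) (N : A -> Prop) (x : nat -> A) k :
  nonneg_cone N -> (forall j, N (x j)) -> N (face_value x k).
Proof. by move=> hN hx; rewrite -heval_face_poly; apply: heval_ge0. Qed.

(** The common source of both parts: by [splittings], or by expansion. *)
Lemma generator_subtraction_free (A : comNzRingType) (N : A -> Prop)
    (x : nat -> A) n :
  nonneg_cone N -> (forall j, N (x j)) -> (n < 20)%N ->
  let r := nth ([::], [::]) generator_ranks n in
  N (monomial (face_value x) r.2 - monomial (face_value x) r.1).
Proof.
move=> hN hx hn /=.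
case ht: (nth None splittings n) => [t|].
  apply: dominatesP (splittings_dominate ht) => //.
    by move=> k; apply: face_value_ge0.
  exact: face_value_plucker.
have /andP[_ /allP h] := face_poly_checks.
apply: (ratio_subtraction_freeP (heval_face_table x) hN hx); apply: h.
have {ht hn} : n \in [seq n <- iota 0 20 | ~~ nth None splittings n].
  by rewrite mem_filter ht mem_iota.
by rewrite (_ : [seq n <- _ | _] = [:: 8; 9; 10]%N) // !inE => /or3P[] /eqP ->.
Qed.

(** * Uniqueness and existence of Plücker functions *)

Definition factors (r : relation3) : seq nat :=
  let: ((x, x'), (a, a'), (b, b')) := r in [:: x; x'; a; a'; b; b'].

(** As no factor vanishes, a relation determines the value of a factor that is the
    only unknown one and occurs once. *)
Definition deduce (known : seq nat) (r : relation3) : seq nat :=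
  if [seq k <- factors r | k \notin known] is [:: k] then k :: known else known.

Definition deductions (known : seq nat) : seq nat :=
  iter 2 (fun s => foldl deduce s relations) known.

Lemma deduceP (R : realType) (P Q : nat -> R) known r :
  {in factors r, forall k, 0 < Q k} -> three_term P r -> three_term Q r ->
  {in known, P =1 Q} -> {in deduce known r, P =1 Q}.
Proof.
move=> hQ hPr hQr hk; rewrite /deduce.
case hf: [seq _ <- _ | _] => [//|k [|//]] j; rewrite inE => /orP[/eqP->{j}|/hk //].
have hin i : i \in factors r -> i != k -> P i = Q i.
  move=> hi hik; apply: hk; apply/negPn/negP => hni.
  have : i \in [seq k <- factors r | k \notin known] by rewrite mem_filter hni.
  by rewrite hf inE (negPf hik).
have huniq : count_mem k (factors r) = 1%N.
  have : k \in [seq k <- factors r | k \notin known] by rewrite hf mem_head.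
  rewrite mem_filter => /andP[hnk _].
  have -> : count_mem k (factors r) = count_mem k [seq k <- factors r | k \notin known].
    rewrite count_filter; apply: eq_count => i /=.
    by case: eqP => //= ->; rewrite hnk.
  by rewrite hf /= eqxx.
have neq i : i \in factors r -> Q i != 0 by move=> /hQ h; rewrite gt_eqF.
case: r hPr hQr hin huniq neq {hf hQ} => [[[x x'] [a a']] [b b']] /= hPr hQr hin huniq neq.
have nx : Q x != 0 by apply: neq; rewrite !inE eqxx ?orbT.
have nx' : Q x' != 0 by apply: neq; rewrite !inE eqxx ?orbT.
have na : Q a != 0 by apply: neq; rewrite !inE eqxx ?orbT.
have na' : Q a' != 0 by apply: neq; rewrite !inE eqxx ?orbT.
have nb : Q b != 0 by apply: neq; rewrite !inE eqxx ?orbT.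
have nb' : Q b' != 0 by apply: neq; rewrite !inE eqxx ?orbT.
have ex : (x == k) = false -> P x = Q x.
  by move=> /negbT; apply: hin; rewrite !inE eqxx ?orbT.
have ex' : (x' == k) = false -> P x' = Q x'.
  by move=> /negbT; apply: hin; rewrite !inE eqxx ?orbT.
have ea : (a == k) = false -> P a = Q a.
  by move=> /negbT; apply: hin; rewrite !inE eqxx ?orbT.
have ea' : (a' == k) = false -> P a' = Q a'.
  by move=> /negbT; apply: hin; rewrite !inE eqxx ?orbT.
have eb : (b == k) = false -> P b = Q b.
  by move=> /negbT; apply: hin; rewrite !inE eqxx ?orbT.
have eb' : (b' == k) = false -> P b' = Q b'.
  by move=> /negbT; apply: hin; rewrite !inE eqxx ?orbT.
move: huniq; case e1: (x == k) ex => ex; case e2: (x' == k) ex' => ex';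
  case e3: (a == k) ea => ea; case e4: (a' == k) ea' => ea';
  case e5: (b == k) eb => eb; case e6: (b' == k) eb' => eb' //= _.
- by move: hPr; rewrite (ex' erefl) (ea erefl) (ea' erefl) (eb erefl) (eb' erefl)
    -hQr -(eqP e1) => /(mulIf nx').
- by move: hPr; rewrite (ex erefl) (ea erefl) (ea' erefl) (eb erefl) (eb' erefl)
    -hQr -(eqP e2) => /(mulfI nx).
- by move: hPr; rewrite (ex erefl) (ex' erefl) (ea' erefl) (eb erefl) (eb' erefl)
    hQr -(eqP e3) => /addIr/(mulIf na').
- by move: hPr; rewrite (ex erefl) (ex' erefl) (ea erefl) (eb erefl) (eb' erefl)
    hQr -(eqP e4) => /addIr/(mulfI na).
- by move: hPr; rewrite (ex erefl) (ex' erefl) (ea erefl) (ea' erefl) (eb' erefl)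
    hQr -(eqP e5) => /addrI/(mulIf nb').
- by move: hPr; rewrite (ex erefl) (ex' erefl) (ea erefl) (ea' erefl) (eb erefl)
    hQr -(eqP e6) => /addrI/(mulfI nb).
Qed.

Lemma foldl_deduce (R : realType) (P Q : nat -> R) rs known :
  {in rs, forall r, [/\ {in factors r, forall k, 0 < Q k}, three_term P r & three_term Q r]} ->
  {in known, P =1 Q} -> {in foldl deduce known rs, P =1 Q}.
Proof.
elim: rs known => [|r rs IHrs] known hrs hk //=; apply: IHrs.
  by move=> r' hr'; apply: hrs; rewrite inE hr' orbT.
have [hQ hP hQ'] := hrs r (mem_head _ _).
exact: deduceP hQ hP hQ' hk.
Qed.

Lemma relation_factors r k : r \in relations -> k \in factors r -> (k < 70)%N.
Proof.
have : all (fun r => all (ltn^~ 70%N) (factors r)) relations by vm_compute.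
by move=> /allP h /h /allP; apply.
Qed.

Definition all_ranks (s : seq nat) : bool := all (mem s) (iota 0 70).

Lemma all_ranksP s k : all_ranks s -> (k < 70)%N -> k \in s.
Proof. by move=> /allP h hk; apply: h; rewrite mem_iota. Qed.

Lemma deductionsE known :
  deductions known = iter 2 (fun s => foldl deduce s relations) known.
Proof. by []. Qed.
Opaque deductions.

(** The values outside [known] are deduced one after the other. *)
Lemma plucker_function_unique (R : realType) (P Q : nat -> R) known :
  (forall k, (k < 70)%N -> 0 < Q k) -> plucker_function P -> plucker_function Q ->
  all_ranks (deductions known) ->
  {in known, P =1 Q} -> forall k, (k < 70)%N -> P k = Q k.
Proof.
move=> hQ hP hQ' hall hk k hk70.
suff h : {in deductions known, P =1 Q} by exact: h (all_ranksP hall hk70).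

rewrite deductionsE; elim: 2%N => [|n IHn]; first exact: hk.
rewrite iterS; apply: foldl_deduce; last exact: IHn.
move=> r hr; split; [|exact: hP|exact: hQ'].
move=> i hi; apply: hQ; exact: relation_factors hr hi.
Qed.

(** Coordinates with a single term, each with the position in [face_order] of a
    face that has exponent 1 in this term and exponent 0 in the following ones.
    Prescribing their values therefore leads to a triangular system of monomial
    equations for the face weights. *)
Definition cluster : seq (nat * nat) := [:: (69, 7); (65, 8); (55, 9); (35, 0);
  (34, 10); (31, 11); (25, 12); (15, 1); (14, 13); (12, 14); (9, 15); (5, 2);
  (4, 3); (3, 4); (2, 5); (1, 6)]%N.

Definition single_term (k : nat) : seq nat := head [::] (terms k).

Fixpoint triangular (s : seq (nat * nat)) : bool :=
  if s is (k, j) :: s' then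
    [&& (j < 16)%N, nth 0%N (single_term k) j == 1%N,
        all (fun p => nth 0%N (single_term p.1) j == 0%N) s' & triangular s']
  else true.

Lemma triangular_solvable (R : realType) (y : nat -> R) s :
  (forall k, (k < 70)%N -> 0 < y k) -> all (fun p => p.1 < 70)%N s -> triangular s ->
  exists x : nat -> R, (forall j, 0 < x j) /\
    {in s, forall p, term_value x (single_term p.1) = y p.1}.
Proof.
move=> hy; elim: s => [|[k j] s IHs] /=; first by exists (fun=> 1); split.
move=> /andP[hk hs] /and4P[hj /eqP he /allP h0 /(IHs hs)[x [hx hxs]]] {IHs}.
pose rest := \prod_(i < 16 | i != Ordinal hj) x i ^+ nth 0%N (single_term k) i.
have hrest : 0 < rest by apply: prodr_gt0 => i _; apply: exprn_gt0.
exists (fun i => if i == j then y k / rest else x i); split.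
  by move=> i; case: eqP => // _; rewrite divr_gt0 ?hy.
move=> p; rewrite inE => /orP[/eqP-> /=|hp].
  rewrite /term_value (bigD1 (Ordinal hj)) //= eqxx he expr1.
  rewrite (eq_bigr (fun i : 'I_16 => x i ^+ nth 0%N (single_term k) i)).
    by rewrite -/rest divfK // gt_eqF.
  by move=> i hi; rewrite ifN.
rewrite -(hxs p hp); apply: eq_bigr => i _; case: eqP => // ->.
by rewrite (eqP (h0 p hp)) !expr0.
Qed.

Lemma face_value_single (A : comNzRingType) (x : nat -> A) k :
  size (terms k) == 1%N -> face_value x k = term_value x (single_term k).
Proof.
rewrite /face_value /single_term; case: (terms k) => [|e [|]] //= _.
by rewrite big_seq1.
Qed.

Lemma terms0 : terms 0 = [:: nseq 16 0%N].
Proof. by vm_compute. Qed.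

Lemma face_value0 (A : comNzRingType) (x : nat -> A) : face_value x 0 = 1.
Proof.
rewrite face_value_single ?terms0 // /single_term terms0 /term_value.
by rewrite big1 // => i _; rewrite nth_nseq if_same.
Qed.

Lemma terms_nonempty k : (k < 70)%N -> terms k != [::].
Proof.
move=> hk; have : all (fun k => terms k != [::]) (iota 0 70) by vm_compute.
by move/allP; apply; rewrite mem_iota.
Qed.

Lemma term_value_gt0 (R : realType) (x : nat -> R) e :
  (forall j, 0 < x j) -> 0 < term_value x e.
Proof. by move=> hx; apply: prodr_gt0 => i _; apply: exprn_gt0. Qed.

Lemma face_value_gt0 (R : realType) (x : nat -> R) k :
  (forall j, 0 < x j) -> (k < 70)%N -> 0 < face_value x k.
Proof.
move=> hx /terms_nonempty; rewrite /face_value; case: (terms k) => // e es _.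
rewrite big_cons ltr_wpDr ?term_value_gt0 //.
by apply: sumr_ge0 => e' _; apply/ltW/term_value_gt0.
Qed.

Lemma cluster_determines :
  all_ranks (deductions (0%N :: [seq p.1 | p <- cluster])).
Proof. by vm_compute. Qed.

(** Positive face weights parametrize the positive Plücker functions: they are
    determined by the coordinates with a single term. *)
Lemma face_weights_exist (R : realType) (P : nat -> R) :
  plucker_function P -> (forall k, (k < 70)%N -> 0 < P k) ->
  exists x : nat -> R, (forall j, 0 < x j) /\
    forall k, (k < 70)%N -> P k = P 0%N * face_value x k.
Proof.
move=> hP hP0.
have h0 : 0 < P 0%N by apply: hP0.
have [x [hx hxs]] : exists x : nat -> R, (forall j, 0 < x j) /\
    {in cluster, forall p, term_value x (single_term p.1) = P p.1 / P 0%N}.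
  apply: (@triangular_solvable _ (fun k => P k / P 0%N)); [|by []|by vm_compute].
  by move=> k hk; rewrite divr_gt0 // hP0.
exists x; split; first exact: hx.
apply: (plucker_function_unique _ hP _ cluster_determines).
- by move=> k hk; rewrite mulr_gt0 // face_value_gt0.
- move=> [[[k k'] [a a']] [b b']] /(face_value_plucker x) /= h.
  by rewrite mulrACA h; ring.
move=> k; rewrite inE => /orP[/eqP->|/mapP[p hp ->]].
  by rewrite face_value0 mulr1.
rewrite face_value_single; first by rewrite (hxs p hp) mulrC divfK // gt_eqF.
have : all (fun p => size (terms p.1) == 1%N) cluster by vm_compute.
by move/allP; apply.
Qed.

(** These 16 coordinates are, up to sign, the entries of N in a matrix of the
    form (identity | N). *)
Definition exchange (i l : nat) : nat := rank4 (rcons (rem i.+1 (iota 1 4)) l).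

Lemma exchange_determines :
  all_ranks (deductions (0%N :: [seq exchange i l | i <- iota 0 4, l <- iota 5 4])).
Proof. by vm_compute. Qed.

(** The sign moves the new column from the last place to that of the omitted
    column of the identity. *)
Definition exchange_matrix (A : comNzRingType) (f : nat -> nat -> A) (l i : nat) : A :=
  if (l <= 4)%N then (i == l.-1)%:R else (-1) ^+ (3 - i) * f i l.

Lemma exchange_minor (A : comNzRingType) (f : nat -> nat -> A) i l :
  i \in iota 0 4 -> (4 < l)%N ->
  minor (exchange_matrix f) (rcons (rem i.+1 (iota 1 4)) l) = f i l.
Proof.
rewrite ltnNge => hi /negPf hl.
move: hi; rewrite !inE => /or4P[] /eqP ->;
  rewrite /minor /= /det4 /det2 /exchange_matrix /= hl /=; ring.
Qed.

(** A matrix whose minors are the polynomials in face weights: both solve the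
    three-term relations, and they agree on the exchange coordinates. *)
Definition weight_matrix (R : realType) (x : nat -> R) : nat -> nat -> R :=
  exchange_matrix (fun i l => face_value x (exchange i l)).

Lemma exchange_sets i l : i \in iota 0 4 -> l \in iota 5 4 ->
  nth [::] sets4 (exchange i l) = rcons (rem i.+1 (iota 1 4)) l.
Proof.
move=> hi hl; apply: nth_rank4.
have : all (fun i => all (fun l => rcons (rem i.+1 (iota 1 4)) l \in sets4) (iota 5 4))
  (iota 0 4) by vm_compute.
by move/allP/(_ i hi)/allP; apply.
Qed.

Lemma weight_matrix_minor (R : realType) (x : nat -> R) k :
  (forall j, 0 < x j) -> (k < 70)%N ->
  minor_rank (weight_matrix x) k = face_value x k.
Proof.
move=> hx; move: k.
apply: (plucker_function_unique _ (minor_plucker _) (face_value_plucker x) exchange_determines).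
  by move=> k; apply: face_value_gt0.
move=> k; rewrite inE => /orP[/eqP->|/allpairsP[[i l] /= [hi hl ->]]].
  rewrite face_value0 /minor_rank (_ : nth [::] sets4 0 = iota 1 4); last by vm_compute.
  rewrite /minor /= /det4 /det2 /weight_matrix /exchange_matrix /=; ring.
rewrite /minor_rank exchange_sets // exchange_minor //.
by move: hl; rewrite !inE; lia.
Qed.

(** * The double description method *)

Section Cones.
Variables (R : realType) (V : lmodType R).

(** The convex cone generated by G. *)
Inductive hull (G : V -> Prop) : V -> Prop :=
  | hull0 : hull G 0
  | hullS a g x : 0 <= a -> G g -> hull G x -> hull G (a *: g + x).

Lemma hull_gen G a g : 0 <= a -> G g -> hull G (a *: g).
Proof. by move=> ha hg; rewrite -[a *: g]addr0; apply: hullS => //; apply: hull0. Qed.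

Lemma hullD G x y : hull G x -> hull G y -> hull G (x + y).
Proof.
by move=> hx hy; elim: hx => [|a g z ha hg _ IH]; rewrite ?add0r // -addrA; apply: hullS.
Qed.

Lemma hullZ G a x : 0 <= a -> hull G x -> hull G (a *: x).
Proof.
move=> ha; elim=> [|b g z hb hg _ IH]; first by rewrite scaler0; apply: hull0.
by rewrite scalerDr scalerA; apply: hullS => //; apply: mulr_ge0.
Qed.

Lemma hull_closed G (Q : V -> Prop) : Q 0 ->
  (forall x y, Q x -> Q y -> Q (x + y)) ->
  (forall a x, 0 <= a -> Q x -> Q (a *: x)) ->
  (forall g, G g -> Q g) -> forall z, hull G z -> Q z.
Proof.
move=> h0 hD hZ hG z; elim=> // a g y ha hg _ IHy.
by apply: hD => //; apply: hZ => //; apply: hG.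
Qed.

Variable f : nat -> V -> R.
Hypothesis f_linear : forall i a x y, f i (a *: x + y) = a * f i x + f i y.

Lemma form0 i : f i 0 = 0.
Proof. by have := f_linear i 1 0 0; rewrite scale1r addr0 mul1r => /eqP; rewrite -subr_eq0 opprD addNKr oppr_eq0 => /eqP. Qed.

Lemma formZ i a x : f i (a *: x) = a * f i x.
Proof. by rewrite -[a *: x]addr0 f_linear form0 addr0. Qed.

Lemma formB i a x b y : f i (a *: x - b *: y) = a * f i x - b * f i y.
Proof. by rewrite f_linear -scaleNr formZ mulNr. Qed.

Definition nonneg (k : nat) (x : V) : Prop := forall i, (i < k)%N -> 0 <= f i x.

(** For x in the cone: y lies in the linear span of the smallest face containing x. *)
Definition tight_sub (k : nat) (x y : V) : Prop :=
  forall i, (i < k)%N -> f i x = 0 -> f i y = 0.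

Definition slack_count (k : nat) (x : V) : nat :=
  count (fun i => f i x != 0) (iota 0 k).

Lemma slack_count_le k x y : tight_sub k x y -> (slack_count k y <= slack_count k x)%N.
Proof.
move=> h; rewrite /slack_count.
have : {in iota 0 k, forall i, f i y != 0 -> f i x != 0}.
  by move=> i; rewrite mem_iota => /= hi; apply: contra_neq; apply: h.
elim: (iota 0 k) => //= i s IHs hs; apply: leq_add.
  by have := hs i (mem_head _ _); case: (f i y != 0) => // ->.
by apply: IHs => j hj; apply: hs; rewrite inE hj orbT.
Qed.

(** The measure for the inductions: it drops when one passes to a smaller face. *)
Lemma slack_count_lt k x y i : tight_sub k x y -> (i < k)%N -> f i x != 0 ->
  f i y = 0 -> (slack_count k y < slack_count k x)%N.
Proof.
move=> h hik hx hy; rewrite /slack_count.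
have : {in iota 0 k, forall i, f i y != 0 -> f i x != 0}.
  by move=> j; rewrite mem_iota => /= hj; apply: contra_neq; apply: h.
have : i \in iota 0 k by rewrite mem_iota.
elim: (iota 0 k) => //= j s IHs; rewrite inE => /orP[/eqP <-|his] hs.
  rewrite hx hy eqxx /= add0n add1n ltnS.
  have {}hs : {in s, forall i, f i y != 0 -> f i x != 0}.
    by move=> l hl; apply: hs; rewrite inE hl orbT.
  elim: s hs {IHs} => //= l s IHs hs; apply: leq_add.
    by have := hs l (mem_head _ _); case: (f l y != 0) => // ->.
  by apply: IHs => m hm; apply: hs; rewrite inE hm orbT.
rewrite -addnS; apply: leq_add.
  by have := hs j (mem_head _ _); case: (f j y != 0) => // ->.
by apply: IHs => // l hl; apply: hs; rewrite inE hl orbT.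
Qed.

Lemma tight_sub_eq k x y : tight_sub k x y ->
  (slack_count k x <= slack_count k y)%N -> tight_sub k y x.
Proof.
move=> h hle i hi hy; apply/eqP/negPn/negP => hx.
by have := slack_count_lt h hi hx hy; rewrite ltnNge hle.
Qed.

(** The largest multiple of [d] that can be subtracted from [x] makes a further
    constraint tight. *)
Lemma subtract k x d : nonneg k x -> nonneg k d -> tight_sub k x d ->
  (exists2 i, (i < k)%N & f i d != 0) ->
  exists t y, [/\ 0 <= t, x = t *: d + y, nonneg k y, tight_sub k x y &
                  (slack_count k y < slack_count k x)%N].
Proof.
move=> hx hd hxd [i0 hi0 hd0].
have hpos0 : 0 < f i0 d by rewrite lt0r hd0 hd.
pose P (i : 'I_k) := 0 < f i d.
have [j hj hmin] := @arg_minP _ R _ (Ordinal hi0) P (fun i => f i x / f i d) hpos0.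
have hj0 : f j d != 0 by rewrite gt_eqF.
have ht : 0 <= f j x / f j d by rewrite divr_ge0 ?hx ?hd.
pose y := 1 *: x - (f j x / f j d) *: d.
have hfy i : f i y = f i x - f j x / f j d * f i d by rewrite formB mul1r.
have hxy : tight_sub k x y.
  by move=> i hi h; rewrite hfy h (hxd i hi h) mulr0 subr0.
exists (f j x / f j d), y; split=> //.
- by rewrite /y scale1r addrC subrK.
- move=> i hi; rewrite hfy subr_ge0; have := hd i hi.
  rewrite le0r => /orP[/eqP ->|hpos]; first by rewrite mulr0 hx.
  by rewrite -ler_pdivlMr // (hmin (Ordinal hi)).
apply: (slack_count_lt (i := j)) => //.
  by apply: contra_neq hj0; apply: hxd.
by rewrite hfy divfK // subrr.
Qed.

(** Let x lie in the new cone, and consider the generators in [G] on the smallest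
    face of the old cone that contains x. If one of them lies on the smallest
    face of the new cone that contains x, a multiple of it can be subtracted from
    x, and x moves to a smaller face. Otherwise f k x = 0, there are generators p and m on that face on the two
    sides of the hyperplane f k = 0, and the combination c of p and m on the
    hyperplane can be subtracted from x. It is in [G'] unless a third generator g
    lies on the smallest face containing p and m. In that case the combination d
    of g with p or m is not proportional to c, because [G] is irredundant. So if c
    lies on no smaller face than x, subtracting a multiple of d from c leaves a
    nonzero vector on a smaller face, to which the induction applies. *)
Theorem double_description_step (k : nat) (G G' : V -> Prop) :
  (forall x, nonneg k x -> hull G x) ->
  (forall g, G g -> nonneg k g) ->
  (forall x, (forall i, (i < k)%N -> f i x = 0) -> x = 0) ->
  (forall g g', G g -> G g' -> tight_sub k g g' -> g = g') ->
  (forall g, G g -> 0 <= f k g -> G' g) ->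
  (forall p n, G p -> G n -> 0 < f k p -> f k n < 0 ->
     G' (f k p *: n - f k n *: p) \/
     exists g, [/\ G g, g <> p, g <> n &
       forall i, (i < k)%N -> f i p = 0 -> f i n = 0 -> f i g = 0]) ->
  forall x, nonneg k.+1 x -> hull G' x.
Proof.
move=> hspan hG hpt hirr hkeep hcomb x.
have nonnegS y : nonneg k.+1 y -> nonneg k y by move=> hy i hi; apply: hy; apply: ltnW.
have pt y : y <> 0 -> exists2 i, (i < k)%N & f i y != 0.
  move=> hy; apply: contrapT => h; apply: hy; apply: hpt => i hi; apply/eqP.
  by apply/negPn/negP => hf; apply: h; exists i.
have ptS y : y <> 0 -> exists2 i, (i < k.+1)%N & f i y != 0.
  by move=> /pt[i hi hf]; exists i => //; apply: ltnW.
have [n] := ubnP (slack_count k.+1 x).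
elim: n x => // n IHn x; rewrite ltnS => hn hx.
have [->|/eqP hx0] := eqVneq x 0; first exact: hull0.
have IH d : nonneg k.+1 d -> tight_sub k.+1 x d -> d <> 0 -> hull G' d -> hull G' x.
  move=> hd hxd hd0 hspd.
  have [t [y [ht ex hy hxy hlt]]] := subtract hx hd hxd (ptS d hd0).
  rewrite ex; apply: hullD; first exact: hullZ.
  by apply: IHn => //; apply: leq_trans hlt hn.
(* The generators on the smallest face that contains x. *)
pose Gx g := G g /\ tight_sub k x g.
have span_face z : hull G z -> tight_sub k x z -> hull Gx z.
  elim=> [|a g y ha hg hy IHy] hsub; first exact: hull0.
  have hy0 : nonneg k y.
    elim: hy => [|b g' z' hb hg' _ IH'] i hi; first by rewrite form0.
    by rewrite f_linear addr_ge0 ?mulr_ge0 ?IH' // hG.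
  have hparts i : (i < k)%N -> f i x = 0 -> a * f i g = 0 /\ f i y = 0.
    move=> hi hfx; have /eqP := hsub i hi hfx; rewrite f_linear.
    rewrite paddr_eq0 ?hy0 //; last by rewrite mulr_ge0 // hG.
    by move=> /andP[/eqP -> /eqP ->].
  have hspy : hull Gx y by apply: IHy => i hi /(hparts i hi)[].
  have [->|ha0] := eqVneq a 0; first by rewrite scale0r add0r.
  apply: hullS => //; split=> // i hi /(hparts i hi)[/eqP].
  by rewrite mulf_eq0 (negPf ha0) => /eqP.
have hGx : hull Gx x by apply: span_face => //; apply: hspan; apply: nonnegS.
have [[g [[hg hgx] hg0 hgk]]|hnog] :=
    EM (exists g, [/\ Gx g, g <> 0 & 0 <= f k g /\ (f k x = 0 -> f k g = 0)]).
  case: hgk => hgk hgxk; apply: (IH g) => //.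
  - by move=> i; rewrite ltnS leq_eqVlt => /orP[/eqP -> //|hi]; apply: hG.
  - move=> i; rewrite ltnS leq_eqVlt => /orP[/eqP -> //|hi]; exact: hgx.
  - by rewrite -[g]scale1r; apply: hull_gen => //; apply: hkeep.
(* Now the generators on that face lie strictly on both sides of f k = 0. *)
have hxk : f k x = 0.
  apply/eqP/negPn/negP => hne.
  have : f k x <= 0.
    apply: (hull_closed (Q := fun z => f k z <= 0)) hGx.
    - by rewrite form0.
    - by move=> y z hy hz; rewrite -[y]scale1r f_linear mul1r -[0]addr0 lerD.
    - by move=> a y ha hy; rewrite formZ mulr_ge0_le0.
    move=> g hg; rewrite leNgt; apply/negP => hpos; apply: hnog; exists g.
    split=> //; first by move=> h; move: hpos; rewrite h form0 ltxx.
    by split; [exact: ltW | move=> h; rewrite h eqxx in hne].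
  by rewrite le_eqVlt (negPf hne) ltNge hx.
have hne g : Gx g -> g <> 0 -> f k g != 0.
  move=> hg hg0; apply/eqP => h; apply: hnog; exists g; split=> //.
  by split=> [|_]; rewrite h.
have fD y z : f k (y + z) = f k y + f k z by rewrite -[y in LHS]scale1r f_linear mul1r.
have [p hp hpk] : exists2 p, Gx p & 0 < f k p.
  apply: contrapT => hno.
  suff [] : x = 0 \/ f k x < 0 by [|rewrite hxk ltxx].
  apply: (hull_closed (Q := fun z => z = 0 \/ f k z < 0)) hGx.
  - by left.
  - move=> y z [->|hy] [->|hz]; rewrite ?add0r ?addr0; [by left|by right|by right|].
    by right; rewrite fD -[0]addr0 ltrD.
  - move=> a y ha [->|hy]; first by left; rewrite scaler0.
    have [->|ha0] := eqVneq a 0; first by left; rewrite scale0r.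
    by right; rewrite formZ pmulr_rlt0 // lt0r ha0.
  move=> g hg; have [->|/eqP hg0] := eqVneq g 0; [by left|right].
  rewrite lt_neqAle hne //= leNgt; apply/negP => h; apply: hno; by exists g.
have [m hm hmk] : exists2 m, Gx m & f k m < 0.
  apply: contrapT => hno.
  suff [] : x = 0 \/ 0 < f k x by [|rewrite hxk ltxx].
  apply: (hull_closed (Q := fun z => z = 0 \/ 0 < f k z)) hGx.
  - by left.
  - move=> y z [->|hy] [->|hz]; rewrite ?add0r ?addr0; [by left|by right|by right|].
    by right; rewrite fD addr_gt0.
  - move=> a y ha [->|hy]; first by left; rewrite scaler0.
    have [->|ha0] := eqVneq a 0; first by left; rewrite scale0r.
    by right; rewrite formZ pmulr_rgt0 // lt0r ha0.
  move=> g hg; have [->|/eqP hg0] := eqVneq g 0; [by left|right].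
  rewrite lt0r hne //= leNgt; apply/negP => h; apply: hno; by exists g.
pose comb u v := f k u *: v - f k v *: u.
have comb_k u v : f k (comb u v) = 0 by rewrite formB mulrC subrr.
have pos_neg u v i : (i < k)%N -> G u -> G v -> 0 < f k u -> f k v < 0 ->
    0 <= f k u * f i v /\ f k v * f i u <= 0.
  move=> hi hu hv hu0 hv0; split; first by apply: mulr_ge0; [exact: ltW|exact: hG].
  by apply: mulr_le0_ge0; [exact: ltW|exact: hG].
have comb_ge0 u v : G u -> G v -> 0 < f k u -> f k v < 0 -> nonneg k.+1 (comb u v).
  move=> hu hv hu0 hv0 i; rewrite ltnS leq_eqVlt => /orP[/eqP ->|hi].
    by rewrite comb_k.
  have [h1 h2] := pos_neg u v i hi hu hv hu0 hv0.
  by rewrite formB subr_ge0 (le_trans h2 h1).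
have comb_tight u v : tight_sub k x u -> tight_sub k x v -> tight_sub k.+1 x (comb u v).
  move=> hu hv i; rewrite ltnS leq_eqVlt => /orP[/eqP -> _|hi h]; first exact: comb_k.
  by rewrite formB (hu i) // (hv i) // !mulr0 subrr.
have comb_neq0 u v : G u -> G v -> 0 < f k u -> f k v < 0 -> comb u v <> 0.
  move=> hu hv hu0 hv0 h0; suff u0 : u = 0 by move: hu0; rewrite u0 form0 ltxx.
  apply: hpt => i hi; have [h1 h2] := pos_neg u v i hi hu hv hu0 hv0.
  have /eqP : f i (comb u v) = 0 by rewrite h0 form0.
  rewrite formB subr_eq0 => /eqP h; rewrite h in h1.
  have /eqP : f k v * f i u = 0 by apply/eqP; rewrite eq_le h2 h1.
  by rewrite mulf_eq0 (lt_eqF hv0) => /eqP.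
(* Irredundancy: no generator of the face is a combination of two others. *)
have indep t u g w r : 0 < t -> G u -> G g -> G w -> g <> u ->
    (forall i, (i < k)%N -> t * f i g = f i u + r * f i w) -> False.
  move=> ht hu hg hw hgu he; apply: hgu.
  have [hr|hr] := leP 0 r.
    apply: hirr => // i hi hgi.
    have /esym/eqP := he i hi; rewrite hgi mulr0 paddr_eq0 ?hG //.
      by move=> /andP[/eqP].
    by rewrite mulr_ge0 ?hG.
  apply/esym; apply: hirr => // i hi hui.
  have := he i hi; rewrite hui add0r => htg.
  have h1 : 0 <= t * f i g by apply: mulr_ge0; [exact: ltW|exact: hG].
  have h2 : t * f i g <= 0 by rewrite htg; apply: mulr_le0_ge0; [exact: ltW|exact: hG].
  have /eqP : t * f i g = 0 by apply/eqP; rewrite eq_le h2 h1.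
  by rewrite mulf_eq0 (gt_eqF ht) => /eqP.
pose c := comb p m.
case: hp => hpG hpx; case: hm => hmG hmx.
have hc0 : c <> 0 by apply: comb_neq0.
have hc : nonneg k.+1 c by apply: comb_ge0.
have hxc : tight_sub k.+1 x c by apply: comb_tight.
have [hc'|[g [hgG hgp hgm hpmg]]] := hcomb p m hpG hmG hpk hmk.
  by apply: (IH c) => //; rewrite -[c]scale1r; apply: hull_gen.
have hgx : tight_sub k x g by move=> i hi h; apply: hpmg; [|exact: hpx|exact: hmx].
have hg0 : g <> 0.
  by move=> g0; apply: hgp; apply/esym; apply: hirr => // i hi _; rewrite g0 form0.
have [hlt|hge] := ltnP (slack_count k.+1 c) (slack_count k.+1 x).
  by apply: (IH c) => //; apply: IHn => //; apply: leq_trans hlt hn.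
have hcx : tight_sub k.+1 c x by apply: tight_sub_eq.
have [d [hd hxd hd0 hcd]] : exists d, [/\ nonneg k.+1 d, tight_sub k.+1 x d, d <> 0 &
    forall t, 0 < t -> c <> t *: d].
  have := hne g (conj hgG hgx) hg0; rewrite neq_lt => /orP[hgk|hgk].
    exists (comb p g); split; [exact: comb_ge0|exact: comb_tight|exact: comb_neq0|].
    move=> t ht e; apply: (indep t m g p ((t * f k g - f k m) / f k p)) => //.
    move=> i hi; have : f i c = f i (t *: comb p g) by rewrite e.
    rewrite formZ !formB => h; have hp0 : f k p != 0 by rewrite gt_eqF.
    apply: (mulfI hp0); rewrite mulrDr [in RHS]mulrA [f k p * (_ / _)]mulrC divfK //.
    lra.
  exists (comb g m); split; [exact: comb_ge0|exact: comb_tight|exact: comb_neq0|].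
  move=> t ht e; apply: (indep t p g m ((t * f k g - f k p) / f k m)) => //.
  move=> i hi; have : f i c = f i (t *: comb g m) by rewrite e.
  rewrite formZ !formB => h; have hm0 : f k m != 0 by rewrite lt_eqF.
  apply: (mulfI hm0); rewrite mulrDr [in RHS]mulrA [f k m * (_ / _)]mulrC divfK //.
  lra.
have hcd' : tight_sub k.+1 c d by move=> i hi h; apply: hxd => //; apply: hcx.
have [t [y [ht ec hy hcy hlt]]] := subtract hc hd hcd' (ptS d hd0).
apply: (IH y) => //.
- by move=> i hi h; apply: hcy => //; apply: hxc.
- move=> y0; have [t0|t0] := eqVneq t 0.
    by apply: hc0; rewrite ec y0 t0 scale0r addr0.
  by apply: (hcd t); rewrite ?lt0r ?t0 // ec y0 addr0.
- apply: IHn => //; apply: leq_trans hn; apply: leq_trans hlt _.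
  exact: slack_count_le.
Qed.
End Cones.

(** * The double description algorithm *)

Notation Z := BinNums.Z.
Notation Z0 := BinNums.Z0.

Fixpoint dotZ (u v : seq Z) : Z :=
  match u, v with
  | x :: u', y :: v' => BinInt.Z.add (BinInt.Z.mul x y) (dotZ u' v')
  | _, _ => Z0
  end.

Fixpoint combZ (a : Z) (u : seq Z) (b : Z) (v : seq Z) : seq Z :=
  match u, v with
  | x :: u', y :: v' =>
      BinInt.Z.add (BinInt.Z.mul a x) (BinInt.Z.mul b y) :: combZ a u' b v'
  | _, _ => [::]
  end.

Lemma size_combZ a u b v : size u = size v -> size (combZ a u b v) = size u.
Proof. by elim: u v => [|x u IHu] [|y v] //= [/IHu ->]. Qed.

Lemma dotZ_comb a u b v w : size u = size v ->
  dotZ w (combZ a u b v) = a * dotZ w u + b * dotZ w v.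
Proof.
elim: w u v => [|z w IHw] u v; first by rewrite !mulr0 addr0.
case: u v => [|x u] [|y v] //=; first by rewrite !mulr0 addr0.
move=> [/IHw ->]; rewrite /GRing.add /GRing.mul /=; lia.
Qed.

(** The set of constraints that are tight at a ray, the most recent one first, so
    that it is updated by adding a constructor. A type of its own makes the
    comparisons, which dominate the computation, faster than lists of Booleans. *)
Inductive mask : Type := Mend | Mtight of mask | Mslack of mask.

Fixpoint mask_bits (m : mask) : seq bool :=
  match m with
  | Mend => [::] | Mtight m' => true :: mask_bits m' | Mslack m' => false :: mask_bits m'
  end.

Lemma mask_bitsK :
  cancel mask_bits (foldr (fun b => if b : bool then Mtight else Mslack) Mend).
Proof. by elim=> //= m ->. Qed.

HB.instance Definition _ := Equality.copy mask (can_type mask_bitsK).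

Fixpoint submask (a b : mask) : bool :=
  match a, b with
  | Mtight a', Mtight b' => submask a' b'
  | Mtight _, _ => false
  | Mslack a', Mtight b' => submask a' b'
  | Mslack a', Mslack b' => submask a' b'
  | _, _ => true
  end.

Fixpoint meet (a b : mask) : mask :=
  match a, b with
  | Mtight a', Mtight b' => Mtight (meet a' b')
  | Mtight a', Mslack b' => Mslack (meet a' b')
  | Mslack a', Mtight b' => Mslack (meet a' b')
  | Mslack a', Mslack b' => Mslack (meet a' b')
  | _, _ => Mend
  end.

Fixpoint eq_mask (a b : mask) : bool :=
  match a, b with
  | Mtight a', Mtight b' => eq_mask a' b'
  | Mslack a', Mslack b' => eq_mask a' b'
  | Mend, Mend => true
  | _, _ => false
  end.

Lemma eq_maskE a b : eq_mask a b = (a == b).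
Proof.
apply/idP/eqP => [|->]; last by elim: b.
by elim: a b => [|a IHa|a IHa] [|b|b] //= /IHa ->.
Qed.

(** A ray: its coordinates, the values of the constraints that are still to be
    processed, and the constraints that are tight among the processed ones. *)
Definition ray : Type := (seq Z * seq Z * mask)%type.

Definition slack (r : ray) : Z := head Z0 r.1.2.

Definition update (tight : bool) (r : ray) : ray :=
  (r.1.1, behead r.1.2, if tight then Mtight r.2 else Mslack r.2).

(** The combination of p and n at which the next constraint is tight. Other
    constraints are tight there if and only if they are so at p and n. *)
Definition combine (p n : ray) : ray :=
  let a := BinInt.Z.opp (slack n) in let b := slack p in
  (combZ a p.1.1 b n.1.1, combZ a (behead p.1.2) b (behead n.1.2),
   Mtight (meet p.2 n.2)).

(** The mask [g] belongs to a third generator on the smallest face that contains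
    the generators with masks [mp] and [mn]. Conditionals are evaluated lazily,
    unlike Boolean operations, which saves most of the comparisons. *)
Definition third (mp mn g : mask) : bool :=
  if submask (meet mp mn) g then (if eq_mask g mp then false else ~~ eq_mask g mn)
  else false.

(** A successful witness is moved to the front of the list of candidates, since
    it is likely to be one for the next pair as well. *)
Fixpoint witness (m mp mn : mask) (cand : seq mask) : option (mask * seq mask) :=
  if cand is g :: c then
    if (if submask m g then (if eq_mask g mp then false else ~~ eq_mask g mn) else false)
    then Some (g, c)
    else if witness m mp mn c is Some (w, c') then Some (w, g :: c') else None
  else None.

Fixpoint combinations (cand : seq mask) (ps : seq (ray * ray)) : seq ray :=
  if ps is (p, n) :: ps' then
    if witness (meet p.2 n.2) p.2 n.2 cand is Some (w, c) then combinations (w :: c) ps'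
    else combine p n :: combinations cand ps'
  else [::].

Definition dd_step (G : seq ray) : seq ray :=
  let pos := [seq r <- G | BinInt.Z.ltb Z0 (slack r)] in
  let neg := [seq r <- G | BinInt.Z.ltb (slack r) Z0] in
  let zer := [seq r <- G | BinInt.Z.eqb Z0 (slack r)] in
  [seq update true r | r <- zer]
  ++ combinations [seq r.2 | r <- G] [seq (p, n) | p <- pos, n <- neg]
  ++ [seq update false r | r <- pos].

Lemma witnessP mp mn cand :
  if witness (meet mp mn) mp mn cand is Some (w, c)
  then third mp mn w /\ (w :: c =i cand)
  else ~~ has (third mp mn) cand.
Proof.
elim: cand => [|g cand IHc] //=; rewrite -/(third mp mn g).
case: ifP => [hg|hg]; first by split.
case: (witness _ _ _ _) IHc => [[w c] [hw hc]|] //; split=> // m.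
by rewrite !inE orbCA -[in RHS]hc inE.
Qed.

Lemma combinationsP cand ps r :
  reflect (exists p n, [/\ (p, n) \in ps, ~~ has (third p.2 n.2) cand & r = combine p n])
          (r \in combinations cand ps).
Proof.
elim: ps cand => [|[p n] ps IHps] cand /=; first by apply: ReflectF => -[p [n []]].
have := witnessP p.2 n.2 cand.
case: (witness _ _ _ _) => [[w c] [hw hc]|hno].
  apply: (iffP (IHps _)) => -[p' [n' [hpn hh ->]]].
    by exists p', n'; split=> //; [rewrite inE hpn orbT | rewrite -(eq_has_r hc)].
  exists p', n'; split=> //; last by rewrite (eq_has_r hc).
  move: hpn; rewrite inE => /orP[/eqP[ep en]|//].
  by move: hh; rewrite ep en -(eq_has_r hc) /= hw.
rewrite inE; apply: (iffP orP) => [[/eqP ->|/IHps[p' [n' [h1 h2 ->]]]]|].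
- by exists p, n; rewrite mem_head.
- by exists p', n'; rewrite inE h1 orbT.
case=> p' [n' [+ h2 er]]; rewrite inE => /orP[/eqP[ep en]|h1].
  by left; rewrite er ep en.
by right; apply/IHps; exists p', n'.
Qed.

Arguments BinInt.Z.eqb : simpl never.
Arguments BinInt.Z.ltb : simpl never.

Section Algorithm.
Variables (d : nat) (rows : seq (seq Z)).
Hypothesis size_rows : all (fun r => size r == d) rows.

Definition dot_row (i : nat) (v : seq Z) : Z := dotZ (nth [::] rows i) v.

Fixpoint tight_mask (k : nat) (v : seq Z) : mask :=
  if k is k'.+1 then
    if BinInt.Z.eqb Z0 (dot_row k' v) then Mtight (tight_mask k' v)
    else Mslack (tight_mask k' v)
  else Mend.

Definition tight_subZ (k : nat) (u v : seq Z) : Prop :=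
  forall i, (i < k)%N -> dot_row i u = 0 -> dot_row i v = 0.

Lemma meet_tight k u v w :
  reflect (forall i, (i < k)%N -> dot_row i u = 0 -> dot_row i v = 0 -> dot_row i w = 0)
    (submask (meet (tight_mask k u) (tight_mask k v)) (tight_mask k w)).
Proof.
elim: k => [|k IHk] /=; first by apply: ReflectT.
have e x : reflect (dot_row k x = 0) (BinInt.Z.eqb Z0 (dot_row k x)).
  by rewrite -[BinInt.Z.eqb _ _]/(0 == dot_row k x) eq_sym; apply: eqP.
have hE : (forall i, (i < k.+1)%N -> dot_row i u = 0 -> dot_row i v = 0 -> dot_row i w = 0) <->
    (forall i, (i < k)%N -> dot_row i u = 0 -> dot_row i v = 0 -> dot_row i w = 0) /\
    (dot_row k u = 0 -> dot_row k v = 0 -> dot_row k w = 0).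
  split=> [h|[h hk] i]; first by split=> [i hi|]; apply: h; rewrite ?ltnS // ltnW.
  by rewrite ltnS leq_eqVlt => /orP[/eqP -> //|]; apply: h.
case: (e u) => hu; case: (e v) => hv; case: (e w) => hw /=.
all: try by apply: (iffP IHk) => [h|/hE[]//]; apply/hE; split.
by apply: ReflectF => /hE[_ /(_ hu hv)].
Qed.

Lemma meet_tight_mask k u v w :
  (forall i, (i < k)%N -> (dot_row i w == 0) = (dot_row i u == 0) && (dot_row i v == 0)) ->
  meet (tight_mask k u) (tight_mask k v) = tight_mask k w.
Proof.
elim: k => //= k IHk he; rewrite -IHk; last by move=> i hi; apply: he; apply: ltnW.
have ee x : BinInt.Z.eqb Z0 x = (x == 0) by rewrite eq_sym.
by rewrite !ee he //; case: eqP; case: eqP.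
Qed.

Lemma meetxx m : meet m m = m.
Proof. by elim: m => //= m ->. Qed.

Lemma tight_maskP k u v :
  reflect (tight_subZ k u v) (submask (tight_mask k u) (tight_mask k v)).
Proof.
rewrite -{1}(meetxx (tight_mask k u)).
by apply: (iffP (meet_tight k u u v)) => h i hi; [move=> hu; apply: h|move=> hu _; apply: h].
Qed.

Lemma tight_mask_eq k u v : tight_mask k u = tight_mask k v -> tight_subZ k u v.
Proof. by move=> e; apply/tight_maskP; rewrite -e; elim: (tight_mask k u). Qed.

Definition ray_ok (k : nat) (r : ray) : Prop :=
  [/\ size r.1.1 = d, r.1.2 = [seq dotZ row r.1.1 | row <- drop k rows],
      r.2 = tight_mask k r.1.1 & forall i, (i < k)%N -> 0 <= dot_row i r.1.1].

Definition irredundant (k : nat) (G : seq ray) : Prop :=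
  {in G &, forall r r' : ray, tight_subZ k r.1.1 r'.1.1 -> r.1.1 = r'.1.1}.

Lemma drop_rows k : (k < size rows)%N -> drop k rows = nth [::] rows k :: drop k.+1 rows.
Proof. exact: drop_nth. Qed.

Lemma slackE k r : (k < size rows)%N -> ray_ok k r -> slack r = dot_row k r.1.1.
Proof. by move=> hk [_ + _ _]; rewrite /slack => ->; rewrite drop_rows. Qed.

Lemma beheadE k r : (k < size rows)%N -> ray_ok k r ->
  behead r.1.2 = [seq dotZ row r.1.1 | row <- drop k.+1 rows].
Proof. by move=> hk [_ -> _ _]; rewrite drop_rows. Qed.

Lemma update_ok k r b : (k < size rows)%N -> ray_ok k r ->
  0 <= dot_row k r.1.1 -> b = (dot_row k r.1.1 == 0) -> ray_ok k.+1 (update b r).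
Proof.
move=> hk hr h0 hb; have [h1 h2 h3 h4] := hr; split=> //=.
- exact: beheadE.
- by rewrite -[BinInt.Z.eqb _ _]/(0 == dot_row k r.1.1) eq_sym -hb h3.
- by move=> i; rewrite ltnS leq_eqVlt => /orP[/eqP -> //|]; apply: h4.
Qed.

Lemma form_combine k p n i : (k < size rows)%N -> ray_ok k p -> ray_ok k n ->
  dot_row i (combine p n).1.1 = - dot_row k n.1.1 * dot_row i p.1.1 + dot_row k p.1.1 * dot_row i n.1.1.
Proof.
move=> hk hp hn; rewrite /dot_row /combine /= dotZ_comb; last by case: hp => ->; case: hn.
by rewrite (slackE hk hp) (slackE hk hn).
Qed.

Lemma combine_ok k p n : (k < size rows)%N -> ray_ok k p -> ray_ok k n ->
  0 < dot_row k p.1.1 -> dot_row k n.1.1 < 0 -> ray_ok k.+1 (combine p n).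
Proof.
move=> hk hp hn hp0 hn0.
have fE := form_combine _ hk hp hn.
have [sp _ mp gp] := hp; have [sn _ mn gn] := hn.
split.
- by rewrite /= size_combZ // sp sn.
- rewrite /= (beheadE hk hp) (beheadE hk hn) (slackE hk hp) (slackE hk hn).
  elim: (drop k.+1 rows) => //= row rs ->; by rewrite dotZ_comb // sp sn.
- rewrite /= -/(dot_row k _) (_ : dot_row k _ = 0); last first.
    by rewrite [dot_row k _](fE k); ring.
  rewrite /= mp mn; congr Mtight.
  apply: meet_tight_mask => i hi; rewrite [dot_row i _](fE i) paddr_eq0.
  - by rewrite !mulf_eq0 oppr_eq0 (lt_eqF hn0) (gt_eqF hp0).
  - by rewrite mulr_ge0 ?gp // oppr_ge0 ltW.
  - by rewrite mulr_ge0 ?gn // ltW.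
- move=> i; rewrite ltnS leq_eqVlt => /orP[/eqP ->|hi]; rewrite fE.
    by rewrite mulNr mulrC addrC subrr.
  apply: addr_ge0; first by rewrite mulr_ge0 ?gp // oppr_ge0 ltW.
  by rewrite mulr_ge0 ?gn // ltW.
Qed.

Lemma stepP k G r : (k < size rows)%N -> {in G, forall r, ray_ok k r} ->
  r \in dd_step G <->
  [\/ exists2 z, z \in G /\ dot_row k z.1.1 = 0 & r = update true z,
      exists p n, [/\ [/\ p \in G, n \in G, 0 < dot_row k p.1.1 & dot_row k n.1.1 < 0],
         {in G, forall g : ray, ~~ third p.2 n.2 g.2} & r = combine p n] |
      exists2 p, p \in G /\ 0 < dot_row k p.1.1 & r = update false p].
Proof.
move=> hk hG; have sE g : g \in G -> slack g = dot_row k g.1.1.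
  by move=> hg; apply: slackE => //; apply: hG.
have ee x : BinInt.Z.eqb Z0 x = (x == 0) by rewrite eq_sym.
rewrite /dd_step !mem_cat; split.
  case/or3P=> [/mapP[z]|/combinationsP[p [n [/allpairsP[[p' n'] /= [hp hn [-> ->]]] hno ->]]]|/mapP[p]].
  - rewrite mem_filter => /andP[h0 hz] ->; apply: Or31; exists z => //; split=> //.
    by apply/eqP; rewrite -sE // -ee.
  - apply: Or32; exists p', n'; move: hp hn; rewrite !mem_filter.
    move=> /andP[hp hpG] /andP[hn hnG]; split=> //; first by rewrite -!sE.
    by move=> g hg; apply: contra hno => h; apply/hasP; exists g.2; rewrite ?map_f.
  - rewrite mem_filter => /andP[h0 hp] ->; apply: Or33; exists p => //; split=> //.
    by rewrite -sE.
case=> [[z [hz h0] ->]|[p [n [[hp hn hp0 hn0] hno ->]]]|[p [hp hp0] ->]]; apply/or3P.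
- by apply: Or31; rewrite map_f // mem_filter hz sE // ee h0 eqxx.
- apply: Or32; apply/combinationsP; exists p, n; split=> //.
    by apply: allpairs_f; rewrite mem_filter sE ?hp ?hn ?andbT.
  by apply/hasPn => m /mapP[g hg ->]; apply: hno.
- by apply: Or33; rewrite map_f // mem_filter hp sE // andbT.
Qed.

Lemma irredundant_slack k G g g' : {in G, forall r, ray_ok k r} -> irredundant k G ->
  g \in G -> g' \in G -> dot_row k g.1.1 != dot_row k g'.1.1 -> ~ tight_subZ k g.1.1 g'.1.1.
Proof. by move=> hG hirr hg hg' hne /(hirr _ _ hg hg') e; rewrite e eqxx in hne. Qed.

Lemma step_ok k G : (k < size rows)%N -> {in G, forall r, ray_ok k r} ->
  {in dd_step G, forall r, ray_ok k.+1 r}.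
Proof.
move=> hk hG r /(stepP r hk hG)[[z [hz h0] ->]|[p [n [[hp hn hp0 hn0] _ ->]]]|[p [hp hp0] ->]].
- by apply: update_ok => //; [exact: hG|rewrite h0|rewrite h0 eqxx].
- by apply: combine_ok => //; exact: hG.
- by apply: update_ok => //; [exact: hG|exact: ltW|rewrite gt_eqF].
Qed.

(** For two generators p, n on the two sides of the new hyperplane without a
    third one on their common face, a generator on that face is p or n. *)
Lemma no_third k G p n g : (k < size rows)%N -> {in G, forall r, ray_ok k r} ->
  irredundant k G -> p \in G -> n \in G -> g \in G ->
  {in G, forall g : ray, ~~ third p.2 n.2 g.2} ->
  (forall i, (i < k)%N -> dot_row i p.1.1 = 0 -> dot_row i n.1.1 = 0 -> dot_row i g.1.1 = 0) ->
  g.1.1 = p.1.1 \/ g.1.1 = n.1.1.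
Proof.
move=> hk hG hirr hp hn hg /(_ g hg) hno hface; move: hno.
have [_ _ mp _] := hG p hp; have [_ _ mn _] := hG n hn; have [_ _ mg _] := hG g hg.
rewrite /third mp mn mg (introT (meet_tight _ _ _ _) hface) !eq_maskE.
case: eqP => [/tight_mask_eq/(hirr _ _ hg hp) -> _|_]; first by left.
by rewrite negbK => /eqP/tight_mask_eq/(hirr _ _ hg hn) ->; right.
Qed.

(** Two combinations with comparable masks coincide by [no_third]. In the other
    cases comparable masks force two rays of [G] with different slacks to be
    equal. *)
Lemma step_irredundant k G : (k < size rows)%N -> {in G, forall r, ray_ok k r} ->
  irredundant k G -> irredundant k.+1 (dd_step G).
Proof.
move=> hk hG hirr r r' hr hr'.
have weaken u v : tight_subZ k.+1 u v -> tight_subZ k u v.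
  by move=> h i hi; apply: h; apply: ltnW.
have neg := irredundant_slack hG hirr.
have combW p n i : p \in G -> n \in G -> 0 < dot_row k p.1.1 -> dot_row k n.1.1 < 0 ->
    (i < k)%N -> dot_row i (combine p n).1.1 = 0 <-> dot_row i p.1.1 = 0 /\ dot_row i n.1.1 = 0.
  move=> hp hn hp0 hn0 hi; rewrite (form_combine i hk (hG p hp) (hG n hn)).
  have [_ _ _ gp] := hG p hp; have [_ _ _ gn] := hG n hn.
  split=> [/eqP|[-> ->]]; last by rewrite !mulr0 addr0.
  rewrite paddr_eq0; first last.
  - by rewrite mulr_ge0 ?gn // ltW.
  - by rewrite mulr_ge0 ?gp // oppr_ge0 ltW.
  by rewrite !mulf_eq0 oppr_eq0 (lt_eqF hn0) (gt_eqF hp0) => /andP[/eqP -> /eqP ->].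
have combk p n : p \in G -> n \in G -> dot_row k (combine p n).1.1 = 0.
  move=> hp hn; rewrite (form_combine k hk (hG p hp) (hG n hn)); ring.
case/(stepP r hk hG): hr => [[z [hz z0] ->]|[p [n [[hp hn hp0 hn0] hno ->]]]|[p [hp hp0] ->]];
case/(stepP r' hk hG): hr' => [[z' [hz' z0'] ->]|[p' [n' [[hp' hn' hp0' hn0'] hno' ->]]]|[p' [hp' hp0'] ->]] hsub.
- by rewrite /= (hirr z z') //; apply: weaken.
- case: (neg z p') => //; first by rewrite z0 lt_eqF.
  by move=> i hi hzi; have /(combW p' n' i)[] := hsub i (ltnW hi) hzi.
- by have := hsub k (ltnSn k) z0 => /= h; rewrite h ltxx in hp0'.
- have [e|e] : z'.1.1 = p.1.1 \/ z'.1.1 = n.1.1.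
    apply: (no_third (G := G) hk) => // i hi h1 h2; apply: (hsub i (ltnW hi)).
    by apply/combW.
  + by rewrite -e z0' ltxx in hp0.
  + by rewrite -e z0' ltxx in hn0.
- have face g : g \in G -> tight_subZ k (combine p' n').1.1 g.1.1 ->
      g.1.1 = p.1.1 \/ g.1.1 = n.1.1.
    move=> hg hg'; apply: (no_third (G := G) hk) => // i hi h1 h2; apply: hg' => //.
    by apply: hsub (ltnW hi) _; apply/combW.
  have [ep|ep] : p'.1.1 = p.1.1 \/ p'.1.1 = n.1.1.
    by apply: face => // i hi /(combW p' n' i)[].
  + have [en|en] : n'.1.1 = p.1.1 \/ n'.1.1 = n.1.1.
      by apply: face => // i hi /(combW p' n' i)[].
    * by move: hp0; rewrite -en ltNge ltW.
    * rewrite /= !(slackE hk (hG _ _)) //; by rewrite ep en.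
  + by move: hn0; rewrite -ep ltNge ltW.
- have := hsub k (ltnSn k) (combk _ _ hp hn) => /= h; by rewrite h ltxx in hp0'.
- case: (neg p z') => //; first by rewrite z0' gt_eqF.
  exact: weaken.
- case: (neg p n') => //; first by rewrite gt_eqF // (lt_trans hn0').
  by move=> i hi hpi; have /(combW p' n' i)[] := hsub i (ltnW hi) hpi.
- by rewrite /= (hirr p p') //; apply: weaken.
Qed.

End Algorithm.

Section RealOf.
Variable R : realType.

(** The algorithm computes with binary integers; its theory is over the reals. *)
Definition real_of (z : Z) : R := (int_of_Z z)%:~R.

Lemma real_ofD x y : real_of (BinInt.Z.add x y) = real_of x + real_of y.
Proof. by rewrite /real_of -intrD; congr _%:~R; lia. Qed.

Lemma real_ofM x y : real_of (BinInt.Z.mul x y) = real_of x * real_of y.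
Proof. by rewrite /real_of -intrM; congr _%:~R; lia. Qed.

Lemma real_ofN x : real_of (- x) = - real_of x.
Proof. by rewrite /real_of raddfN mulrNz. Qed.

Lemma real_of_eq0 x : (real_of x == 0) = (x == 0).
Proof. by rewrite /real_of intr_eq0; apply/eqP/eqP => [|->] //; case: x => [|p|p] //; lia. Qed.

Lemma real_of_gt0 x : (0 < real_of x) = (0 < x).
Proof. by rewrite /real_of ltr0z; apply/idP/idP; lia. Qed.

Lemma real_of_lt0 x : (real_of x < 0) = (x < 0).
Proof. by rewrite /real_of ltrz0; apply/idP/idP; lia. Qed.

Lemma real_of_ge0 x : (0 <= real_of x) = (0 <= x).
Proof. by rewrite !leNgt real_of_lt0. Qed.

Lemma real_of_dot u v n : (size u <= n)%N ->
  real_of (dotZ u v) = \sum_(j < n) real_of (nth Z0 u j) * real_of (nth Z0 v j).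
Proof.
move=> hu; elim: u v n hu => [|a u IHu] v n hu.
  by rewrite big1 // => j _; rewrite nth_nil mul0r.
case: n hu => // n hu; rewrite big_ord_recl; case: v => [|b v].
  by rewrite nth_nil mulr0 add0r big1 // => j _; rewrite nth_nil mulr0.
by rewrite /= real_ofD real_ofM (IHu v n).
Qed.

End RealOf.
Arguments real_ofN {R}.
Arguments real_of_eq0 {R}.
Arguments real_of_gt0 {R}.
Arguments real_of_lt0 {R}.
Arguments real_of_ge0 {R}.
Arguments real_of_dot {R}.

Section RealCone.
Variables (R : realType) (d : nat) (rows : seq (seq Z)).
Hypothesis size_rows : all (fun r => size r == d) rows.
Local Notation real_of := (@real_of R).

Definition row_of (v : seq Z) : 'rV[R]_d := \row_j real_of (nth Z0 v j).

Definition real_form (i : nat) (x : 'rV[R]_d) : R :=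
  \sum_(j < d) real_of (nth Z0 (nth [::] rows i) j) * x 0 j.

Lemma real_form_linear i a x y :
  real_form i (a *: x + y) = a * real_form i x + real_form i y.
Proof.
rewrite /real_form mulr_sumr -big_split; apply: eq_bigr => j _ /=.
by rewrite !mxE mulrDr mulrCA.
Qed.

Lemma size_row i : (size (nth [::] rows i) <= d)%N.
Proof.
have [hi|hi] := ltnP i (size rows); last by rewrite nth_default.
by have /allP/(_ _ (mem_nth [::] hi))/eqP -> := size_rows.
Qed.

Lemma real_form_row i v : real_form i (row_of v) = real_of (dot_row rows i v).
Proof.
rewrite /dot_row (real_of_dot _ v _ (size_row i)) /real_form.
by apply: eq_bigr => j _; rewrite mxE.
Qed.

Lemma row_of_comb a u b v : size u = d -> size v = d ->
  row_of (combZ a u b v) = real_of a *: row_of u + real_of b *: row_of v.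
Proof.
move=> hu hv; apply/rowP => j; rewrite !mxE.
have : (j < size u)%N by rewrite hu.
have : size u = size v by rewrite hu hv.
elim: u v (nat_of_ord j) {hu hv} => [|x u IHu] [|y v] [|k] //= [e] hk.
  by rewrite real_ofD !real_ofM.
by apply: IHu.
Qed.

Definition rays (G : seq ray) (x : 'rV[R]_d) : Prop :=
  exists2 r, r \in G & x = row_of r.1.1.

Lemma step_span k G : (d <= k < size rows)%N ->
  (forall x, (forall i, (i < d)%N -> real_form i x = 0) -> x = 0) ->
  {in G, forall r, ray_ok d rows k r} -> irredundant rows k G ->
  (forall x, nonneg real_form k x -> hull (rays G) x) ->
  forall x, nonneg real_form k.+1 x -> hull (rays (dd_step G)) x.
Proof.
move=> /andP[hdk hk] hpt hG hirr hspan.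
have sE g : g \in G -> slack g = dot_row rows k g.1.1.
  by move=> hg; apply: (slackE (d := d)) => //; apply: hG.
have szE (g : ray) : g \in G -> size g.1.1 = d by move=> /hG[].
apply: (double_description_step real_form_linear hspan).
- move=> _ [r hr ->] i hi; rewrite real_form_row real_of_ge0.
  by have [_ _ _] := hG r hr; apply.
- by move=> x hx; apply: hpt => i hi; apply: hx; apply: leq_trans hdk.
- move=> _ _ [r hr ->] [r' hr' ->] htight; congr row_of; apply: hirr => // i hi h0.
  by apply/eqP; rewrite -(real_of_eq0 (R := R)) -real_form_row htight // real_form_row h0.
- move=> _ [r hr ->]; rewrite real_form_row real_of_ge0 le0r => /orP[/eqP h0|h0].
    exists (update true r) => //; apply/(stepP _ hk hG).
    by apply: Or31; exists r.
  exists (update false r) => //; apply/(stepP _ hk hG).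
  by apply: Or33; exists r.
- move=> _ _ [p hp ->] [n hn ->]; rewrite !real_form_row real_of_gt0 real_of_lt0.
  move=> hp0 hn0.
  have [/hasP[g hg hthird]|hno] := boolP (has (fun g : ray => third p.2 n.2 g.2) G).
    right; exists (row_of g.1.1); move: hthird.
    have [_ _ mp _] := hG p hp; have [_ _ mn _] := hG n hn; have [_ _ mg _] := hG g hg.
    rewrite /third mp mn mg; case: meet_tight => // hface; rewrite !eq_maskE.
    case: eqP => // hgp /eqP hgn; split.
    + by exists g.
    + move=> e; apply: hgp; congr tight_mask; apply: hirr => // i hi h0; apply/eqP.
      by rewrite -(real_of_eq0 (R := R)) -real_form_row -e real_form_row h0.
    + move=> e; apply: hgn; congr tight_mask; apply: hirr => // i hi h0; apply/eqP.
      by rewrite -(real_of_eq0 (R := R)) -real_form_row -e real_form_row h0.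
    + move=> i hi /eqP; rewrite !real_form_row real_of_eq0 => /eqP h1 /eqP.
      by rewrite real_of_eq0 => /eqP h2; rewrite hface.
  left; exists (combine p n).
    apply/(stepP _ hk hG); apply: Or32; exists p, n; split=> // g hg.
    by have /hasPn/(_ g hg) := hno.
  rewrite /combine /= row_of_comb ?szE // !sE //.
  by rewrite -[BinInt.Z.opp _]/(- dot_row rows k n.1.1) real_ofN scaleNr addrC.
Qed.

Variable W : seq (seq Z).
Hypothesis size_W : size W = d.
Hypothesis W_dual : forall i j, (i < d)%N -> (j < d)%N ->
  size (nth [::] W i) = d /\ dot_row rows j (nth [::] W i) = (i == j)%:R.
Hypothesis many_rows : (d <= size rows)%N.

Definition start_ray (w : seq Z) : ray :=
  (w, [seq dotZ row w | row <- drop d rows], tight_mask rows d w).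

(** The vectors of [W] are dual to the first d rows, so they generate the
    simplicial cone that these rows define. *)
Lemma start_expansion x : x = \sum_(i < d) real_form i x *: row_of (nth [::] W i).
Proof.
pose N : 'M[R]_d := \matrix_(j, i) real_of (nth Z0 (nth [::] rows i) j).
pose M : 'M[R]_d := \matrix_i row_of (nth [::] W i).
have MN : M *m N = 1%:M.
  apply/matrixP => i j; rewrite !mxE.
  have [_ h] := W_dual (ltn_ord i) (ltn_ord j).
  have := real_form_row j (nth [::] W i); rewrite h => e.
  transitivity (real_form j (row_of (nth [::] W i))).
    by apply: eq_bigr => k _; rewrite !mxE mulrC.
  by rewrite e -(inj_eq val_inj); case: eqP.
rewrite -[LHS]mulmx1 -(mulmx1C MN) mulmxA mulmx_sum_row.
apply: eq_bigr => i _; rewrite rowK; congr (_ *: _).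
by rewrite !mxE; apply: eq_bigr => j _; rewrite !mxE mulrC.
Qed.

(** The d vectors of [W] generate the cone of the first d rows; every step takes
    one more row into account. *)
Lemma double_description x : nonneg real_form (size rows) x ->
  hull (rays (iter (size rows - d) dd_step [seq start_ray w | w <- W])) x.
Proof.
have hpt y : (forall i, (i < d)%N -> real_form i y = 0) -> y = 0.
  by move=> hy; rewrite (start_expansion y) big1 // => i _; rewrite hy // scale0r.
have wE w : w \in W -> exists2 i, (i < d)%N & w = nth [::] W i.
  by move=> /(nthP [::])[i hi <-]; exists i; rewrite // -size_W.
suff h m : (m <= size rows - d)%N ->
    let G := iter m dd_step [seq start_ray w | w <- W] in
    [/\ {in G, forall r, ray_ok d rows (d + m) r}, irredundant rows (d + m) G &
        forall x, nonneg real_form (d + m) x -> hull (rays G) x].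
  have [_ _ hs] := h _ (leqnn _); move=> hx; apply: hs.
  by rewrite subnKC.
elim: m => [_|m IHm hm].
  rewrite addn0; split.
  - move=> _ /mapP[w /wE[i hi ->] ->]; split=> //=.
      by have [] := W_dual hi hi.
    by move=> j hj; have [_ ->] := W_dual hi hj; case: eqP.
  - move=> _ _ /mapP[w /wE[i hi ->] ->] /mapP[w' /wE[j hj ->] ->] /= hsub.
    have [<-//|hne] := eqVneq i j; have [_ e] := W_dual hi hj.
    have [_ e'] := W_dual hj hj.
    by have := hsub j hj; rewrite e (negPf hne) e' eqxx => /(_ erefl).
  - move=> y hy; rewrite (start_expansion y).
    have : forall i : 'I_d, rays [seq start_ray w | w <- W] (row_of (nth [::] W i)).
      move=> i; exists (start_ray (nth [::] W i)) => //.
      by rewrite map_f // mem_nth // size_W.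
    elim/big_rec: _ => [|i z _ hz hr]; first by move=> _; apply: hull0.
    by apply: hullS => //; [exact: hy | exact: hz].
have [hG hirr hs] := IHm (ltnW hm).
have hk : (d + m < size rows)%N by lia.
rewrite addnS /=; split.
- exact: step_ok.
- exact: (step_irredundant (d := d)).
- by apply: step_span => //; rewrite leq_addr.
Qed.

End RealCone.

(** * The cone of bounded ratios *)

(** The 332 ratios of the orbits, as pairs of a generator and a symmetry. In
    the 62 coordinates outside [gauge_ranks] the first 62 of them form a basis of
    the integral lattice; the order keeps the number of intermediate rays small. *)
Definition ratio_order : seq (nat * nat) :=
  [:: (0, 3); (0, 2); (0, 5); (0, 1); (0, 6); (0, 7); (0, 0); (0, 4); (7, 27);
  (7, 5); (7, 15); (7, 23); (7, 26); (7, 2); (7, 9); (7, 17); (7, 4);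
  (7, 14); (7, 22); (7, 30); (7, 20); (7, 12); (7, 25); (7, 1); (7, 28);
  (7, 6); (7, 10); (7, 18); (7, 31); (7, 21); (7, 7); (7, 11); (7, 0);
  (7, 24); (7, 19); (7, 29); (7, 3); (7, 16); (4, 2); (4, 1); (1, 2); (1, 9);
  (1, 11); (1, 1); (1, 3); (1, 10); (1, 0); (1, 8); (2, 4); (2, 3); (2, 1);
  (2, 7); (2, 0); (2, 6); (5, 4); (5, 6); (5, 9); (5, 11); (5, 15); (5, 13);
  (5, 0); (5, 2); (3, 13); (6, 16); (6, 6); (6, 18); (6, 1); (6, 23);
  (4, 22); (6, 3); (6, 17); (10, 3); (6, 0); (8, 2); (6, 2); (10, 0);
  (4, 20); (4, 23); (8, 3); (6, 21); (6, 7); (10, 1); (4, 7); (4, 4);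
  (3, 15); (5, 14); (9, 0); (3, 2); (2, 2); (8, 0); (5, 12); (13, 7);
  (4, 18); (4, 17); (13, 2); (5, 5); (9, 1); (4, 5); (13, 22); (5, 1);
  (9, 17); (6, 19); (8, 1); (2, 5); (6, 5); (10, 5); (10, 7); (3, 12);
  (12, 12); (4, 6); (13, 19); (14, 19); (4, 3); (4, 19); (13, 4); (13, 20);
  (4, 16); (9, 2); (6, 4); (10, 6); (6, 20); (5, 8); (9, 18); (10, 2);
  (12, 13); (15, 0); (4, 0); (3, 5); (12, 5); (5, 3); (9, 3); (5, 7);
  (9, 19); (11, 12); (12, 2); (11, 2); (15, 15); (16, 15); (17, 0); (19, 0);
  (3, 10); (12, 10); (11, 10); (6, 22); (10, 4); (5, 10); (9, 16); (11, 5);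
  (11, 13); (16, 0); (12, 15); (11, 15); (19, 15); (18, 0); (3, 1); (12, 1);
  (11, 1); (4, 21); (7, 13); (13, 6); (13, 21); (13, 23); (13, 17); (13, 0);
  (14, 0); (15, 28); (16, 28); (15, 21); (16, 21); (17, 21); (19, 28);
  (19, 21); (18, 21); (3, 6); (12, 6); (11, 6); (7, 8); (13, 16); (13, 5);
  (13, 1); (13, 3); (13, 18); (14, 3); (14, 18); (15, 14); (16, 14);
  (15, 31); (16, 31); (15, 7); (16, 7); (15, 16); (16, 16); (17, 7); (19, 7);
  (19, 14); (18, 7); (17, 16); (19, 16); (19, 31); (18, 16); (3, 8);
  (14, 22); (15, 10); (16, 10); (12, 8); (11, 8); (15, 3); (16, 3); (17, 3);
  (19, 3); (19, 10); (18, 3); (3, 11); (14, 4); (15, 17); (16, 17); (12, 11);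
  (11, 11); (15, 24); (16, 24); (17, 17); (19, 24); (19, 17); (18, 17);
  (3, 4); (14, 21); (15, 2); (16, 2); (12, 4); (11, 4); (15, 9); (16, 9);
  (17, 2); (19, 2); (19, 9); (18, 2); (3, 3); (14, 1); (15, 29); (16, 29);
  (12, 3); (11, 3); (15, 22); (16, 22); (17, 22); (19, 29); (19, 22);
  (18, 22); (3, 9); (14, 2); (14, 23); (15, 11); (16, 11); (15, 23);
  (16, 23); (12, 9); (11, 9); (15, 4); (16, 4); (15, 30); (16, 30); (17, 4);
  (19, 11); (19, 4); (18, 4); (17, 23); (19, 23); (19, 30); (18, 23);
  (3, 14); (14, 20); (14, 7); (15, 8); (16, 8); (15, 20); (16, 20); (12, 14);
  (11, 14); (15, 1); (16, 1); (15, 27); (16, 27); (17, 20); (19, 20);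
  (19, 27); (18, 20); (17, 1); (19, 8); (19, 1); (18, 1); (3, 7); (14, 16);
  (14, 5); (15, 5); (16, 5); (15, 25); (16, 25); (12, 7); (11, 7); (15, 18);
  (16, 18); (15, 12); (16, 12); (17, 5); (19, 12); (19, 5); (18, 5);
  (17, 18); (19, 25); (19, 18); (18, 18); (3, 0); (14, 17); (14, 6);
  (15, 26); (16, 26); (15, 6); (16, 6); (12, 0); (11, 0); (15, 13); (16, 13);
  (15, 19); (16, 19); (17, 19); (19, 19); (19, 26); (18, 19); (17, 6);
  (19, 6); (19, 13); (18, 6)].

(** The dual basis of the first 62 ratios. *)
Definition start_vectors : seq (seq int) := [::
  [:: 0; 0; 1; 0; 0; 1; 0; 1; 1; 0; 0; 1; 0; 0; 1; 0; 1; 1; 0; 0; 1; 0; 1; 1;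
  0; 1; 1; 1; 0; 0; 1; 0; 0; 1; 0; 1; 1; 0; 0; 1; 0; 1; 1; 0; 1; 1; 1; 0; 0;
  1; 0; 1; 1; 0; 1; 1; 1; 0; 1; 1; 1; 1]; [:: 0; 0; 0; 0; 0; 0; 0; 0; -1; 0;
  0; 0; 0; 0; 0; 0; 0; 0; 0; 0; 0; 0; 0; 0; 0; 0; 0; 0; 0; 0; 0; 0; 0; 0; 0;
  0; 0; 0; 0; 0; 0; 0; 0; 0; 0; 0; 0; 0; 0; 0; 0; 0; 0; 0; 0; 0; 0; 0; 0; 0;
  0; 0]; [:: 0; 0; 0; 0; 0; 0; 0; 0; 0; 0; 0; 0; 0; 0; 0; 0; 0; 0; 0; 0; 0; 0;
  0; 0; 0; 0; 0; 0; 1; 1; 1; 1; 1; 1; 1; 1; 1; 1; 1; 1; 1; 1; 1; 1; 1; 1; 1;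
  1; 1; 1; 1; 1; 1; 1; 1; 1; 1; 1; 1; 1; 1; 1]; [:: 0; 0; 0; 0; 0; 0; 0; 0; 0;
  0; 0; 0; 0; 0; 0; 0; 0; 0; 0; 0; 0; 0; 0; 0; 0; 0; 0; -1; 0; 0; 0; 0; 0; 0;
  0; 0; 0; 0; 0; 0; 0; 0; 0; 0; 0; 0; 0; 0; 0; 0; 0; 0; 0; 0; 0; 0; 0; 0; 0;
  0; 0; 0]; [:: 0; 0; 0; 0; 0; 0; 0; 0; 0; 0; 0; 0; 0; 0; 0; 0; 0; 0; 0; 0; 0;
  0; 0; 0; 0; 0; 0; 0; 0; 0; 0; 0; 0; 0; 0; 0; 0; 0; 0; 0; 0; 0; 0; 0; 0; 0;
  0; -1; 0; 0; 0; 0; 0; 0; 0; 0; 0; 0; 0; 0; 0; 0]; [:: 0; 0; 0; 0; 0; 0; 0;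
  0; 0; 0; 0; 0; 0; 0; 0; 0; 0; 0; 0; 0; 0; 0; 0; 0; 0; 0; 0; 0; 0; 0; 0; 0;
  0; 0; 0; 0; 0; 0; 0; 0; 0; 0; 0; 0; 0; 0; 0; 0; 0; 0; 0; 0; 0; 0; 0; 0; 0;
  -1; 0; 0; 0; 0]; [:: 0; 0; 0; 0; 0; 0; 0; 0; 0; 0; 0; 0; 0; 0; 0; 0; 0; 0;
  0; 0; 0; 0; 0; 0; 0; 0; 0; 0; 0; 0; 0; 0; 0; 0; 0; 0; 0; 0; 0; 0; 0; 0; 0;
  0; 0; 0; 0; 0; 0; 0; 0; 0; 0; 0; 0; 0; 0; 0; 0; 0; 0; -1]; [:: 0; 0; 0; -1;
  -1; -1; -1; -1; -1; 0; 0; 0; -1; -1; -1; -1; -1; -1; -1; -1; -1; -1; -1; -1;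
  -2; -2; -2; -2; 0; 0; 0; -1; -1; -1; -1; -1; -1; -1; -1; -1; -1; -1; -1; -2;
  -2; -2; -2; -1; -1; -1; -1; -1; -1; -2; -2; -2; -2; -2; -2; -2; -2; -3]; [::
  0; 1; 1; 0; 1; 1; 1; 1; 2; 0; 1; 1; 0; 1; 1; 1; 1; 2; 1; 2; 2; 2; 2; 3; 2;
  2; 3; 3; 0; 1; 1; 0; 1; 1; 1; 1; 2; 1; 2; 2; 2; 2; 3; 2; 2; 3; 3; 1; 2; 2;
  2; 2; 3; 2; 2; 3; 3; 3; 3; 4; 4; 4]; [:: -1; -1; -1; -1; -1; -1; -1; -1; -1;
  0; 0; 0; 0; 0; 0; 0; 0; 0; -1; -1; -1; -1; -1; -1; -1; -1; -1; -1; 0; 0; 0;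
  0; 0; 0; 0; 0; 0; -1; -1; -1; -1; -1; -1; -1; -1; -1; -1; 0; 0; 0; 0; 0; 0;
  0; 0; 0; 0; -1; -1; -1; -1; -1]; [:: 0; 0; 0; 1; 1; 1; 1; 1; 1; 0; 0; 1; 1;
  1; 1; 1; 1; 1; 2; 1; 1; 1; 1; 1; 2; 2; 2; 3; 0; 0; 0; 1; 0; 0; 0; 0; 0; 1;
  0; 0; 0; 0; 0; 1; 1; 1; 2; 1; 0; 0; 0; 0; 0; 1; 1; 1; 2; 2; 2; 2; 2; 3]; [::
  0; 0; 0; -1; -1; 0; -1; 0; 0; 0; 0; 0; -1; -1; 0; -1; 0; 0; -2; -1; 0; -1;
  0; 0; -2; -1; -1; -2; 0; 0; 1; -1; 0; 1; 0; 1; 1; -1; 0; 1; 0; 1; 1; -1; 0;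
  0; -1; -1; 0; 1; 0; 1; 1; -1; 0; 0; -1; -2; -1; -1; -1; -2]; [:: 0; 0; 0; 1;
  1; 1; 1; 0; 0; 0; 0; 0; 1; 1; 0; 1; 0; 0; 2; 1; 0; 1; 0; 0; 2; 1; 1; 2; 0;
  0; -1; 1; 0; -1; 0; -1; -1; 1; 0; -1; 0; -1; -1; 1; 0; 0; 1; 1; 0; -1; 0;
  -1; -1; 1; 0; 0; 1; 2; 1; 1; 1; 2]; [:: 0; 0; 0; -1; -1; -1; -1; -1; -1; 0;
  0; 0; -1; -1; 0; -1; 0; 0; -2; -1; 0; -1; 0; 0; -2; -1; -1; -2; 0; 0; 1; -1;
  0; 1; 0; 1; 1; -1; 0; 1; 0; 1; 1; -1; 0; 0; -1; -1; 0; 1; 0; 1; 1; -1; 0; 0;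
  -1; -2; -1; -1; -1; -2]; [:: 0; 0; 0; 0; 0; 0; 0; 0; 0; 0; 0; 0; 0; 0; 0; 0;
  0; 0; 1; 0; 0; 0; 0; 0; 0; 0; 0; 1; 0; 0; 0; 1; 0; 0; 0; 0; 0; 1; 0; 0; 0;
  0; 0; 0; 0; 0; 1; 1; 0; 0; 0; 0; 0; 0; 0; 0; 1; 1; 1; 1; 1; 1]; [:: 0; 0; 0;
  0; 0; 0; 0; 0; 0; 0; 0; 0; 0; 0; 0; 0; 0; 0; -1; 0; 0; 0; 0; 0; 0; 0; 0; -1;
  0; 1; 1; 0; 1; 1; 1; 1; 1; 0; 1; 1; 1; 1; 1; 1; 1; 1; 0; 0; 1; 1; 1; 1; 1;
  1; 1; 1; 0; 0; 0; 0; 0; 0]; [:: 0; 0; 0; -1; -1; -1; -1; -1; -1; 0; 0; 0;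
  -1; -1; -1; -1; -1; -1; -2; -1; -1; -1; -1; -1; -2; -2; -2; -3; 0; 0; 0; -1;
  0; 0; 0; 0; 0; -1; 0; 0; 0; 0; 0; -1; -1; -1; -2; -1; 0; 0; 0; 0; 0; -1; -1;
  -1; -2; -2; -2; -2; -2; -3]; [:: 0; 0; 0; 0; 0; 0; 0; 0; 0; 0; 0; 0; 0; 0;
  0; 0; 0; 0; 1; 1; 1; 1; 1; 1; 1; 1; 1; 1; 0; 0; 0; 0; 0; 0; 0; 0; 1; 1; 1;
  1; 1; 1; 1; 1; 1; 1; 1; 1; 1; 1; 1; 1; 1; 1; 1; 1; 1; 2; 2; 2; 2; 2]; [:: 0;
  0; 0; 0; 0; 0; 0; 0; -1; 0; 0; 0; 0; 0; 0; 0; 0; -1; -1; -1; -1; -1; -1; -1;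
  -1; -1; -1; -1; 0; 0; 0; 0; 0; 0; 0; 0; -1; -1; -1; -1; -1; -1; -1; -1; -1;
  -1; -1; -1; -1; -1; -1; -1; -1; -1; -1; -1; -1; -2; -2; -2; -2; -2]; [:: 0;
  0; 0; 0; 0; 0; 0; 0; 0; 0; 0; 0; 0; 0; 0; 0; 0; 0; 1; 0; 0; 0; 0; 0; 0; 0;
  0; 1; 0; 0; 0; 0; 0; 0; 0; 0; 0; 0; 0; 0; 0; 0; 0; 0; 0; 0; 1; 0; 0; 0; 0;
  0; 0; 0; 0; 0; 1; 1; 1; 1; 1; 1]; [:: -1; -1; -1; -1; -1; -1; -1; -1; -1;
  -1; -1; -1; -1; -1; -1; -1; -1; -1; -2; -2; -2; -2; -2; -2; -2; -2; -2; -2;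
  -1; -1; -1; -1; -1; -1; -1; -1; -1; -2; -2; -2; -2; -2; -2; -1; -2; -2; -2;
  -1; -1; -1; -1; -2; -2; -1; -2; -2; -2; -2; -3; -3; -3; -3]; [:: 1; 1; 1; 1;
  1; 1; 1; 1; 1; 1; 1; 1; 1; 1; 1; 1; 1; 1; 2; 2; 2; 2; 2; 2; 1; 2; 2; 2; 1;
  1; 1; 1; 1; 1; 1; 1; 1; 2; 2; 2; 2; 2; 2; 1; 2; 2; 2; 1; 1; 1; 1; 2; 2; 1;
  2; 2; 2; 2; 3; 3; 3; 2]; [:: 0; 0; 0; 0; 0; 0; 0; 0; 1; 0; 0; 0; 0; 0; 0; 0;
  0; 1; 1; 1; 1; 1; 1; 2; 1; 1; 1; 1; 0; 0; 0; 0; 0; 0; 0; 0; 1; 1; 1; 1; 1;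
  1; 1; 1; 1; 1; 1; 1; 1; 1; 1; 1; 1; 1; 1; 1; 1; 2; 2; 2; 2; 2]; [:: 0; 0; 0;
  0; 0; 0; 0; 0; -1; 0; 0; 0; 0; 0; 0; 0; 0; -1; -1; -1; -1; -1; -1; -2; -1;
  -1; -2; -2; 0; 0; 0; 0; 0; 0; 0; 0; -1; -1; -1; -1; -1; -1; -1; -1; -1; -1;
  -1; -1; -1; -1; -1; -1; -1; -1; -1; -1; -1; -2; -2; -2; -2; -2]; [:: 0; 0;
  0; 0; 0; 0; 0; 0; 0; 0; 0; 0; 0; 0; 0; 0; 0; 0; 1; 0; 0; 0; 0; 0; 0; 0; 0;
  1; 0; 0; -1; 0; -1; -1; -1; -1; -1; 0; -1; -1; -1; -1; -1; -1; -1; -1; 0; 0;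
  -1; -1; -1; -1; -1; -1; -1; -1; 0; 0; 0; 0; 0; 0]; [:: 0; 0; 0; 0; 0; 0; 0;
  0; 0; 0; 0; 0; 0; 0; 0; 0; 0; 0; -1; 0; 0; 0; 0; 0; 0; 0; 0; -1; 0; 0; 0; 0;
  0; 0; 0; 0; 0; -1; 0; 0; 0; 0; 0; 0; 0; 0; -1; -1; 0; 0; 0; 0; 0; 0; 0; 0;
  -1; -1; -1; -1; -1; -1]; [:: 1; 1; 1; 1; 1; 1; 1; 1; 1; 1; 1; 1; 1; 1; 1; 1;
  1; 1; 2; 2; 2; 2; 2; 2; 2; 2; 2; 2; 1; 1; 1; 1; 1; 1; 1; 1; 1; 2; 2; 2; 2;
  2; 2; 2; 2; 2; 2; 1; 1; 1; 2; 2; 2; 2; 2; 2; 2; 3; 3; 3; 3; 3]; [:: -1; -1;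
  -1; -1; -1; -1; -1; -1; -1; -1; -1; -1; -1; -1; -1; -1; -1; -1; -2; -2; -2;
  -2; -2; -2; -2; -2; -2; -2; -1; -1; -1; -1; -1; -1; -1; -1; -1; -2; -2; -2;
  -2; -2; -2; -2; -2; -2; -2; -2; -2; -1; -2; -2; -2; -2; -2; -2; -2; -3; -3;
  -3; -3; -3]; [:: 1; 1; 1; 1; 1; 1; 1; 1; 1; 1; 1; 1; 1; 1; 1; 1; 1; 1; 2; 2;
  2; 2; 2; 2; 2; 2; 2; 2; 1; 1; 1; 1; 1; 1; 1; 1; 1; 2; 2; 2; 2; 2; 2; 2; 2;
  2; 2; 1; 1; 1; 1; 2; 2; 1; 2; 2; 2; 2; 3; 3; 3; 3]; [:: 0; 0; 0; 0; 0; 0; 0;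
  0; 0; 0; 0; 0; 0; 0; 0; 0; 0; 0; 0; 0; 0; 0; 0; 0; 0; 0; 0; -1; 0; 0; 0; 0;
  0; 0; 0; 0; 0; 0; 0; 0; 0; 0; 0; 0; 0; 0; -1; 0; 0; 0; 0; 0; 0; 0; 0; 0; 0;
  0; 0; 0; 0; 0]; [:: -1; -1; -1; -1; -1; -1; -1; -1; -1; -1; -1; -1; -1; -1;
  -1; -1; -1; -1; -2; -2; -2; -2; -2; -2; -2; -2; -2; -2; -1; -1; -1; -1; -1;
  -1; -1; -1; -1; -2; -2; -2; -2; -2; -2; -2; -2; -2; -2; -1; -1; -1; -1; -2;
  -2; -2; -2; -2; -2; -3; -3; -3; -3; -3]; [:: 0; 0; 0; 0; 0; 0; 0; 0; 0; 0;
  0; 0; 0; 0; 0; 0; 0; 0; 0; 0; 0; 0; 0; 0; 0; 0; 0; 1; 0; 0; 0; 0; 0; 0; 0;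
  0; 0; 0; 0; 0; 0; 0; 0; 0; 0; 0; 1; 0; 0; 0; 0; 0; 0; 0; 0; 0; 1; 0; 0; 1;
  1; 1]; [:: 0; 0; 0; 0; 0; 0; 0; 0; 0; 0; 0; 0; 0; 0; 0; 0; 0; 0; 0; 0; 0; 0;
  0; 0; 0; 0; 0; -1; 0; 0; 0; 0; 0; 0; 0; 0; 0; 0; 0; 0; 0; 0; 0; 0; 0; 0; -1;
  0; 0; 0; 0; 0; 0; 0; 0; 0; -1; 0; 0; 0; -1; -1]; [:: 0; 0; 0; 0; 0; 0; 0; 0;
  0; 0; 0; 0; 0; 0; 0; 0; 0; 0; 0; 0; 0; 0; 0; 0; 0; 0; 0; 1; 0; 0; 0; 0; 0;
  0; 0; 0; 0; 0; 0; 0; 0; 0; 0; 0; 0; 0; 1; 0; 0; 0; 0; 0; 0; 0; 0; 0; 1; 0;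
  0; 0; 0; 0]; [:: 0; 0; 0; 0; 0; 0; 0; 0; 0; 0; 0; 0; 0; 0; 0; 0; 0; 0; 0; 0;
  0; 0; 0; 0; 0; 0; 0; -1; 0; 0; 0; 0; 0; 0; 0; 0; 0; 0; 0; 0; 0; 0; 0; 0; 0;
  0; -1; 0; 0; 0; 0; 0; 0; 0; 0; 0; -1; -1; -1; -1; -1; -1]; [:: 1; 1; 1; 1;
  1; 1; 1; 1; 1; 1; 1; 1; 1; 1; 1; 1; 1; 1; 2; 2; 2; 2; 2; 2; 2; 2; 2; 2; 1;
  1; 1; 1; 1; 1; 1; 1; 1; 2; 2; 2; 2; 2; 2; 2; 2; 2; 2; 2; 2; 2; 2; 2; 2; 2;
  2; 2; 2; 3; 3; 3; 3; 3]; [:: 0; 0; 0; 0; 0; 0; 0; 0; 0; 0; 0; 0; 0; 0; 0; 0;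
  0; 0; -1; -1; -1; -1; -1; -1; -1; -1; -1; -1; 0; 0; 0; 0; 0; 0; 0; 0; 0; -1;
  -1; -1; -1; -1; -1; -1; -1; -1; -1; -1; -1; -1; -1; -1; -1; -1; -1; -1; -1;
  -2; -2; -2; -2; -2]; [:: -1; -1; -1; -1; -1; -1; -2; -2; -2; -1; -1; -1; -1;
  -1; -1; -2; -2; -2; -2; -2; -2; -3; -3; -3; -3; -3; -3; -4; -1; -1; -1; -1;
  -1; -1; -2; -2; -2; -2; -2; -2; -3; -3; -3; -3; -3; -3; -4; -2; -2; -2; -3;
  -3; -3; -3; -3; -3; -4; -4; -4; -4; -5; -5]; [:: 0; 0; 0; -1; -1; -1; -2;
  -1; -1; 0; 0; 0; -1; -1; 0; -1; 0; 0; -2; -1; 0; -1; 0; 0; -2; -1; -1; -2;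
  0; 0; 1; -1; 0; 1; 0; 1; 1; -1; 0; 1; 0; 1; 1; -1; 0; 0; -1; -1; 0; 1; 0; 1;
  1; -1; 0; 0; -1; -2; -1; -1; -1; -2]; [:: 1; 1; 1; 1; 1; 1; 1; 1; 0; 1; 1;
  1; 1; 1; 1; 1; 1; 0; 1; 1; 1; 1; 1; 0; 0; 0; 0; 0; 1; 1; 1; 1; 1; 1; 1; 1;
  0; 1; 1; 1; 1; 1; 1; 0; 1; 1; 1; 0; 0; 0; 0; 1; 1; 0; 1; 1; 1; 0; 1; 1; 1;
  0]; [:: 0; 0; 0; 1; 0; 0; 0; 0; 0; 0; 0; 0; 0; 0; 0; 0; 0; 0; 0; 0; 0; 0; 0;
  0; 1; 1; 1; 1; 0; 0; 0; 0; 0; 0; 0; 0; 0; 0; 0; 0; 0; 0; 0; 1; 1; 1; 1; 1;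
  1; 1; 1; 1; 1; 1; 1; 1; 1; 1; 1; 1; 1; 2]; [:: 0; 0; 0; 0; 0; 0; 0; 0; 0; 0;
  0; 0; 0; 0; 0; 0; 0; 0; 1; 1; 1; 1; 1; 1; 1; 1; 1; 1; 0; 0; 0; 0; 0; 0; 1;
  0; 0; 1; 1; 0; 1; 0; 0; 1; 0; 0; 0; 1; 1; 0; 1; 0; 0; 1; 0; 0; 0; 2; 1; 1;
  1; 1]; [:: -1; -1; -1; -1; -1; -1; -1; -1; -1; -1; -1; -1; -1; -1; -1; -1;
  -1; -1; -2; -2; -1; -2; -2; -2; -2; -2; -2; -2; -1; -1; -1; -1; -1; -1; -1;
  -1; -1; -2; -2; -1; -2; -2; -2; -2; -2; -2; -2; -2; -2; -1; -2; -2; -2; -2;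
  -2; -2; -2; -3; -3; -3; -3; -3]; [:: 1; 1; 1; 1; 1; 1; 1; 1; 1; 1; 1; 1; 1;
  1; 1; 1; 1; 1; 2; 2; 2; 2; 2; 2; 2; 2; 2; 2; 1; 1; 1; 1; 1; 1; 1; 1; 1; 2;
  2; 1; 2; 2; 2; 2; 2; 2; 2; 2; 2; 1; 2; 2; 2; 2; 2; 2; 2; 3; 3; 3; 3; 3]; [::
  0; 0; 0; 0; 0; 0; 0; 0; 0; 0; 0; 0; 0; 0; 0; 0; 0; 0; -1; -1; -1; -1; -1;
  -1; -1; -1; -1; -1; 0; 0; 0; 0; 0; 0; 0; 0; 0; -1; -1; 0; -1; 0; 0; -1; 0;
  0; 0; -1; -1; 0; -1; 0; 0; -1; 0; 0; 0; -2; -1; -1; -1; -1]; [:: 0; 0; 0; 0;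
  0; 0; 0; 0; -1; 0; 0; 0; 0; 0; 0; 0; 0; -1; 0; 0; 0; 0; 0; -1; 0; 0; 0; 0;
  0; 0; 0; 0; 0; 0; 0; 0; -1; 0; 0; 0; 0; 0; -1; 0; 0; 0; 0; 0; 0; 0; 0; 0; 0;
  0; 0; 0; 0; 0; 0; 0; 0; 0]; [:: 0; 0; 0; 0; 0; 0; 0; 0; 1; 0; 0; 0; 0; 0; 0;
  0; 0; 1; 0; 0; 0; 0; 0; 1; 0; 0; 0; 0; 0; 0; 0; 0; 0; 0; 0; 0; 1; 0; 0; 0;
  0; 0; 1; 0; 0; 0; 0; 0; 0; 0; 0; 0; 1; 0; 0; 0; 0; 0; 0; 0; 0; 0]; [:: 0; 0;
  0; 0; 0; 0; 0; 0; 0; 0; 0; 0; 0; 0; 0; 0; 0; 0; 0; 0; 0; 0; 0; 0; -1; -1;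
  -1; -1; 0; 0; 0; 0; 0; 0; 0; 0; 0; 0; 0; 0; 0; 0; 0; -1; -1; -1; -1; -1; -1;
  -1; -1; -1; -1; -1; -1; -1; -1; -1; -1; -1; -1; -2]; [:: 0; 0; 0; -1; 0; 0;
  0; 0; 1; 0; 1; 1; 0; 1; 1; 1; 1; 2; 0; 1; 1; 1; 1; 2; 0; 0; 1; 1; 0; 1; 1;
  0; 1; 1; 1; 1; 2; 0; 1; 1; 1; 1; 2; 0; 0; 1; 1; 0; 1; 1; 1; 1; 2; 1; 1; 2;
  2; 1; 1; 2; 2; 1]; [:: -1; -1; -1; -1; -1; -1; -2; -2; -2; -1; -1; -1; -1;
  -1; -1; -2; -2; -2; -2; -2; -2; -3; -3; -3; -3; -3; -3; -4; -1; -1; -1; -1;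
  -1; -1; -2; -1; -1; -2; -2; -1; -3; -2; -2; -3; -2; -2; -3; -2; -2; -1; -3;
  -2; -2; -3; -2; -2; -3; -4; -3; -3; -4; -4]; [:: 1; 1; 1; 1; 1; 1; 1; 1; 1;
  1; 1; 1; 1; 1; 1; 1; 1; 1; 2; 2; 2; 2; 3; 3; 2; 3; 3; 3; 1; 1; 1; 1; 1; 1;
  1; 1; 1; 2; 2; 1; 2; 2; 2; 2; 2; 2; 2; 2; 2; 1; 2; 2; 2; 2; 2; 2; 2; 3; 3;
  3; 3; 3]; [:: 0; 0; 0; 0; 0; 0; 0; 0; 0; 0; 0; 0; 0; 0; 0; 0; 0; 0; -1; -1;
  -1; -1; -1; -1; -1; -1; -1; -1; 0; 0; 0; 0; 0; 0; 0; 0; 0; -1; -1; 0; 0; 0;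
  0; 0; 0; 0; 0; -1; -1; 0; 0; 0; 0; 0; 0; 0; 0; -1; -1; -1; -1; -1]; [:: 0;
  0; 0; 0; 0; 0; 0; 0; 0; 0; 0; 0; 0; 0; 0; 0; 0; 0; 0; 0; 0; 0; 0; 0; 0; 0;
  -1; -1; 0; 0; 0; 0; 0; 0; 0; 0; 0; 0; 0; 0; 0; 0; 0; 0; 0; -1; -1; -1; -1;
  -1; -1; -1; -1; -1; -1; -1; -1; -1; -1; -1; -1; -1]; [:: 0; 0; 0; 0; 0; 0;
  0; 0; -1; 0; 0; 0; 0; 0; 0; 0; 0; -1; 0; 0; 0; 0; 0; -1; 0; 0; 0; 0; 0; 0;
  0; 0; 0; 0; 0; 0; -1; 0; 0; 0; 0; 0; -1; 0; 0; 0; 0; 1; 1; 1; 1; 1; 0; 0; 0;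
  0; 0; 0; 0; 0; 0; 0]; [:: 0; 0; 0; -1; -1; -1; -1; -1; -1; 0; 0; 0; 0; 0; 0;
  0; 0; 0; 0; 0; 0; 0; 0; 0; -1; -1; -1; -1; 0; 0; 0; 0; 0; 0; 0; 0; 0; 0; 0;
  0; 0; 0; 0; -1; -1; -1; -1; 0; 0; 0; 0; 0; 0; 0; 0; 0; 0; 0; 0; 0; 0; -1];
  [:: 0; 0; 0; -1; 0; 0; 0; 0; 0; 0; 0; 0; -1; 0; 0; 0; 0; 0; -1; 0; 0; 0; 0;
  0; -1; -1; 0; 0; 0; 0; 0; -1; 0; 0; 0; 0; 0; -1; 0; 0; 0; 0; 0; -1; -1; 0;
  0; -1; 0; 0; 0; 0; 0; -1; -1; 0; 0; -1; -1; 0; 0; -1]; [:: 0; 0; 0; 0; 0; 0;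
  0; 0; 0; 0; 0; 0; 0; 0; 0; 0; 0; 0; -1; -1; -1; -1; -1; -1; -1; -1; -1; -1;
  0; 0; 0; 0; 0; 0; 0; 0; 0; 0; 0; 0; 0; 0; 0; 0; 0; 0; 0; 0; 0; 0; 0; 0; 0;
  0; 0; 0; 0; -1; -1; -1; -1; -1]; [:: 1; 1; 1; 1; 1; 1; 1; 1; 1; 1; 1; 1; 1;
  1; 1; 1; 1; 1; 1; 1; 1; 2; 2; 2; 2; 2; 2; 2; 1; 1; 1; 1; 1; 1; 1; 1; 1; 1;
  1; 1; 2; 2; 2; 2; 2; 2; 2; 1; 1; 1; 2; 2; 2; 2; 2; 2; 2; 2; 2; 2; 3; 3]; [::
  0; 0; 0; 0; 0; 0; 0; 0; 0; 0; 0; 0; 0; 0; 0; 0; 0; 0; 0; 0; 0; 0; 0; 0; 0;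
  0; 0; 0; 0; 0; 1; 0; 0; 1; 0; 1; 1; 0; 0; 1; 0; 1; 1; 0; 1; 1; 1; 0; 0; 1;
  0; 1; 1; 0; 1; 1; 1; 0; 1; 1; 1; 1]; [:: 0; 0; 0; 0; 0; 0; -1; 0; 0; 0; 0;
  0; 0; 0; 0; -1; 0; 0; 0; 0; 0; -1; 0; 0; -1; 0; 0; -1; 0; 0; 0; 0; 0; 0; -1;
  0; 0; 0; 0; 0; -1; 0; 0; -1; 0; 0; -1; 0; 0; 0; -1; 0; 0; -1; 0; 0; -1; -1;
  0; 0; -1; -1]; [:: 0; 0; 0; 0; 0; 0; 0; 0; -1; 0; 0; 0; 0; 0; 0; 0; 0; -1;
  0; 0; 0; 0; 0; -1; 0; 0; -1; -1; 0; 0; 0; 0; 0; 0; 0; 0; -1; 0; 0; 0; 0; 0;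
  -1; 0; 0; -1; -1; 0; 0; 0; 0; 0; -1; 0; 0; -1; -1; 0; 0; -1; -1; -1]; [:: 0;
  0; 0; 0; 0; 0; 0; 0; 0; 0; 0; 0; 0; 0; 0; 0; 0; 0; 0; 0; 0; 0; 0; 0; 0; 0;
  0; 0; 0; 0; 0; 0; 0; 0; 0; 0; 0; 0; 0; 0; 0; 0; 0; 0; 0; 0; 0; -1; -1; -1;
  -1; -1; -1; -1; -1; -1; -1; -1; -1; -1; -1; -1]]%Z.

(** The weights w whose tropical vectors are the extreme rays, restricted to the
    nine faces in the upper left 3 x 3 square; w vanishes on the other faces. They
    are listed in the order in which the rays are computed. *)
Definition directions : seq (seq int) := [::
  [:: 0; 0; 0; 0; 0; 0; 1; 0; 0]; [:: 0; 0; 0; 1; 0; 0; -1; 0; 0]; [:: 0; 0;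
  1; 0; 0; 0; 0; 0; 0]; [:: 1; 0; 0; -1; 0; 0; 0; 0; 0]; [:: 0; 1; -1; 0; 0;
  0; 0; 0; 0]; [:: 1; -1; 0; 0; 0; 0; 0; 0; 0]; [:: -1; 0; 0; 0; 0; 0; 0; 0;
  0]; [:: 0; 0; 0; 0; 0; 0; 0; 0; -1]; [:: 0; 1; 0; 1; 0; -1; 0; -1; 0]; [::
  1; -1; 0; -1; 0; 1; 0; 1; -1]; [:: 0; -1; 0; 0; 0; 0; 0; 0; 0]; [:: 0; 0; 0;
  -1; 0; 0; 0; 0; 0]; [:: 0; 0; 1; 0; 2; -1; 1; -1; -1]; [:: 1; 0; -1; 0; 0;
  0; 0; 0; 0]; [:: 0; 0; 0; 1; -1; 0; 0; 0; 0]; [:: 0; 2; -1; 1; -2; 0; -1; 0;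
  1]; [:: 1; -1; 0; 0; 0; 1; 0; 1; -1]; [:: 1; -1; 0; 0; -1; 1; 0; 1; -1]; [::
  2; 0; -1; 1; -2; 0; -1; 0; 1]; [:: 0; 1; 0; 1; -1; 0; -1; 0; 0]; [:: 1; 0;
  -1; 0; -1; 0; 0; 0; 1]; [:: 0; 1; 0; 0; -1; 0; 0; 0; 0]; [:: 1; 0; -1; 1;
  -1; 0; -1; 0; 1]; [:: 1; 0; -1; 0; 0; 0; 0; -1; 0]; [:: 1; -1; 0; 0; 0; 1;
  0; 0; 0]; [:: 0; 1; 0; 1; -1; 0; 0; 0; 0]; [:: 0; 1; 0; 2; -1; -1; 0; -1;
  0]; [:: 0; 1; 0; 1; -1; 0; 0; -1; 0]; [:: 0; 1; 0; 0; -1; 0; 0; 1; 0]; [::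
  0; 1; 0; 1; -1; -1; -1; 0; 0]; [:: 0; 1; 0; 1; -2; 0; -1; 0; 1]; [:: 2; 0;
  -1; 0; -1; 0; -1; 0; 1]; [:: 0; 1; 0; 1; -1; -1; 0; 0; 0]; [:: 0; 2; 0; 1;
  -1; -1; 0; -1; 0]; [:: 0; 2; -1; 2; -3; 0; -1; 0; 1]; [:: 1; 0; 0; 1; -1; 0;
  -1; 0; 0]; [:: 0; 1; -1; 0; -1; 0; 0; 0; 1]; [:: 1; 0; 0; 0; -1; 0; 0; 0;
  0]; [:: 0; 1; -1; 1; -1; 0; -1; 0; 1]; [:: 0; 1; -1; 0; 0; 0; 0; -1; 0]; [::
  0; 0; 0; 0; 0; 1; 0; 0; 0]; [:: 1; 1; -1; 1; 0; -1; 0; -1; 0]; [:: 1; 1; -1;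
  0; 0; 0; 0; -1; 0]; [:: 1; 0; 0; 0; -1; 0; 0; 1; 0]; [:: 1; 0; 0; 1; -1; -1;
  -1; 0; 0]; [:: 1; 0; 0; 1; -2; 0; -1; 0; 1]; [:: 1; 1; -1; 0; -1; 0; -1; 0;
  1]; [:: 1; 2; -2; 1; -2; 0; -1; 0; 1]; [:: 1; 0; 0; 0; 0; 0; 0; 0; 0]; [::
  1; 0; 0; 0; 0; -1; 0; 0; 0]; [:: 1; 1; 0; 0; 0; -1; 0; -1; 0]; [:: 0; 0; 0;
  0; 0; 0; 0; 1; 0]; [:: 1; 0; 0; 0; 0; 0; -1; 0; 0]; [:: 1; 0; 0; 1; 0; -1;
  -1; 0; 0]; [:: 1; 1; 0; 1; 0; -1; -1; -1; 0]; [:: 0; 0; 0; 0; 0; -1; 0; 0;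
  0]; [:: 0; 0; 0; 0; -1; 0; 0; 0; 1]; [:: 0; 0; 0; 1; 0; -1; -1; 0; 0]; [::
  0; 0; 0; 1; -1; 0; -1; 0; 1]; [:: 0; 0; 0; 0; 0; 0; 0; -1; 0]; [:: 0; 1; 0;
  2; -1; -1; -1; 0; 0]; [:: 0; 2; 0; 2; -1; -1; -1; -1; 0]; [:: 1; 0; 0; 1; 0;
  -1; 0; -1; 0]; [:: 1; 0; 0; 0; 0; 0; 0; -1; 0]; [:: 0; 2; -1; 2; -1; -1; 0;
  -1; 0]; [:: 0; 2; -1; 1; -1; 0; 0; -1; 0]; [:: 1; 0; 0; -1; 0; 0; 0; 1; 0];
  [:: 1; 0; 0; 0; 0; -1; -1; 0; 0]; [:: 1; 0; 0; 0; -1; 0; -1; 0; 1]; [:: 2;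
  -1; 0; -1; 0; 1; 0; 1; -1]; [:: 2; -1; 0; -1; -1; 1; 0; 1; -1]; [:: 1; 1;
  -1; 0; -2; 0; 0; 0; 1]; [:: 1; 1; -1; 2; -2; 0; -2; 0; 1]; [:: 1; 1; -1; 1;
  -1; 0; -1; -1; 0]; [:: 1; 0; 0; 1; -1; 1; -1; 0; 0]; [:: 1; 1; -1; 1; -1; 0;
  -1; 0; 0]; [:: 0; 1; -1; 1; -2; 0; 0; 0; 1]; [:: 1; 1; -1; 0; -2; 0; 0; 1;
  1]; [:: 1; 1; -1; 0; -1; 0; 0; -1; 0]; [:: 1; 0; 0; 0; -1; 1; 0; 0; 0]; [::
  1; 1; -1; 0; -1; 0; 0; 0; 0]; [:: 0; 1; -1; 2; -2; 0; -1; 0; 1]; [:: 1; 0;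
  0; -1; 0; 1; 0; 1; -1]; [:: 1; 0; 0; -1; -1; 1; 0; 1; -1]; [:: 2; 1; -1; 0;
  -2; 0; -1; 0; 1]; [:: 0; 0; 0; 0; 0; 1; 0; 1; -1]; [:: 0; 0; 0; 0; -1; 1; 0;
  1; -1]; [:: 0; 1; -1; 1; -1; 0; 0; -1; 0]; [:: 0; 0; 0; 1; -1; 1; 0; 0; 0];
  [:: 0; 1; -1; 1; -1; 0; 0; 0; 0]; [:: 1; 0; 0; 0; -1; 1; 0; 1; 0]; [:: 1; 1;
  -1; 0; -1; 0; 0; 1; 0]; [:: 1; 1; -1; 1; -1; -1; -1; -1; 0]; [:: 1; 1; -1;
  1; -1; -1; -1; 0; 0]; [:: 1; 0; 0; 1; -2; 1; -1; 0; 1]; [:: 1; 1; -1; 1; -2;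
  0; -1; 0; 1]; [:: -2; 0; 1; 0; 2; -1; 1; -1; -1]; [:: -1; 0; 1; 0; 1; -1; 0;
  -1; 0]; [:: -1; 0; 1; 1; 1; -2; 0; -1; 0]; [:: -1; 0; 0; 0; 0; 0; 0; 0; 1];
  [:: -1; 1; 0; 0; 1; -1; 1; -2; 0]; [:: -1; 0; 0; 0; 1; -1; 1; -1; 0]; [::
  -1; 0; 0; 0; 1; -1; 0; -1; 0]; [:: 1; 0; 0; 0; 1; -1; 0; -1; 0]; [:: 1; -1;
  0; 0; 0; 1; 0; 0; -1]; [:: 0; 0; 0; 0; 0; 1; 0; 0; -1]; [:: 0; 0; 0; -1; 0;
  1; 0; 1; -1]; [:: 2; -1; -1; -1; 0; 1; 0; 1; -1]; [:: 1; 0; -1; 0; -1; 0; 0;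
  0; 0]; [:: 2; -2; 0; -1; 0; 2; 0; 1; -1]; [:: 1; -1; 0; 0; -1; 1; 0; 0; 0];
  [:: 1; 0; -1; -1; 0; 1; 0; 1; -1]; [:: 0; 1; -1; 0; -1; 0; 0; 0; 0]; [:: 1;
  -1; 0; -1; 0; 2; 0; 1; -1]; [:: 0; 0; 0; 0; -1; 1; 0; 0; 0]; [:: -1; 0; 0;
  0; 1; 0; 1; -1; -1]; [:: 0; 0; 1; 0; 1; -1; 0; 0; 0]; [:: 0; 0; 0; 0; 1; -1;
  0; 0; 0]; [:: -1; 0; 1; 0; 1; 0; 1; -1; -1]; [:: -1; 0; 0; 0; 1; 0; 1; -1;
  0]; [:: -1; 0; 0; 0; 1; 0; 0; -1; 0]; [:: 0; 0; 1; 0; 1; -1; 0; 0; -1]; [::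
  -1; 1; 0; 0; 1; 0; 1; -1; -1]; [:: 0; 0; 1; 0; 1; -1; 1; 0; -1]; [:: 0; 0;
  1; 1; 1; -1; 0; 0; -1]; [:: 1; -2; 0; -1; 0; 1; 0; 1; -1]; [:: 0; -1; 0; 0;
  1; 0; 0; 0; 0]; [:: 1; -1; 0; 0; 0; 0; -1; 0; 0]; [:: 1; -1; 0; -1; 0; 0; 0;
  1; -1]; [:: 1; -1; 0; -1; 1; 0; 0; 1; -1]; [:: 1; -1; 0; -1; 0; 0; 0; 1; 0];
  [:: 0; -1; 1; 0; 2; -1; 1; -1; -1]; [:: 0; 0; 0; 0; 1; 0; 0; 0; 0]; [:: 0;
  0; 0; 0; -1; 0; 0; 0; 0]; [:: 0; 1; 0; 0; 0; 0; 0; -1; 0]; [:: 0; 0; 0; 1;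
  0; -1; 0; 0; 0]; [:: 0; 0; 1; 0; 0; -1; 0; 0; 0]; [:: 0; 0; 1; 1; 0; -1; 0;
  -1; 0]; [:: 0; 1; 0; 0; 0; -1; 1; -1; 0]; [:: 0; 0; 0; 0; 0; 0; 1; -1; 0];
  [:: 0; 1; -1; 0; 0; 0; 1; -1; 0]; [:: 0; 0; 1; 1; 0; -1; -1; 0; 0]; [:: 0;
  0; 0; 0; 0; 0; 0; 1; -1]; [:: 1; 0; 0; -1; 0; 0; 0; 1; -1]; [:: 0; -1; 0; 0;
  0; 1; 0; 1; -1]; [:: 1; 0; -1; -1; 0; 0; 0; 1; -1]; [:: 0; 0; -1; 0; 0; 0;
  0; 0; 0]; [:: 0; -1; 0; 0; 0; 1; 0; 0; 0]; [:: 1; -1; 0; 0; 0; 1; -1; 1;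
  -1]; [:: 0; 0; 0; 1; -1; 0; -1; 0; 0]; [:: 1; -1; 0; -1; 0; 1; 0; 2; -1];
  [:: 0; 0; 0; 0; -1; 0; 0; 1; 0]; [:: 2; -1; 0; -1; 0; 1; -1; 1; -1]; [:: 1;
  0; 0; 0; -1; 0; -1; 0; 0]; [:: 2; -1; 0; -2; 0; 1; 0; 2; -1]; [:: 1; 0; 0;
  -1; -1; 0; 0; 1; 0]; [:: 0; 0; 0; 0; 1; 0; 1; -1; -1]; [:: -1; 0; 1; 0; 1;
  -1; 0; 0; 0]; [:: -1; 0; 0; 0; 1; -1; 0; 0; 0]; [:: 0; 0; 1; 0; 1; 0; 1; -1;
  -1]; [:: 0; 0; 0; 0; 1; 0; 1; -1; 0]; [:: 0; 0; 0; 0; 1; 0; 0; -1; 0]; [::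
  -1; 0; 1; 0; 1; -1; 0; 0; -1]; [:: 0; 1; 0; 0; 1; 0; 1; -1; -1]; [:: -1; 0;
  1; 0; 1; -1; 1; 0; -1]; [:: -1; 0; 1; 1; 1; -1; 0; 0; -1]; [:: 1; -1; 0; -2;
  0; 1; 0; 1; -1]; [:: 0; 0; 0; -1; 1; 0; 0; 0; 0]; [:: 1; 0; -1; -1; 0; 0; 0;
  0; 0]; [:: 1; -1; 0; -1; 0; 1; 0; 0; 0]; [:: 1; -1; 0; -1; 0; 1; 0; 0; -1];
  [:: 1; -1; 0; -1; 1; 1; 0; 0; -1]; [:: 0; 0; 1; -1; 2; -1; 1; -1; -1]; [::
  1; -1; 0; 0; 0; 1; -1; 0; -1]; [:: 0; 0; 0; 0; 0; 0; -1; 0; 0]; [:: 0; 0; 0;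
  -1; 0; 0; 0; 1; 0]; [:: 1; -1; 0; -1; 0; 1; 0; 1; -2]; [:: 0; 0; 0; 0; 1; 0;
  0; 0; -1]; [:: 1; 0; -1; 0; 0; 0; -1; 0; 0]; [:: 1; 0; -1; 0; -1; 0; -1; 0;
  0]; [:: 1; 0; -1; 1; -1; 0; -1; 0; 0]; [:: 1; 0; -1; -1; 0; 0; 0; 1; 0]; [::
  1; 0; -1; -1; -1; 0; 0; 1; 0]; [:: 1; -1; 0; -1; 0; 1; 0; 1; 0]; [:: 1; -1;
  0; -1; -1; 1; 0; 1; 0]; [:: 1; -1; 0; 0; 0; 1; -1; 0; 0]; [:: 1; -1; 0; 0;
  -1; 1; -1; 0; 0]; [:: 2; 0; -1; 0; -1; 0; -1; 0; 0]; [:: 1; 0; -1; 0; -1; 0;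
  0; 1; 0]; [:: 1; -1; 0; 0; -1; 1; 0; 1; 0]; [:: 2; 0; -1; -1; -1; 0; 0; 1;
  0]; [:: 2; -1; 0; -1; -1; 1; 0; 1; 0]; [:: 1; -1; 0; 1; -1; 1; -1; 0; 0];
  [:: 2; -1; 0; 0; -1; 1; -1; 0; 0]; [:: 1; 1; -1; 0; -1; 0; -1; 0; 0]; [:: 0;
  1; -1; 0; -1; 0; 0; 1; 0]; [:: 0; 0; 0; 0; -1; 1; 0; 1; 0]; [:: 1; 1; -1;
  -1; -1; 0; 0; 1; 0]; [:: 1; 0; 0; -1; -1; 1; 0; 1; 0]; [:: 0; 0; 0; 1; -1;
  1; -1; 0; 0]; [:: 0; 1; -1; 1; -1; 0; -1; 0; 0]; [:: 1; 0; 0; 0; -1; 1; -1;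
  0; 0]; [:: 0; 0; 0; -1; 0; 0; 0; 1; -1]; [:: 0; 0; 0; -1; 1; 0; 0; 1; -1];
  [:: 0; 0; 0; -1; 1; 0; 0; 0; -1]; [:: 0; -1; 0; 0; 0; 1; 0; 0; -1]; [:: 0;
  -1; 0; 0; 1; 1; 0; 0; -1]; [:: 0; -1; 0; 0; 1; 0; 0; 0; -1]; [:: 0; 0; 1; 0;
  0; 0; 0; 0; -1]; [:: 0; 1; 0; 0; 0; 0; 0; 0; 0]; [:: 0; 0; 0; 0; 0; 0; 1; 0;
  -1]; [:: 0; 0; 0; 1; 0; 0; 0; 0; -1]; [:: 0; 0; 1; 0; 0; 0; 1; 0; -1]; [::
  0; 0; 1; 1; 0; 0; 0; 0; -1]; [:: 0; 0; 0; 1; 0; 0; 0; 0; 0]; [:: 0; 1; 0; 0;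
  0; 0; 0; 0; -1]; [:: 0; 1; 0; 0; 0; 0; 1; 0; -1]; [:: 0; 1; 0; 1; 0; 0; 0;
  0; -1]; [:: 0; -1; 0; -1; 0; 1; 0; 1; -1]; [:: -1; 0; 0; 0; 1; 0; 0; 0; 0];
  [:: 2; -2; 0; -2; 0; 1; 0; 1; -1]; [:: 1; -1; 0; -1; 1; 0; 0; 0; 0]; [:: 0;
  0; 1; -1; 0; 0; 0; 1; -1]; [:: 0; 0; 1; -1; 1; 0; 0; 1; -1]; [:: 1; -1; 1;
  -1; 0; 0; 0; 1; -1]; [:: 1; -1; 1; -1; 1; 0; 0; 1; -1]; [:: 1; -1; 0; 0; 0;
  1; 1; 0; -1]; [:: 0; 1; 0; 1; -1; 0; 0; 0; -1]; [:: 0; 0; 1; 0; 0; 0; 0; 1;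
  -1]; [:: 1; 0; 0; 0; 0; 0; 0; 0; -1]; [:: 1; 0; 1; -1; 0; 0; 0; 1; -1]; [::
  0; -1; 0; 0; 0; 1; 1; 0; -1]; [:: 0; -1; 0; 0; 1; 1; 1; 0; -1]; [:: 1; -1;
  0; -1; 0; 1; 1; 0; -1]; [:: 1; -1; 0; -1; 1; 1; 1; 0; -1]; [:: 1; -1; 1; -1;
  0; 1; 0; 1; -2]; [:: 0; 0; 1; 0; 1; 0; 0; 0; -1]; [:: 1; -1; 1; -1; 0; 1; 1;
  1; -2]; [:: 0; 0; 1; 0; 1; 0; 1; 0; -1]; [:: 1; -1; 0; -1; 0; 1; 1; 1; -2];
  [:: 0; 0; 0; 0; 1; 0; 1; 0; -1]; [:: -1; 0; 1; 0; 1; 0; 0; 0; -1]; [:: -1;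
  0; 1; 0; 1; 0; 1; 0; -1]; [:: 0; -1; 1; 0; 1; 0; 0; 0; -1]; [:: 0; -1; 1; 0;
  1; 0; 1; 0; -1]; [:: 1; -1; 1; -1; 1; 0; 0; 0; -1]; [:: 1; -1; 1; -1; 1; 0;
  1; 0; -1]; [:: 0; 0; 1; -1; 1; 0; 0; 0; -1]; [:: 0; 0; 1; -1; 1; 0; 1; 0;
  -1]; [:: -1; 0; 0; 0; 1; 0; 1; 0; -1]; [:: 0; -1; 0; 0; 1; 0; 1; 0; -1]; [::
  1; -1; 0; -1; 1; 0; 0; 0; -1]; [:: 1; -1; 0; -1; 1; 0; 1; 0; -1]; [:: -1; 0;
  0; 0; 1; 0; 0; 0; -1]; [:: 0; 0; 0; -1; 1; 0; 1; 0; -1]; [:: 0; 0; 0; 0; 0;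
  1; 1; 0; -1]; [:: -1; 1; 0; 0; 1; -1; 0; -1; 0]; [:: -1; 1; 0; 1; 1; -2; 0;
  -1; 0]; [:: -1; 1; 0; 1; 1; -1; 0; -2; 0]; [:: -1; 0; 0; 1; 1; -1; 0; -1;
  0]; [:: 0; 1; 0; 0; 0; -1; 0; 0; 0]; [:: 0; 0; 0; 1; 0; 0; 0; -1; 0]; [:: 0;
  1; -1; 1; 0; 0; 0; -1; 0]; [:: 0; 1; 0; 1; 0; -1; -1; 0; 0]; [:: 0; 1; 1; 1;
  0; -1; 0; -1; 0]; [:: 0; 0; 1; 1; 0; -1; 0; 0; 0]; [:: 0; 1; -1; 1; -1; 0;
  0; 0; 1]; [:: 0; 2; -1; 1; -1; 0; 0; -1; 1]; [:: 0; 1; 0; 1; -1; 0; 0; 0;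
  1]; [:: 0; 1; 0; 0; 0; 0; 1; -1; 0]; [:: 0; 1; 0; 1; 0; -1; 1; -1; 0]; [::
  0; 1; 0; 1; -1; -1; 0; 0; 1]; [:: 0; 1; 0; 0; -1; 0; 0; 0; 1]; [:: 1; 1; -1;
  0; -1; 0; 0; 0; 1]; [:: 0; 0; 0; 1; -1; 0; 0; 0; 1]; [:: 0; 1; 0; 1; -1; 0;
  0; -1; 1]; [:: 0; 1; 0; 1; -2; 0; 0; 0; 1]; [:: 0; 1; 0; 2; -1; -1; -1; 0;
  1]; [:: 0; 1; 0; 1; -1; 0; -1; 0; 1]; [:: 0; 1; 0; 2; 0; -2; -1; -1; 0]; [::
  0; 1; 0; 1; 0; -1; -1; -1; 0]; [:: 1; 0; 0; 1; -1; 0; -1; 0; 1]; [:: 0; 0;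
  0; 1; 0; -1; 0; -1; 0]; [:: 0; 1; 0; 1; 0; -1; 0; -2; 0]; [:: 0; 1; -1; 1;
  0; -1; 0; -1; 0]; [:: 0; 2; -1; 1; 0; -1; 0; -2; 0]; [:: 1; 0; 0; 1; 0; -1;
  -1; -1; 0]; [:: 1; 1; -1; 1; 0; -1; -1; -1; 0]; [:: 0; 1; 0; 2; -1; -1; -1;
  -1; 0]; [:: 0; 2; -1; 2; -1; -1; -1; -1; 0]; [:: 1; 1; -1; 1; -1; 0; -1; 0;
  1]; [:: 0; 1; 0; 2; -2; 0; -1; 0; 1]; [:: 0; 2; -1; 2; -2; 0; -1; 0; 1]; [::
  0; 1; 0; 1; 0; -2; 0; -1; 0]; [:: 0; 1; 0; 0; 0; -1; 0; -1; 0]; [:: 1; 0; 0;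
  0; 0; -1; 0; -1; 0]; [:: 1; 1; -1; 0; 0; -1; 0; -1; 0]; [:: 0; 1; 0; 1; -1;
  -1; 0; -1; 0]; [:: 0; 2; -1; 1; -1; -1; 0; -1; 0]; [:: 1; 0; 0; 0; -1; 0; 0;
  0; 1]; [:: 0; 2; -1; 1; -2; 0; 0; 0; 1]; [:: -1; 0; 1; 0; 1; -1; 1; -1; 0];
  [:: 0; 1; 1; 1; 0; -1; 0; -1; -1]; [:: 0; 0; 1; 1; 0; -1; 0; 0; -1]; [:: 0;
  2; 0; 1; 0; -1; 0; -1; 0]; [:: 0; 1; 0; 1; 0; -1; 0; 0; 0]; [:: 0; 2; 0; 1;
  0; -1; 0; -1; -1]; [:: 0; 1; 0; 1; 0; -1; 0; 0; -1]; [:: 0; 1; 0; 0; 0; 0;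
  1; -1; -1]; [:: 0; 1; 0; 1; 0; -1; 1; -1; -1]; [:: 0; 1; 0; 1; 0; 0; 0; -1;
  -1]; [:: 0; 1; 0; 2; 0; -1; 0; -1; -1]; [:: 0; 1; 0; 1; 0; 0; 0; -1; 0]; [::
  0; 1; 0; 2; 0; -1; 0; -1; 0]; [:: -1; 0; 1; 0; 1; -1; 1; -1; -1]; [:: -1; 1;
  0; 0; 1; -1; 1; -1; 0]; [:: -1; 1; 0; 0; 1; -1; 1; -1; -1]; [:: -1; 1; 0; 1;
  1; -1; 0; -1; -1]; [:: -1; 0; 1; 1; 1; -1; 0; -1; -1]; [:: -1; 1; 0; 1; 1;
  -1; 0; -1; 0]; [:: -1; 0; 1; 1; 1; -1; 0; -1; 0]; [:: -1; 0; 0; 0; 2; -1; 1;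
  -1; -1]; [:: -1; 0; 2; 0; 2; -1; 1; -1; -1]; [:: -1; 0; 1; 0; 2; -1; 1; -1;
  0]; [:: 0; -1; 0; 0; 1; 0; 1; -1; -1]; [:: -1; 0; 1; 0; 2; -1; 0; -1; 0];
  [:: 0; 0; 1; -1; 1; -1; 0; 0; 0]; [:: -1; 0; 1; 0; 2; -1; 1; -1; -2]; [::
  -1; 0; 0; 0; 2; -1; 1; -1; 0]; [:: -1; 0; 0; 0; 2; -1; 0; -1; 0]; [:: 0; 0;
  0; -1; 1; -1; 0; 0; 0]; [:: 0; -1; 1; 0; 1; 0; 1; -1; -1]; [:: -1; 1; 0; 0;
  2; -1; 1; -1; -1]; [:: 0; -1; 0; 0; 1; 0; 1; -1; 0]; [:: 0; -1; 0; 0; 1; 0;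
  0; -1; 0]; [:: 1; -1; 0; -1; 0; 0; 0; 0; 0]; [:: -1; 0; 1; 0; 2; -1; 0; -1;
  -1]; [:: 0; 0; 1; -1; 1; -1; 0; 0; -1]; [:: -1; 0; 1; 0; 2; -1; 2; -1; -1];
  [:: -1; 0; 1; 1; 2; -1; 0; -1; -1]; [:: 0; 0; 1; -1; 1; -1; 1; 0; -1]; [::
  -1; 0; 1; 0; 2; -1; 1; -1; -1]; [:: 0; 1; 0; 0; 1; -1; 0; -1; 0]; [:: 0; 1;
  0; 1; 1; -2; 0; -1; 0]; [:: 0; 0; 1; 0; 1; -1; 0; -1; 0]; [:: 0; 0; 1; 1; 1;
  -2; 0; -1; 0]; [:: 0; 0; 0; 0; 0; 0; 0; 0; 1]; [:: 0; 1; 0; 0; 1; -1; 1; -2;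
  0]; [:: 0; 0; 0; 0; 1; -1; 1; -1; 0]; [:: 0; 1; 0; 1; 1; -1; 0; -2; 0]; [::
  0; 0; 0; 1; 1; -1; 0; -1; 0]; [:: 0; 0; 1; 0; 1; -1; 1; -1; -1]; [:: 0; 1;
  0; 0; 1; -1; 1; -1; 0]; [:: 0; 1; 0; 0; 1; -1; 1; -1; -1]; [:: 0; 1; 0; 1;
  1; -1; 0; -1; -1]; [:: 0; 0; 1; 1; 1; -1; 0; -1; -1]; [:: 0; 1; 0; 1; 1; -1;
  0; -1; 0]; [:: 0; 0; 1; 1; 1; -1; 0; -1; 0]; [:: 0; 0; 1; 0; 1; -1; 1; -1;
  0]; [:: 0; 0; 0; 0; 1; -1; 0; -1; 0]]%Z.

(** The rotation i -> i + 1 and the reflection i -> 9 - i of the labels, and the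
    complementation of index sets, as permutations of the ranks. *)
Definition rotation : seq nat :=
  Eval vm_compute in [seq rank4 (sort leq [seq (x %% 8).+1 | x <- s]) | s <- sets4]%N.
Definition reflection : seq nat :=
  Eval vm_compute in [seq rank4 (sort leq [seq 9 - x | x <- s]) | s <- sets4]%N.
Definition duality : seq nat :=
  Eval vm_compute in [seq rank4 [seq x <- iota 1 8 | x \notin s] | s <- sets4]%N.

Definition compose (g h : seq nat) : seq nat := [seq nth 0%N g i | i <- h].

(** The number [k = 16 e + 8 f + d] encodes the d-th power of the rotation after
    the f-th power of the reflection and the e-th power of the duality. *)
Definition symmetry (k : nat) : seq nat :=
  let power n g := iter n (compose g) (iota 0 70) in
  compose (power (k %% 8) rotation)%N
    (compose (power (k %/ 8 %% 2) reflection) (power (k %/ 16) duality))%N.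

Definition orbit_ratio (c : nat * nat) : seq nat * seq nat :=
  let r := nth ([::], [::]) generator_ranks c.1 in
  (compose (symmetry c.2) r.1, compose (symmetry c.2) r.2).

(** The sets {1, 2, 3, j}, {1, 2, 4, 5}, {1, 3, 4, 5} and {2, 3, 4, 5}. Each of
    them has a constant or a product of weights of faces on the right or bottom
    side as its polynomial, and rescaling the columns makes these eight
    coordinates equal to 1. *)
Definition gauge_ranks : seq nat := [:: 0; 1; 2; 3; 4; 5; 15; 35]%N.

Definition free_ranks : seq nat :=
  Eval vm_compute in [seq k <- iota 0 70 | k \notin gauge_ranks].

(** The linear form log q - log p in the coordinates outside [gauge_ranks]. *)
Definition constraint (r : seq nat * seq nat) : seq Z :=
  [seq BinInt.Z.sub (BinInt.Z.of_nat (count_mem k r.2))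
         (BinInt.Z.of_nat (count_mem k r.1)) | k <- free_ranks].

Definition constraints : seq (seq Z) :=
  Eval vm_compute in [seq constraint (orbit_ratio c) | c <- ratio_order].

Definition start_rays : seq (seq Z) :=
  Eval vm_compute in [seq [seq Z_of_int x | x <- v] | v <- start_vectors].

Definition direction_vectors : seq (seq Z) :=
  Eval vm_compute in [seq nseq 7 Z0 ++ [seq Z_of_int x | x <- w] | w <- directions].

Lemma constraintsE : constraints = [seq constraint (orbit_ratio c) | c <- ratio_order].
Proof. by vm_compute. Qed.

Definition integer_terms (k : nat) : seq (seq Z) :=
  [seq [seq BinInt.Z.of_nat n | n <- e] | e <- terms k].

Definition maxZ (s : seq Z) : Z :=
  if s is x :: s' then foldr BinInt.Z.max x s' else Z0.

(** The leading exponent of a polynomial with exponent vectors [es] along the curve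
    t^w. *)
Definition tropical (w : seq Z) (es : seq (seq Z)) : Z := maxZ [seq dotZ w e | e <- es].

Lemma start_dual :
  all (fun i => let w := nth [::] start_rays i in
     if size w == 62 then
       all (fun j => BinInt.Z.eqb (dotZ (nth [::] constraints j) w)
            (if i == j then BinInt.Z.of_nat 1 else Z0)) (iota 0 62) else false) (iota 0 62).
Proof. by vm_compute. Qed.

(** The main computation: 270 further constraints lead from the simplicial start
    cone to the cone with the 360 tropical vectors as extreme rays. *)
Lemma final_rays :
  let tab := [seq integer_terms k | k <- free_ranks] in
  [seq r.1.1 | r <- iter 270 dd_step [seq start_ray 62 constraints w | w <- start_rays]]
  == [seq [seq tropical w es | es <- tab] | w <- direction_vectors].
Proof. by vm_compute. Qed.

Lemma tropical_gauge :
  let tab := [seq integer_terms k | k <- gauge_ranks] in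
  all (fun w => all (fun es => BinInt.Z.eqb (tropical w es) Z0) tab) direction_vectors.
Proof. by vm_compute. Qed.

Definition relation_image (g : seq nat) (r : relation3) : relation3 :=
  let: ((x, x'), (a, a'), (b, b')) := r in
  let h := nth 0%N g in ((h x, h x'), (h a, h a'), (h b, h b')).

Definition sort2 (p : nat * nat) : nat * nat := if (p.1 <= p.2)%N then p else (p.2, p.1).

(** Symmetries may exchange the factors of a term, and the two terms of a sum. *)
Definition normal_relation (r : relation3) : relation3 :=
  let: (p, q, q') := r in
  let q1 := sort2 q in let q2 := sort2 q' in
  if (q1.1 <= q2.1)%N then (sort2 p, q1, q2) else (sort2 p, q2, q1).

(** The buckets by the first factor only speed up the search. *)
Definition preserves_relations (g : seq nat) : bool :=
  let nrel := [seq normal_relation r | r <- relations] in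
  let buckets := [seq [seq r <- nrel | r.1.1.1 == k] | k <- iota 0 70] in
  all (fun r => let r' := normal_relation (relation_image g r) in
         r' \in nth [::] buckets r'.1.1.1) relations.

Lemma generators_preserve :
  all preserves_relations [:: rotation; reflection; duality].
Proof. by vm_compute. Qed.

Opaque relations sets4 rank4 exponent_table.

Opaque constraints start_rays direction_vectors symmetry ratio_order generator_ranks.

Section Symmetry.
Variable R : realType.
Implicit Types (P Q : nat -> R) (g h : seq nat).

Lemma plucker_function_eq P Q : (forall k, (k < 70)%N -> P k = Q k) ->
  plucker_function P -> plucker_function Q.
Proof.
move=> hPQ hP r hr; have := hP r hr; have := @relation_factors r _ hr.
case: r {hr} => [[[x x'] [a a']] [b b']] /= h.
by rewrite !hPQ //; apply: h; rewrite !inE eqxx ?orbT.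
Qed.

Lemma three_term_normal P r : three_term P (normal_relation r) <-> three_term P r.
Proof.
case: r => [[[x x'] [a a']] [b b']]; rewrite /normal_relation /sort2 /=.
by do 4 case: ifP => _ /=; rewrite ?(mulrC (P x')) ?(mulrC (P a')) ?(mulrC (P b')) 1?addrC.
Qed.

Lemma bucket_mem (T : eqType) (key : T -> nat) (s : seq T) n k x :
  x \in nth [::] [seq [seq y <- s | key y == j] | j <- iota 0 n] k -> x \in s.
Proof.
have [hk|hk] := ltnP k n; last by rewrite nth_default ?size_map ?size_iota.
by rewrite (nth_map 0%N) ?size_iota // mem_filter => /andP[].
Qed.

Lemma preserves_relationsP P g : preserves_relations g -> plucker_function P ->
  plucker_function (fun k => P (nth 0%N g k)).
Proof.
move=> hg hP r hr; suff : three_term P (relation_image g r).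
  by case: r {hr} => [[[x x'] [a a']] [b b']].
apply/three_term_normal; move/allP/(_ r hr): hg; cbv beta zeta.
set r' := normal_relation _ => h.
have : r' \in [seq normal_relation r | r <- relations].
  exact: bucket_mem h.
by case/mapP => r0 hr0 ->; apply/three_term_normal/hP.
Qed.

Definition is_symmetry g : Prop :=
  [/\ size g = 70, forall k, (k < 70)%N -> (nth 0 g k < 70)%N &
      forall P, plucker_function P -> plucker_function (fun k => P (nth 0%N g k))].

Lemma nth_compose g h i : (i < size h)%N -> nth 0%N (compose g h) i = nth 0%N g (nth 0%N h i).
Proof. exact: nth_map. Qed.

Lemma compose_symmetry g h : is_symmetry g -> is_symmetry h -> is_symmetry (compose g h).
Proof.
move=> [sg bg pg] [sh bh ph]; split; first by rewrite size_map.
  by move=> k hk; rewrite nth_compose ?sh // bg // bh.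
move=> P /pg/ph; apply: plucker_function_eq => k hk.
by rewrite nth_compose ?sh.
Qed.

Lemma power_symmetry n g : is_symmetry g -> is_symmetry (iter n (compose g) (iota 0 70)).
Proof.
move=> hg; elim: n => [|n IHn]; last exact: compose_symmetry.
split=> [||P]; first by rewrite size_iota.
  by move=> k hk; rewrite nth_iota.
by apply: plucker_function_eq => k hk; rewrite nth_iota.
Qed.

Lemma symmetryP k : is_symmetry (symmetry k).
Proof.
have hg g : g \in [:: rotation; reflection; duality] -> is_symmetry g.
  move=> hg; have h : size g = 70%N /\ all (ltn^~ 70%N) g.
    by move: hg; rewrite !inE => /or3P[] /eqP ->.
  case: h => sg /allP bg; split=> // [i hi|P]; first by apply: bg; rewrite mem_nth ?sg.
  by apply: preserves_relationsP; move/allP: generators_preserve; apply.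
Transparent symmetry.
rewrite /symmetry; apply: compose_symmetry; last apply: compose_symmetry;
  by apply: power_symmetry; apply: hg; rewrite !inE eqxx ?orbT.
Qed.

(** In face weights x with [P k = P 0 * face_value x k] the powers of [P 0] cancel,
    as p and q have the same degree. *)
Lemma generator_le P n : plucker_function P -> (forall k, (k < 70)%N -> 0 < P k) ->
  (n < 20)%N ->
  monomial P (nth ([::], [::]) generator_ranks n).1
    <= monomial P (nth ([::], [::]) generator_ranks n).2.
Proof.
move=> hP hP0 hn; set r := nth _ _ _.
have [x [hx hPx]] := face_weights_exist hP hP0.
have hr : size r.1 == size r.2 /\ all (ltn^~ 70%N) r.1 && all (ltn^~ 70%N) r.2.
  apply/andP; have : all (fun r => (size r.1 == size r.2) && (all (ltn^~ 70%N) r.1 && all (ltn^~ 70%N) r.2)) generator_ranks.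
    by vm_compute.
  by move/allP; apply; rewrite mem_nth.
case: hr => /eqP hs /andP[/allP h1 /allP h2].
have monE m : {in m, forall k, (k < 70)%N} ->
    monomial P m = P 0%N ^+ size m * monomial (face_value x) m.
  rewrite /monomial; elim: m => [|k m IHm] hm; first by rewrite !big_nil mulr1.
  rewrite !big_cons hPx ?hm ?mem_head // IHm; first by rewrite exprS; ring.
  by move=> i hi; apply: hm; rewrite inE hi orbT.
rewrite !monE // hs ler_wpM2l ?exprn_ge0 ?(ltW (hP0 _ _)) // -subr_ge0.
apply: (@generator_subtraction_free _ (fun y : R => 0 <= y)) => //; last by move=> j; apply: ltW.
by split=> // [x0 y|x0 y]; [apply: addr_ge0|apply: mulr_ge0].
Qed.

Lemma orbit_ratio_le P c : plucker_function P -> (forall k, (k < 70)%N -> 0 < P k) ->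
  (c.1 < 20)%N -> monomial P (orbit_ratio c).1 <= monomial P (orbit_ratio c).2.
Proof.
move=> hP hP0 hc; have [_ hb /(_ P hP) hQ] := symmetryP c.2.
have := @generator_le _ c.1 hQ (fun k hk => hP0 _ (hb k hk)) hc.
by rewrite /monomial /= !big_map.
Qed.

End Symmetry.

(** * Index sets and their ranks *)

Lemma plucker_set_inj : {in iota 0 70 &, injective plucker_set}.
Proof.
move=> i j; rewrite !mem_iota /= => hi hj e.
have : nth [::] sets4 i = nth [::] sets4 j by rewrite -!enum_plucker_set // e.
have hs : uniq sets4 && (size sets4 == 70) by vm_compute.
case/andP: hs => hu /eqP hs /eqP; rewrite nth_uniq ?hs // => /eqP; exact.
Qed.

Lemma card_plucker_set k : (k < 70)%N -> #|plucker_set k| = 4.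
Proof.
move=> hk; rewrite cardE -(size_map (fun i : 'I_8 => i.+1)) enum_plucker_set //.
have : all (fun k => size (nth [::] sets4 k) == 4)%N (iota 0 70) by vm_compute.
by move/allP => h; apply/eqP/h; rewrite mem_iota.
Qed.

(** The 70 sets [plucker_set k] are different, and there are 70 sets of four
    labels. *)
Lemma perm_plucker_sets :
  perm_eq (enum [pred I : {set 'I_8} | #|I| == 4]) [seq plucker_set k | k <- iota 0 70].
Proof.
have hu : uniq [seq plucker_set k | k <- iota 0 70].
  by rewrite map_inj_in_uniq ?iota_uniq //; apply: plucker_set_inj.
apply: uniq_perm => //; first exact: enum_uniq.
apply/fsym; apply: (uniq_min_size hu _ _).2.
  move=> I /mapP[k]; rewrite mem_iota /= => hk ->.
  by rewrite mem_enum inE card_plucker_set.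
rewrite size_map size_iota -cardE.
have := card_draws 'I_8 4; rewrite card_ord => h.
rewrite -[X in (_ <= X)%N](_ : 'C(8, 4) = 70)%N // -h.
by rewrite leq_eqVlt; apply/orP; left; apply/eqP/eq_card => I; rewrite !inE.
Qed.

Lemma plucker_set_surj (I : {set 'I_8}) : #|I| = 4 ->
  exists2 k, (k < 70)%N & I = plucker_set k.
Proof.
move=> hI; have : I \in enum [pred I : {set 'I_8} | #|I| == 4] by rewrite mem_enum inE hI.
by rewrite (perm_mem perm_plucker_sets) => /mapP[k]; rewrite mem_iota /= => hk ->; exists k.
Qed.

Section LogRatio.
Variable R : realType.
Implicit Types (M : 'M[R]_(4, 8)) (a : {set 'I_8} -> int).

Lemma minors_positiveP M :
  minors_positive M <-> forall k, (k < 70)%N -> 0 < minor_rank (entry M) k.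
Proof.
split=> h => [k hk|I hI].
  by rewrite -plucker_minor //; apply: h; apply: card_plucker_set.
by have [k hk ->] := plucker_set_surj hI; rewrite plucker_minor // h.
Qed.

(** The logarithm of the ratio, when [F] is the logarithm of the coordinates. *)
Definition pairing a (F : nat -> R) : R :=
  \sum_(k <- iota 0 70) (a (plucker_set k))%:~R * F k.

Lemma pairingD a F G : pairing a (fun k => F k + G k) = pairing a F + pairing a G.
Proof. by rewrite /pairing -big_split; apply: eq_bigr => k _; rewrite mulrDr. Qed.

Lemma pairingZ a c F : pairing a (fun k => c * F k) = c * pairing a F.
Proof. by rewrite /pairing mulr_sumr; apply: eq_bigr => k _; rewrite mulrCA. Qed.

Lemma eq_pairing a F G : (forall k, (k < 70)%N -> F k = G k) -> pairing a F = pairing a G.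
Proof. by move=> h; apply: eq_big_seq => k; rewrite mem_iota => /h ->. Qed.

Lemma expR_int (z : int) (x : R) : expR (z%:~R * x) = expR x ^ z.
Proof.
case: z => n; first by rewrite -exprnP -expRM_natl.
by rewrite NegzE mulNr expRN -exprnN -expRM_natl.
Qed.

Lemma log_ratio M a : minors_positive M ->
  plucker_ratio a M = expR (pairing a (fun k => ln (minor_rank (entry M) k))).
Proof.
move=> hM; rewrite /plucker_ratio /pairing expR_sum.
have -> : \prod_(I : {set 'I_8} | #|I| == 4%N) plucker M I ^ a I
    = \prod_(I <- enum [pred I : {set 'I_8} | #|I| == 4%N]) plucker M I ^ a I.
  by rewrite big_enum.
rewrite (perm_big _ perm_plucker_sets) big_map; apply: eq_big_seq => k.
rewrite mem_iota /= => hk; rewrite plucker_minor // expR_int lnK // posrE.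
by move/minors_positiveP: hM; apply.
Qed.

(** * Rescaling the columns *)

Definition label_sum (t : nat -> R) (k : nat) : R := \sum_(l <- nth [::] sets4 k) t l.

Lemma labels_bounded k l : (k < 70)%N -> l \in nth [::] sets4 k -> (0 < l <= 8)%N.
Proof.
move=> hk; have : all (fun k => all (fun l => 0 < l <= 8)%N (nth [::] sets4 k)) (iota 0 70).
  by vm_compute.
by move/allP/(_ k); rewrite mem_iota => /(_ hk)/allP; apply.
Qed.

Lemma sets4_quadruple k : (k < 70)%N ->
  exists a b c d : nat, nth [::] sets4 k = [:: a; b; c; d].
Proof.
move=> hk; have : size (nth [::] sets4 k) = 4%N.
  by rewrite -enum_plucker_set // size_map -cardE card_plucker_set.
by case: (nth _ _ _) => [|a [|b [|c [|d []]]]] // _; exists a, b, c, d.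
Qed.

Lemma minor_scale (u v : nat -> nat -> R) (t : nat -> R) k : (k < 70)%N ->
  (forall l i, (0 < l <= 8)%N -> (i < 4)%N -> v l i = u l i * expR (t l)) ->
  minor_rank v k = minor_rank u k * expR (label_sum t k).
Proof.
move=> hk huv; rewrite /minor_rank /label_sum.
have hl := labels_bounded hk; have [a [b [c [d e]]]] := sets4_quadruple hk.
rewrite e in hl *; rewrite !big_cons big_nil addr0 !expRD /minor /= /det4 /det2.
have ha : (0 < a <= 8)%N by apply: hl; rewrite !inE eqxx ?orbT.
have hb : (0 < b <= 8)%N by apply: hl; rewrite !inE eqxx ?orbT.
have hc : (0 < c <= 8)%N by apply: hl; rewrite !inE eqxx ?orbT.
have hd : (0 < d <= 8)%N by apply: hl; rewrite !inE eqxx ?orbT.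
rewrite !(huv _ _ ha) // !(huv _ _ hb) // !(huv _ _ hc) // !(huv _ _ hd) //; ring.
Qed.

Definition matrix_of (u : nat -> nat -> R) : 'M[R]_(4, 8) := \matrix_(i, j) u j.+1 i.

Lemma entry_matrix_of u l i : (0 < l <= 8)%N -> (i < 4)%N -> entry (matrix_of u) l i = u l i.
Proof. by case: l => // l hl hi; rewrite /entry mxE !inordK. Qed.

Lemma minor_matrix_of u k : (k < 70)%N -> minor_rank (entry (matrix_of u)) k = minor_rank u k.
Proof.
move=> hk; rewrite (@minor_scale u _ (fun=> 0)) //.
  by rewrite /label_sum big1_eq expR0 mulr1.
by move=> l i hl hi; rewrite expR0 mulr1 entry_matrix_of.
Qed.

Definition rescale M (t : nat -> R) : 'M[R]_(4, 8) :=
  matrix_of (fun l i => entry M l i * expR (t l)).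

Lemma minor_rescale M t k : (k < 70)%N ->
  minor_rank (entry (rescale M t)) k = minor_rank (entry M) k * expR (label_sum t k).
Proof. by move=> hk; rewrite minor_matrix_of //; apply: minor_scale. Qed.

Lemma rescale_positive M t : minors_positive M -> minors_positive (rescale M t).
Proof.
move=> /minors_positiveP hM; apply/minors_positiveP => k hk.
by rewrite minor_rescale // mulr_gt0 ?hM ?expR_gt0.
Qed.

Lemma ln_minor_rescale M t k : minors_positive M -> (k < 70)%N ->
  ln (minor_rank (entry (rescale M t)) k) = ln (minor_rank (entry M) k) + label_sum t k.
Proof.
move=> /minors_positiveP hM hk; apply: expR_inj.
rewrite expRD lnK ?posrE; last by apply/minors_positiveP: k hk; apply: rescale_positive; apply/minors_positiveP.
by rewrite minor_rescale // lnK // posrE hM.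
Qed.

(** * Boundedness *)

(** A function b + t s of t >= 0 that is bounded above does not increase. *)
Lemma bounded_slope (b c s : R) : (forall t, 0 <= t -> b + t * s <= c) -> s <= 0.
Proof.
move=> h; rewrite leNgt; apply/negP => hs.
have := h ((`|c - b| + 1) / s); rewrite divfK ?gt_eqF //.
have h1 : c - b <= `|c - b| by apply: ler_norm.
have h2 : 0 <= (`|c - b| + 1) / s by apply: divr_ge0; [apply: addr_ge0|exact: ltW].
move=> /(_ h2); lra.
Qed.

(** A convenient form of boundedness, as exp y is at least y. *)
Lemma pairing_bounded a C M : ratio_le a C -> minors_positive M ->
  pairing a (fun k => ln (minor_rank (entry M) k)) <= C.
Proof.
move=> hC hM; apply: le_trans (hC M hM); rewrite log_ratio //.
apply: le_trans (expR_ge1Dx _); lra.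
Qed.

(** Multiplying the column [l] by exp (c t_l) multiplies the ratio by the
    exponential of c times this pairing, for all real c. *)
Lemma bounded_degree a t M : ratio_bounded R a -> minors_positive M ->
  pairing a (label_sum t) = 0.
Proof.
move=> [C hC] hM.
have h u : pairing a (label_sum u) <= 0.
  apply: (@bounded_slope (pairing a (fun k => ln (minor_rank (entry M) k))) C) => c _.
  have := pairing_bounded hC (rescale_positive (fun l => c * u l) hM).
  rewrite (eq_pairing _ (G := fun k => ln (minor_rank (entry M) k) + c * label_sum u k)).
    by rewrite pairingD pairingZ.
  move=> k hk; rewrite ln_minor_rescale //; congr (_ + _).
  by rewrite /label_sum mulr_sumr.
apply/eqP; rewrite eq_le h -oppr_le0 -mulN1r -pairingZ.
rewrite (eq_pairing _ (G := label_sum (fun l => - t l))) ?h // => k hk.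
by rewrite /label_sum mulN1r sumrN.
Qed.

(** * Tropical points *)

Lemma maxZ_ge s x : x \in s -> x <= maxZ s.
Proof.
case: s => // y s; rewrite inE /maxZ; elim: s => [|z s IHs] /=.
  by rewrite orbF => /eqP ->.
rewrite inE orbCA => /orP[/eqP -> | /IHs h]; lia.
Qed.

Lemma maxZ_mem s : s != [::] -> maxZ s \in s.
Proof.
case: s => // y s _; rewrite /maxZ; elim: s => [|z s IHs] /=; first exact: mem_head.
have [->|->] : BinInt.Z.max z (foldr BinInt.Z.max y s) = z \/
  BinInt.Z.max z (foldr BinInt.Z.max y s) = foldr BinInt.Z.max y s by lia.
  by rewrite !inE eqxx orbT.
by move: IHs; rewrite !inE => /orP[-> //|->]; rewrite !orbT.
Qed.

Section Tropical.
Variables (w : seq Z) (c : R).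
Hypotheses (size_w : (size w <= 16)%N) (c_ge0 : 0 <= c).

Let x (j : nat) : R := expR (c * real_of R (nth Z0 w j)).

Lemma term_value_exp e : term_value x e
  = expR (c * real_of R (dotZ w [seq BinInt.Z.of_nat n | n <- e])).
Proof.
rewrite (real_of_dot _ _ _ size_w) mulr_sumr expR_sum; apply: eq_bigr => j _.
rewrite -expRM_natl mulrC -mulrA; congr (expR (_ * (_ * _))).
have [hj|hj] := ltnP j (size e); last by rewrite !nth_default ?size_map.
rewrite (nth_map 0%N) // /real_of.
by have -> : int_of_Z (BinInt.Z.of_nat (nth 0%N e j)) = Posz (nth 0%N e j) by lia.
Qed.

(** The largest term of a sum of positive terms bounds the sum from below, and from
    above if it is multiplied by the number of terms. *)
Lemma face_value_bounds k : (k < 70)%N ->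
  expR (c * real_of R (tropical w (integer_terms k))) <= face_value x k
    <= (size (terms k))%:R * expR (c * real_of R (tropical w (integer_terms k))).
Proof.
move=> hk; set y := expR _; rewrite /face_value.
have le_y e : e \in terms k -> term_value x e <= y.
  move=> he; rewrite term_value_exp /y ler_expR ler_wpM2l // -subr_ge0.
  rewrite -real_ofN -real_ofD real_of_ge0.
  have := @maxZ_ge [seq dotZ w e | e <- integer_terms k]
    (dotZ w [seq BinInt.Z.of_nat n | n <- e]).
  rewrite -/(tropical w _) !map_f // => /(_ isT); lia.
have [e he ey] : exists2 e, e \in terms k & term_value x e = y.
  have : tropical w (integer_terms k) \in [seq dotZ w e | e <- integer_terms k].
    by apply: maxZ_mem; have := terms_nonempty hk; rewrite /integer_terms; case: (terms k).
  rewrite /integer_terms -map_comp => /mapP[e he h]; exists e => //.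
  by rewrite term_value_exp /y h.
apply/andP; split.
  rewrite -ey (perm_big _ (perm_to_rem he)) big_cons lerDl.
  by apply: sumr_ge0 => e' _; rewrite term_value_exp expR_ge0.
rewrite -[size _]sum1_size natr_sum mulr_suml.
by rewrite big_seq [leRHS]big_seq; apply: ler_sum => e' /le_y; rewrite mul1r.
Qed.

Lemma face_value_log k : (k < 70)%N ->
  0 <= ln (face_value x k) - c * real_of R (tropical w (integer_terms k))
    <= (size (terms k))%:R.
Proof.
move=> hk; have /andP[h1 h2] := face_value_bounds hk.
set v := c * _ in h1 h2 *.
have hF : 0 < face_value x k by apply: lt_le_trans h1; rewrite expR_gt0.
have e : expR (ln (face_value x k)) = face_value x k by rewrite lnK ?posrE.
rewrite subr_ge0 -ler_expR e h1 /= lerBlDr -ler_expR e expRD.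
apply: le_trans h2 _; rewrite ler_pM2r ?expR_gt0 //.
by apply: le_trans (expR_ge1Dx _); rewrite lerDr.
Qed.
End Tropical.

(** Along the curve x = t^w the logarithm of a Plücker coordinate grows like
    its tropical value at w times log t, so a bounded ratio cannot have positive
    tropical value. *)
Lemma tropical_bounded a w : ratio_bounded R a -> (size w <= 16)%N ->
  pairing a (fun k => real_of R (tropical w (integer_terms k))) <= 0.
Proof.
move=> [C hC] hw; set s := pairing _ _.
pose B := pairing (fun I => `|a I|) (fun k => (size (terms k))%:R).
apply: (@bounded_slope (- B) C) => t ht.
pose x j : R := expR (t * real_of R (nth Z0 w j)).
have hx j : 0 < x j by apply: expR_gt0.
have hM k : (k < 70)%N ->
    minor_rank (entry (matrix_of (weight_matrix x))) k = face_value x k.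
  by move=> hk; rewrite minor_matrix_of // weight_matrix_minor.
have hpos : minors_positive (matrix_of (weight_matrix x)).
  by apply/minors_positiveP => k hk; rewrite hM // face_value_gt0.
apply: le_trans (pairing_bounded hC hpos).
rewrite /s -pairingZ -subr_ge0.
set F := fun k => ln _; set T := fun k => t * _.
have -> : pairing a F - (- B + pairing a T)
    = \sum_(k <- iota 0 70) ((a (plucker_set k))%:~R * (F k - T k)
         + (`|a (plucker_set k)|)%:~R * (size (terms k))%:R).
  rewrite big_split /= -/B opprD opprK addrCA addrC; congr (_ + _).
  by rewrite -sumrB; apply: eq_bigr => k _; rewrite mulrBr.
rewrite big_seq; apply: sumr_ge0 => k; rewrite mem_iota /= => hk.
have /andP[h1 h2] := face_value_log hw ht hk.
have {h2}h2 : F k - T k <= (size (terms k))%:R by rewrite /F hM.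
have {h1}h1 : 0 <= F k - T k by rewrite /F hM.
rewrite intr_norm -lerBlDr sub0r.
apply: (@le_trans _ _ (- (`|(a (plucker_set k))%:~R| * (F k - T k)))).
  by rewrite lerN2 ler_wpM2l.
by rewrite -mulNr ler_wpM2r // lerNl -normrN ler_norm.
Qed.
End LogRatio.

Lemma map_eq_mem (T U V : eqType) (f : T -> U) (g : V -> U) s s' x :
  map f s = map g s' -> x \in s -> exists2 y, y \in s' & f x = g y.
Proof. by move=> e hx; have := map_f f hx; rewrite e => /mapP. Qed.

Section PartOne.
Variable R : realType.

Definition free_rank (j : nat) : nat := nth 0%N free_ranks j.

Opaque gauge_ranks.
(** Sums over all ranks, and sums over the factors of a monomial, become sums over
    [free_ranks] for functions that vanish on [gauge_ranks]. *)
Lemma pairing_free (a : {set 'I_8} -> int) (F : nat -> R) :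
  {in gauge_ranks, forall k, F k = 0} ->
  pairing a F = \sum_(j < 62) (a (plucker_set (free_rank j)))%:~R * F (free_rank j).
Proof.
move=> hF; have hp : perm_eq (iota 0 70) (gauge_ranks ++ free_ranks) by vm_compute.
rewrite /pairing (perm_big _ hp) big_cat /= big_seq big1 ?add0r; last first.
  by move=> k hk; rewrite (hF k hk) mulr0.
by rewrite (big_nth 0%N) big_mkord.
Qed.

Lemma delta_sum (F : nat -> R) k s : uniq s -> k \in s ->
  \sum_(i <- s) (k == i)%:R * F i = F k.
Proof.
move=> hu hk; rewrite (bigD1_seq k) //= eqxx mul1r big1 ?addr0 // => i hi.
by rewrite eq_sym (negPf hi) mul0r.
Qed.

Lemma count_sum (F : nat -> R) m : {in gauge_ranks, forall k, F k = 0} ->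
  {in m, forall k, (k < 70)%N} ->
  \sum_(k <- m) F k = \sum_(k <- free_ranks) (count_mem k m)%:R * F k.
Proof.
move=> hF; elim: m => [|k m IHm] hm.
  by rewrite big_nil big1 // => k _; rewrite mul0r.
rewrite big_cons IHm; last by move=> i hi; apply: hm; rewrite inE hi orbT.
under [RHS]eq_bigr => i _ do rewrite /= natrD mulrDl.
rewrite big_split /=; congr (_ + _).
have hu : uniq free_ranks by vm_compute.
have hp : perm_eq (iota 0 70) (gauge_ranks ++ free_ranks) by vm_compute.
have : k \in iota 0 70 by rewrite mem_iota hm ?mem_head.
rewrite (perm_mem hp) mem_cat => /orP[hk|hk].
  rewrite (hF k hk); apply/esym/big1 => i _.
  by case: eqP => [e|_]; [rewrite -e (hF k hk) mulr0 | rewrite mul0r].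
by rewrite (delta_sum F hu hk).
Qed.

Transparent gauge_ranks.
(** Eight linear equations for eight unknowns. Differences with b 0 and b 1 give
    all t l - t 4, and the equation for {1, 2, 3, 4} then gives t 4 (= s). *)
Lemma gauge_exists (b : nat -> R) :
  exists t, {in gauge_ranks, forall k, b k + label_sum t k = 0}.
Proof.
pose d1 := b 35%N - b 1%N; pose d2 := b 15%N - b 1%N; pose d3 := b 5%N - b 1%N.
pose s := (- b 0%N - d1 - d2 - d3) / 4%:R.
exists (nth 0 [:: 0; s + d1; s + d2; s + d3; s; s + b 0%N - b 1%N; s + b 0%N - b 2%N;
  s + b 0%N - b 3%N; s + b 0%N - b 4%N]) => k.
have hs : 4%:R * s = - b 0%N - d1 - d2 - d3 by rewrite /s; field.
have e0 : nth [::] sets4 0 = [:: 1; 2; 3; 4]%N by vm_compute.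
have e1 : nth [::] sets4 1 = [:: 1; 2; 3; 5]%N by vm_compute.
have e2 : nth [::] sets4 2 = [:: 1; 2; 3; 6]%N by vm_compute.
have e3 : nth [::] sets4 3 = [:: 1; 2; 3; 7]%N by vm_compute.
have e4 : nth [::] sets4 4 = [:: 1; 2; 3; 8]%N by vm_compute.
have e5 : nth [::] sets4 5 = [:: 1; 2; 4; 5]%N by vm_compute.
have e6 : nth [::] sets4 15 = [:: 1; 3; 4; 5]%N by vm_compute.
have e7 : nth [::] sets4 35 = [:: 2; 3; 4; 5]%N by vm_compute.
rewrite !inE /label_sum => hk.
repeat (case/orP: hk => [/eqP -> | hk]); last move/eqP: hk => ->;
  rewrite ?e0 ?e1 ?e2 ?e3 ?e4 ?e5 ?e6 ?e7 !big_cons big_nil /=;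
  rewrite /d1 /d2 /d3 in hs *; lra.
Qed.

Opaque gauge_ranks.

Lemma size_constraints : size constraints = 332.
Proof. by vm_compute. Qed.

Lemma constraint_rows : all (fun r => size r == 62) constraints.
Proof. by vm_compute. Qed.

Lemma start_dualP i j : (i < 62)%N -> (j < 62)%N ->
  size (nth [::] start_rays i) = 62 /\
  dot_row constraints j (nth [::] start_rays i) = (i == j)%:R.
Proof.
move=> hi hj; have /allP/(_ i) := start_dual; rewrite mem_iota => /(_ hi); cbv beta zeta.
case: eqP => // sz /allP/(_ j); rewrite mem_iota => /(_ hj) /BinInt.Z.eqb_eq h.
by split=> //; rewrite /dot_row h; case: eqP.
Qed.

(** This is [orbit_ratio_le] in logarithmic form. *)
Lemma real_form_constraint (P L : nat -> R) i : plucker_function P ->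
  (forall k, (k < 70)%N -> P k = expR (L k)) -> {in gauge_ranks, forall k, L k = 0} ->
  (i < 332)%N -> 0 <= real_form constraints i (\row_(j < 62) L (free_rank j)).
Proof.
move=> hP hPL hL hi.
have hc : all (fun c : nat * nat => (c.1 < 20)%N &&
    (all (ltn^~ 70%N) (orbit_ratio c).1 && all (ltn^~ 70%N) (orbit_ratio c).2)) ratio_order.
  by vm_compute.
have sc : size ratio_order = 332 by vm_compute.
move/allP: hc; set c := nth (0, 0)%N ratio_order i => /(_ c).
rewrite mem_nth ?sc // => /(_ isT) /and3P[hc1 /allP h1 /allP h2].
have hP0 k : (k < 70)%N -> 0 < P k by move=> hk; rewrite hPL ?expR_gt0.
have monE m : {in m, forall k, (k < 70)%N} -> monomial P m = expR (\sum_(k <- m) L k).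
  by move=> hm; rewrite /monomial expR_sum; apply: eq_big_seq => k hk; rewrite hPL // hm.
have := orbit_ratio_le hP hP0 hc1; rewrite !monE // ler_expR -subr_ge0.
rewrite (count_sum hL h1) (count_sum hL h2) -sumrB; congr (0 <= _).
rewrite /real_form (big_nth 0%N) big_mkord; apply: eq_bigr => j _.
rewrite mxE constraintsE (nth_map (0, 0)%N) ?sc // -/c /constraint (nth_map 0%N) //.
rewrite -mulrBl; congr (_ * _); rewrite /real_of -/(free_rank j).
rewrite -[X in X - _]/((Posz _)%:~R) -[X in _ - X]/((Posz _)%:~R) -intrB; congr _%:~R; lia.
Qed.

(** * Bounded ratios are bounded by one *)

Lemma direction_size w : w \in direction_vectors -> (size w <= 16)%N.
Proof.
have : all (fun w => size w <= 16)%N direction_vectors by vm_compute.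
by move/allP; apply.
Qed.

Lemma tropical_gaugeP w k : w \in direction_vectors -> k \in gauge_ranks ->
  real_of R (tropical w (integer_terms k)) = 0.
Proof.
move=> hw hk; have /allP/(_ w hw)/allP h := tropical_gauge.
have /BinInt.Z.eqb_eq -> := h _ (map_f integer_terms hk).
by [].
Qed.

(** The logarithm L of the rescaled minors is a nonnegative combination of
    tropical vectors, on which the functional Q given by the exponents is not
    positive. *)
Lemma bounded_by_one (a : {set 'I_8} -> int) :
  ratio_bounded R a -> ratio_bounded_by_one R a.
Proof.
move=> ha M hM.
have [t ht] := gauge_exists (fun k => ln (minor_rank (entry M) k)).
pose L k := ln (minor_rank (entry M) k) + label_sum t k.
have -> : plucker_ratio a M = expR (pairing a L).
  by rewrite log_ratio // /L pairingD (bounded_degree t ha hM) addr0.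
rewrite -[leRHS]expR0 ler_expR pairing_free //.
pose Q (y : 'rV[R]_62) := \sum_(j < 62) (a (plucker_set (free_rank j)))%:~R * y 0 j <= 0.
suff : Q (\row_j L (free_rank j)).
  by rewrite /Q; under eq_bigr => j _ do rewrite mxE.
have hstart : size start_rays = 62 by vm_compute.
have := double_description (R := R) constraint_rows hstart start_dualP.
rewrite size_constraints => /(_ isT (\row_j L (free_rank j))) hull_L.
apply: (hull_closed (Q := Q)) (hull_L _).
- by rewrite /Q big1 // => j _; rewrite mxE mulr0.
- move=> y z hy hz; rewrite /Q; under eq_bigr => j _ do rewrite mxE mulrDr.
  by rewrite big_split -[leRHS]addr0; apply: lerD.
- move=> c y hc hy; rewrite /Q; under eq_bigr => j _ do rewrite mxE mulrCA.
  by rewrite -mulr_sumr mulr_ge0_le0.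
- move=> _ [r hr ->].
  have [w hw e] := map_eq_mem (eqP final_rays) hr.
  have := tropical_bounded ha (direction_size hw).
  rewrite pairing_free.
    rewrite /Q => hs; apply: le_trans hs; rewrite le_eqVlt; apply/orP; left; apply/eqP.
    apply: eq_bigr => j _; rewrite mxE e -map_comp (nth_map 0%N) //.
  by move=> k hk; apply: tropical_gaugeP hw hk.
move=> i hi; apply: (real_form_constraint (minor_plucker (entry (rescale M t)))) hi.
- move=> k hk; rewrite /L expRD lnK ?posrE; last by apply/minors_positiveP: k hk.
  by rewrite minor_rescale.
- exact: ht.
Qed.
End PartOne.

(** * Families of disjoint paths *)

(** The combinatorial enumeration uses pairs and lists of natural numbers; these
    are the translations to the vertices and paths of the grid and back. *)
Definition code_vertex (v : vertex) : nat * nat := (nat_of_ord v.1, nat_of_ord v.2).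
Definition code_path (p : gpath) : seq (nat * nat) := [seq code_vertex v | v <- p].
Definition vertex_of (v : nat * nat) : vertex := (inord v.1, inord v.2).
Definition path_of (l : seq (nat * nat)) : gpath := insub_bseq 7 [seq vertex_of v | v <- l].

Definition grid_step (u v : nat * nat) : bool :=
  ((v.1 == u.1) && (v.2.+1 == u.2)) || ((v.1 == u.1.+1) && (v.2 == u.2)).

Lemma code_vertex_inj : injective code_vertex.
Proof. by move=> [a b] [c d] [/val_inj -> /val_inj ->]. Qed.

Lemma vertex_ofK v : (v.1 < 4)%N -> (v.2 < 4)%N -> code_vertex (vertex_of v) = v.
Proof. by case: v => r c /= hr hc; rewrite /code_vertex /= !inordK. Qed.

Lemma path_bounds u l : path grid_step u l ->
  {in u :: l, forall v, (v.1 <= (last u l).1)%N /\ (v.2 <= u.2)%N}.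
Proof.
elim: l u => [|w l IHl] u /=; first by move=> _ v; rewrite inE => /eqP ->.
move=> /andP[huw /IHl h] v; rewrite inE => /orP[/eqP -> | /h[h1 h2]].
  by have [h1 h2] := h w (mem_head _ _); split=> //; move: huw; rewrite /grid_step; lia.
by split=> //; move: huw; rewrite /grid_step; lia.
Qed.

(** The recursion follows the first step of the path. A path that ends in row 3
    never leaves the grid, because rows do not decrease along it. *)
Lemma walksP n r c tc l : (r <= 3)%N ->
  l \in walks n r c tc =
  if l is u :: l' then [&& u == (r, c), path grid_step u l', last u l' == (3, tc)%N & (size l <= n)%N]
  else false.
Proof.
elim: n r c l => [|n IHn] r c l hr.
  by case: l => [//|u l]; rewrite ltn0 !andbF.
have no_nil f (L : seq (seq (nat * nat))) : ([::] \in [seq (f : nat * nat) :: w | w <- L]) = false.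
  by apply/mapP => -[].
rewrite [walks _ _ _ _]/= !mem_cat.
have single : l \in (if (r == 3) && (c == tc) then [:: [:: (r, c)]] else [::])%N
    = [&& l == [:: (r, c)], r == 3 & c == tc]%N.
  by case: ifP; rewrite ?inE ?andbT ?andbF.
case: l => [|u [|v l]] in single *; rewrite single.
- by rewrite /=; case: (c) => [|c']; case: ifP => _; rewrite ?no_nil.
- have no_single f (r' c' : nat) : (r' <= 3)%N ->
      [:: u] \in [seq (f : nat * nat) :: w | w <- walks n r' c' tc] = false.
    move=> hr'; apply/mapP => -[w hw [_ e]]; by move: hw; rewrite -e IHn.
  have -> : [:: u] \in (if c is c'.+1 then [seq (r, c) :: w | w <- walks n r c' tc] else [::]) = false.
    by case: (c) => // c'; apply: no_single.
  have -> : [:: u] \in (if (r < 3)%N then [seq (r, c) :: w | w <- walks n r.+1 c tc] else [::]) = false.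
    by case: ifP => // hr3; apply: no_single.
  rewrite /= !orbF andbT eqseq_cons eqxx andbT.
  by case: eqP => [->|]; rewrite //= xpair_eqE.
have mem_map' f L : (u :: v :: l \in [seq (f : nat * nat) :: w | w <- L]) = (u == f) && (v :: l \in L).
  apply/mapP/andP => [[w hw [-> ->]]|[/eqP -> hw]]; first by rewrite eqxx.
  by exists (v :: l).
rewrite eqseq_cons andbF /=.
have -> : u :: v :: l \in (if c is c'.+1 then [seq (r, c) :: w | w <- walks n r c' tc] else [::])
   = [&& u == (r, c), v.2.+1 == c, v.1 == r & [&& path grid_step v l, last v l == (3, tc)%N & (size l < n)%N]].
  case: (c) => [|c']; first by rewrite andbF.
  rewrite mem_map' IHn //; case: (v) => a b /=; rewrite xpair_eqE eqSS.
  by case: (u == _); case: (a == r); case: (b == c').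
have -> : u :: v :: l \in (if (r < 3)%N then [seq (r, c) :: w | w <- walks n r.+1 c tc] else [::])
   = [&& u == (r, c), v.1 == r.+1, v.2 == c & [&& path grid_step v l, last v l == (3, tc)%N & (size l < n)%N]].
  case: ifP => hr3.
    rewrite mem_map' IHn //; case: (v) => a b /=; rewrite xpair_eqE.
    by case: (u == _); case: (a == _); case: (b == _).
  rewrite in_nil; apply/esym/negP => /and4P[_ /eqP ev _ /and3P[/path_bounds/(_ v (mem_head _ _))[h _] /eqP e _]].
  by move: h; rewrite e ev /=; lia.
rewrite ltnS; case: eqP => [->|//]; rewrite /= /grid_step /=.
case: (path _ _ _); case: (last _ _ == _); case: (size l < n)%N; rewrite ?andbF ?andbT //.
by rewrite (andbC (_.+1 == c)).
Qed.

Lemma routesE (s t : 'I_8) (p : gpath) : (s < 4)%N -> (4 <= t)%N ->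
  routes s t p = (code_path p \in walks 7 s 3 (7 - t)).
Proof.
move=> hs ht; rewrite walksP // /routes /code_path.
have -> : val p = bseqval p by [].
have := size_bseq p; case: (bseqval p) => [//|u l] hsz.
have hstep : relpre code_vertex grid_step =2 Defs.step.
  by move=> [a b] [c d].
rewrite hs ht /= path_map (eq_path hstep) last_map size_map (hsz : (size l < 7)%N) andbT.
have eqE (v : vertex) (x : nat * nat) : (x.1 < 4)%N -> (x.2 < 4)%N ->
    (v == vertex_of x) = (code_vertex v == x).
  move=> h1 h2; rewrite -[in RHS](vertex_ofK h1 h2).
  by rewrite (inj_eq code_vertex_inj).
rewrite -(eqE u (nat_of_ord s, 3%N)) // -(eqE _ (3, 7 - t)%N) //=.
by have := ltn_ord t; lia.
Qed.

Lemma walk_grid r c tc n l : (r <= 3)%N -> (c <= 3)%N -> l \in walks n r c tc ->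
  {in l, forall v, (v.1 < 4)%N /\ (v.2 < 4)%N}.
Proof.
move=> hr hc; rewrite walksP //; case: l => // u l /and4P[/eqP eu /path_bounds h /eqP e _] v.
by move=> /h[]; rewrite e eu /=; lia.
Qed.

Lemma path_of_code l : {in l, forall v, (v.1 < 4)%N /\ (v.2 < 4)%N} -> (size l <= 7)%N ->
  code_path (path_of l) = l.
Proof.
move=> hg hs; have es : path_of l = [seq vertex_of v | v <- l] :> seq vertex.
  by rewrite /path_of /insub_bseq insubdK // unfold_in size_map.
rewrite /code_path es -map_comp -[RHS]map_id; apply/eq_in_map => v /hg[h1 h2].
exact: vertex_ofK.
Qed.

Lemma path_ofK n r c tc l : (n <= 7)%N -> (r <= 3)%N -> (c <= 3)%N -> l \in walks n r c tc ->
  code_path (path_of l) = l.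
Proof.
move=> hn hr hc hl; apply: path_of_code; first exact: walk_grid hl.
by move: hl; rewrite walksP //; case: (l) => // u l' /and4P[_ _ _ h]; apply: leq_trans h hn.
Qed.

Lemma code_pathK p : path_of (code_path p) = p.
Proof.
apply: val_inj; rewrite /path_of /insub_bseq insubdK; last first.
  by rewrite unfold_in !size_map size_bseq.
rewrite -map_comp -[RHS]map_id; apply: eq_map => -[a b] /=.
by rewrite /vertex_of /code_vertex /= !inord_val.
Qed.

Definition disjoint_paths (p q : seq (nat * nat)) : bool := ~~ has (mem q) p.

Lemma disjoint_pathsC p q : disjoint_paths p q = disjoint_paths q p.
Proof. by rewrite /disjoint_paths has_sym. Qed.

Lemma disjoint_code (p q : gpath) :
  disjoint_paths (code_path p) (code_path q) = ~~ has (mem q) p.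
Proof.
rewrite /disjoint_paths /code_path has_map; congr (~~ _); apply: eq_has => v /=.
by rewrite (mem_map code_vertex_inj).
Qed.

Lemma paths_toP s ts l :
  reflect (exists2 t, t \in ts & l \in walks 7 s 3 (7 - t)) (l \in paths_to s ts).
Proof. exact: flatten_mapP. Qed.

Lemma paths_to_head s ts l : (s < 4)%N -> l \in paths_to s ts ->
  head (0, 0)%N l = (s, 3)%N /\ (s, 3)%N \in l.
Proof.
move=> hs /paths_toP[t _]; rewrite walksP //.
by case: l => // u l /and4P[/eqP -> _ _ _]; rewrite mem_head.
Qed.

(** Thus a disjoint family contains at most one path from each source. *)
Lemma disjoint_heads ts s p q : (s < 4)%N -> p \in paths_to s ts -> q \in paths_to s ts ->
  ~~ disjoint_paths p q.
Proof.
move=> hs /(paths_to_head hs)[_ hp] /(paths_to_head hs)[_ hq].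
by rewrite negbK; apply/hasP; exists (s, 3)%N.
Qed.

Lemma mem_families ss ts (g : nat -> seq (nat * nat)) : uniq ss ->
  {in ss, forall s, g s \in paths_to s ts} ->
  {in ss &, forall s s', s != s' -> disjoint_paths (g s) (g s')} ->
  [seq g s | s <- ss] \in families ss ts.
Proof.
elim: ss => [|s ss IHs] //= /andP[hs hu] hg hd.
apply/flatten_mapP; exists (g s); first by rewrite hg ?mem_head.
apply/mapP; exists [seq g s | s <- ss] => //; rewrite mem_filter; apply/andP; split.
  apply/allP => _ /mapP[s' hs' ->].
  apply: hd; rewrite ?mem_head // ?inE ?hs' ?orbT //.
  by apply: contraNneq hs => ->.
apply: IHs => // [s' hs'|s1 s2 h1 h2]; first by apply: hg; rewrite inE hs' orbT.
by apply: hd; rewrite inE ?h1 ?h2 orbT.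
Qed.

Lemma familiesP ss ts f : uniq ss -> {in ss, forall s, (s < 4)%N} ->
  f \in families ss ts ->
  [/\ {in f, forall p, exists2 s, s \in ss & p \in paths_to s ts},
      {in ss, forall s, exists2 p, p \in f & p \in paths_to s ts},
      {in f &, forall p q, p != q -> disjoint_paths p q} &
      [seq head (0, 0)%N p | p <- f] = [seq (s, 3)%N | s <- ss]].
Proof.
elim: ss f => [|s ss IHs] f /=; first by rewrite inE => _ _ /eqP ->.
move=> /andP[hs hu] hss /flatten_mapP[p hp /mapP[f']].
rewrite mem_filter => /andP[/allP hd hf'] ->.
have hss' : {in ss, forall s, (s < 4)%N} by move=> s' hs'; rewrite hss // inE hs' orbT.
have [h1 h2 h3 h4] := IHs f' hu hss' hf'.
split.
- move=> q; rewrite inE => /orP[/eqP -> |/h1[s' hs' hq]]; first by exists s; rewrite ?mem_head.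
  by exists s'; rewrite // inE hs' orbT.
- move=> s'; rewrite inE => /orP[/eqP -> |/h2[q hq hqs]]; first by exists p; rewrite ?mem_head.
  by exists q; rewrite // inE hq orbT.
- move=> q q'; rewrite !inE => /orP[/eqP -> |hq] /orP[/eqP -> |hq'].
  + by rewrite eqxx.
  + by move=> _; apply: hd.
  + by move=> _; rewrite disjoint_pathsC; apply: hd.
  + exact: h3.
- by rewrite /= h4 (paths_to_head _ hp).1 // hss ?mem_head.
Qed.

(** Two listings of the same set agree if they are sorted by the same distinct
    keys; the keys will be the sources of the paths. *)
Lemma eq_from_map_mem (T U : eqType) (h : T -> U) (f g : seq T) :
  uniq (map h f) -> map h f = map h g -> f =i g -> f = g.
Proof.
elim: f g => [|x f IHf] [|y g] //= /andP[hx hu] [hxy hfg] hm.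
have exy : x = y.
  have : x \in y :: g by rewrite -hm mem_head.
  rewrite inE => /orP[/eqP //|/(map_f h)]; by rewrite -hfg (negPf hx).
rewrite -exy in hm *; congr (_ :: _); apply: IHf => // z.
have nf : x \notin f by apply: contra hx => /(map_f h).
have ng : x \notin g by apply: contra hx => /(map_f h); rewrite hfg.
have := hm z; rewrite !inE; case: eqP => [-> _|//].
by rewrite (negPf nf) (negPf ng).
Qed.

Definition path_set (f : seq (seq (nat * nat))) : {set gpath} :=
  [set p : gpath | p \in [seq path_of l | l <- f]].

Section Families.
Variable k : nat.
Let s4 := nth [::] sets4 k.
Let I := plucker_set k.

Lemma mem_sourcesE (s : 'I_8) : (s \in sources I) = (nat_of_ord s \in source_list s4).
Proof.
by rewrite /sources /source_list !inE mem_filter mem_iota /= andbC.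
Qed.

Lemma mem_sinksE (t : 'I_8) : (t \in sinks I) = (nat_of_ord t \in sink_list s4).
Proof.
rewrite /sinks /sink_list !inE mem_filter mem_iota /= andbC.
by rewrite (ltn_ord t) andbT.
Qed.

Lemma source_bound s : s \in source_list s4 -> (s < 4)%N.
Proof. by rewrite mem_filter mem_iota => /andP[]. Qed.

Lemma sink_bound t : t \in sink_list s4 -> (4 <= t < 8)%N.
Proof. by rewrite mem_filter mem_iota => /andP[]. Qed.

Lemma source_uniq : uniq (source_list s4).
Proof. by rewrite filter_uniq // iota_uniq. Qed.

Lemma routes_paths_to (s : 'I_8) p : s \in sources I ->
  [exists t in sinks I, routes s t p] =
  (code_path p \in paths_to s (sink_list s4)).
Proof.
rewrite mem_sourcesE => /source_bound hs.
apply/existsP/paths_toP => [[t /andP[ht hr]]|[t ht hr]].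
  exists t; first by rewrite -mem_sinksE.
  rewrite -routesE //; by move: ht; rewrite mem_sinksE => /sink_bound/andP[].
have /andP[h4 h8] := sink_bound ht.
exists (Ordinal h8); rewrite mem_sinksE ht routesE //.
Qed.

Lemma family_codes f : f \in disjoint_families s4 ->
  {in f, forall l, code_path (path_of l) = l}.
Proof.
rewrite mem_filter => /andP[_ hf] l hl.
have [h _ _ _] := familiesP source_uniq source_bound hf.
have [s hs /paths_toP[t _]] := h l hl.
by apply: path_ofK => //; have := source_bound hs.
Qed.

Lemma path_set_disjoint f : f \in disjoint_families s4 -> disjoint_family I (path_set f).
Proof.
move=> hf; have hcode := family_codes hf.
move: hf; rewrite mem_filter => /andP[/allP hcov hf].
have [h1 h2 h3 _] := familiesP source_uniq source_bound hf.
have memE p : p \in path_set f -> code_path p \in f.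
  by rewrite inE => /mapP[l hl ->]; rewrite hcode.
have memF l : l \in f -> path_of l \in path_set f by move=> hl; rewrite inE map_f.
apply/and4P; split.
- apply/forallP => p; apply/implyP => /memE hp; have [s hs hps] := h1 _ hp.
  have hs8 : (s < 8)%N by apply: leq_trans (source_bound hs) _.
  have hS : Ordinal hs8 \in sources I by rewrite mem_sourcesE.
  by apply/existsP; exists (Ordinal hs8); rewrite hS routes_paths_to.
- apply/forallP => s; apply/implyP => hs.
  have [l hl hls] := h2 s (etrans (esym (mem_sourcesE s)) hs).
  by apply/existsP; exists (path_of l); rewrite memF // routes_paths_to // hcode.
- apply/forallP => t; apply/implyP; rewrite mem_sinksE => ht.
  have /hasP[l hl /eqP hlast] := hcov t ht.
  apply/existsP; exists (path_of l); rewrite memF //=.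
  have [s hs /paths_toP[t' ht' hw]] := h1 l hl.
  have hs4 := source_bound hs.
  have hs8 : (s < 8)%N by apply: leq_trans hs4 _.
  have hS : Ordinal hs8 \in sources I by rewrite mem_sourcesE.
  apply/existsP; exists (Ordinal hs8); rewrite hS andTb routesE ?hcode //.
    move: hw hlast; rewrite !walksP //; case: (l) => // u l' /and4P[hu hp _ hn] /= ->.
    by rewrite hp hn (eqP hu) !eqxx.
  by have /andP[] := sink_bound ht.
- apply/forallP => p; apply/implyP => /memE hp; apply/forallP => q; apply/implyP => /memE hq.
  apply/implyP => hne; rewrite -disjoint_code; apply: h3 => //.
  by apply: contra hne => /eqP e; rewrite -(code_pathK p) e code_pathK.
Qed.

(** As paths from the same source share its vertex, there is exactly one path [g s]
    for each source s. *)
Lemma disjoint_family_path_set (F : {set gpath}) : disjoint_family I F ->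
  exists2 f, f \in disjoint_families s4 & F = path_set f.
Proof.
move=> /and4P[/forallP hF1 /forallP hF2 /forallP hF3 /forallP hF4].
pose starts s p := (p \in F) && (code_path p \in paths_to s (sink_list s4)).
have uniq_start s p q : (s < 4)%N -> starts s p -> starts s q -> p = q.
  move=> hs /andP[hp hps] /andP[hq hqs]; apply/eqP/negPn/negP => hne.
  have := disjoint_heads hs hps hqs; rewrite disjoint_code.
  by have /implyP/(_ hp)/forallP/(_ q)/implyP/(_ hq)/implyP/(_ hne) -> := hF4 p.
pose g s := odflt (path_of [::]) [pick p | starts s p].
have hg s : s \in source_list s4 -> starts s (g s).
  move=> hs; have hs8 : (s < 8)%N by apply: leq_trans (source_bound hs) _.
  have hS : Ordinal hs8 \in sources I by rewrite mem_sourcesE.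
  have /implyP/(_ hS)/existsP[p /andP[hp]] := hF2 (Ordinal hs8).
  rewrite routes_paths_to // => hps.
  rewrite /g; case: pickP => [//|/(_ p)]; by rewrite /starts hp hps.
have F_g p : p \in F -> exists2 s, s \in source_list s4 & p = g s.
  move=> hp; have /implyP/(_ hp)/existsP[s /andP[hs hr]] := hF1 p.
  have hs' : nat_of_ord s \in source_list s4 by rewrite -mem_sourcesE.
  exists (nat_of_ord s) => //; apply: (uniq_start s) (hg _ hs'); first exact: source_bound.
  by rewrite /starts hp -routes_paths_to.
exists [seq code_path (g s) | s <- source_list s4].
  rewrite mem_filter; apply/andP; split; last first.
    apply: mem_families; first exact: source_uniq.
      by move=> s /hg/andP[].
    move=> s s' hs hs' hne; rewrite disjoint_code.
    have /andP[hp hps] := hg s hs; have /andP[hq hqs] := hg s' hs'.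
    have hne' : g s != g s'.
      apply: contra hne => /eqP e.
      have [] := paths_to_head (source_bound hs) hps.
      by rewrite e => + _; have [-> _] := paths_to_head (source_bound hs') hqs => -[->].
    by have /implyP/(_ hp)/forallP/(_ (g s'))/implyP/(_ hq)/implyP/(_ hne') := hF4 (g s).
  apply/allP => t ht; have /andP[h4 h8] := sink_bound ht.
  have hT : Ordinal h8 \in sinks I by rewrite mem_sinksE.
  have /implyP/(_ hT)/existsP[p /andP[hp /existsP[s /andP[hs hr]]]] := hF3 (Ordinal h8).
  have [s' hs' ep] := F_g p hp.
  apply/hasP; exists (code_path (g s')); first by apply/mapP; exists s'.
  have hs4 : (s < 4)%N by apply: source_bound; rewrite -mem_sourcesE.
  move: hr; rewrite routesE // -ep walksP //.
  by case: (code_path p) => // u l /and4P[_ _ h _].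
apply/setP => p; rewrite inE; apply/idP/mapP => [/F_g[s hs ->]|[_ /mapP[s hs ->] ->]].
  by exists (code_path (g s)); rewrite ?code_pathK //; apply/mapP; exists s.
by rewrite code_pathK; have /andP[] := hg s hs.
Qed.

End Families.

Section FacePlucker.
Variable k : nat.
Hypothesis hk : (k < 70)%N.
Let s4 := nth [::] sets4 k.
Let I := plucker_set k.

Lemma families_heads f : f \in disjoint_families s4 ->
  [seq head (0, 0)%N p | p <- f] = [seq (s, 3)%N | s <- source_list s4].
Proof.
rewrite mem_filter => /andP[_ hf].
by have [] := familiesP (source_uniq k) (@source_bound k) hf.
Qed.

Lemma path_set_inj : {in disjoint_families s4 &, injective path_set}.
Proof.
have sub f f' : f \in disjoint_families s4 -> f' \in disjoint_families s4 ->
    path_set f = path_set f' -> {subset f <= f'}.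
  move=> hf hf' e l hl; have : path_of l \in path_set f by rewrite inE map_f.
  rewrite e inE => /mapP[l' hl' el].
  by rewrite -(family_codes hf hl) el (family_codes hf' hl').
move=> f f' hf hf' e;  apply: (@eq_from_map_mem (seq (nat * nat)) (nat * nat)%type (head (0, 0)%N)).
- by rewrite (families_heads hf) map_inj_uniq ?source_uniq // => a b [].
- by rewrite (families_heads hf) (families_heads hf').
- move=> l; apply/idP/idP; [exact: (sub f f')|exact: (sub f' f)].
Qed.

Lemma disjoint_families_uniq : uniq (disjoint_families s4).
Proof.
have : all (fun s => uniq (disjoint_families s)) sets4 by vm_compute.
move/allP; apply; apply: mem_nth; by have -> : size sets4 = 70 by vm_compute.
Qed.

Lemma perm_families :
  perm_eq (enum [pred F : {set gpath} | disjoint_family I F])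
          [seq path_set f | f <- disjoint_families s4].
Proof.
apply: uniq_perm; first exact: enum_uniq.
  by rewrite map_inj_in_uniq ?disjoint_families_uniq //; apply: path_set_inj.
move=> F; rewrite mem_enum inE; apply/idP/mapP => [/disjoint_family_path_set[f]|[f hf ->]].
  by exists f.
exact: path_set_disjoint.
Qed.

Definition face_variable (j : nat) : @mpoly.mpoly 16 int :=
  face_var (vertex_of (nth (0, 0)%N face_order j)).

(** A product over the faces south-east of the path becomes a product over all faces
    with exponents 0 and 1. *)
Lemma path_weight_code l : {in l, forall v, (v.1 < 4)%N /\ (v.2 < 4)%N} ->
  (size l <= 7)%N ->
  path_weight (path_of l) =
  \prod_(j < 16) face_variable j ^+ below_right l (nth (0, 0)%N face_order j).
Proof.
move=> hl hs; rewrite /path_weight.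
have hperm : perm_eq (index_enum vertex) [seq vertex_of v | v <- face_order].
  apply: uniq_perm; first exact: index_enum_uniq.
    rewrite map_inj_in_uniq; first by vm_compute.
    have hb : {in face_order, forall v, (v.1 < 4)%N /\ (v.2 < 4)%N}.
      have : all (fun v => (v.1 < 4) && (v.2 < 4))%N face_order by vm_compute.
      by move=> /allP h v /h /andP.
    by move=> u v /hb[u1 u2] /hb[v1 v2] e; rewrite -(vertex_ofK u1 u2) e vertex_ofK.
  move=> v; rewrite mem_index_enum; apply/esym/mapP; exists (code_vertex v).
    have : all (fun r => all (fun c => (r, c) \in face_order) (iota 0 4)) (iota 0 4).
      by vm_compute.
    by move=> /allP/(_ v.1)/[!mem_iota]/(_ (ltn_ord _))/allP; apply; rewrite mem_iota ltn_ord.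
  by case: v => a b; rewrite /vertex_of /code_vertex /= !inord_val.
have south_eastE f : f \in face_order ->
    south_east (path_of l) (vertex_of f) = below_right l f.
  move=> hf; have [f1 f2] : (f.1 < 4)%N /\ (f.2 < 4)%N.
    have : all (fun v => (v.1 < 4) && (v.2 < 4))%N face_order by vm_compute.
    by move=> /allP /(_ f hf) /andP.
  rewrite /south_east /below_right -[in RHS](path_of_code hl hs) has_map.
  apply: eq_has => v; have := vertex_ofK f1 f2.
  by case: (f) => r c [e1 e2]; rewrite /= e1 e2.
have -> : \prod_(f : vertex | south_east (path_of l) f) face_var f =
    \prod_(f : vertex) face_var f ^+ south_east (path_of l) f.
  by rewrite big_mkcond; apply: eq_bigr => f _; case: (south_east _ _).
rewrite (perm_big _ hperm) big_map big_seq.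
under eq_bigr => f hf do rewrite south_eastE //.
rewrite -big_seq (big_nth (0, 0)%N) big_mkord.
have -> : size face_order = 16%N by vm_compute.
by [].
Qed.

Lemma disjoint_families_grid f l : f \in disjoint_families s4 -> l \in f ->
  {in l, forall v, (v.1 < 4)%N /\ (v.2 < 4)%N} /\ (size l <= 7)%N.
Proof.
move=> + hl; rewrite mem_filter => /andP[_ hf].
have [h _ _ _] := familiesP (source_uniq k) (@source_bound k) hf.
have [s /source_bound hs /paths_toP[t _ hw]] := h l hl.
split; first exact: walk_grid hw.
by move: hw; rewrite walksP //; case: (l) => // u l' /and4P[].
Qed.

Lemma family_weight f : f \in disjoint_families s4 ->
  \prod_(p in path_set f) path_weight p = term_value face_variable (family_exponents f).
Proof.
move=> hf; have hcode := family_codes hf.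
have hu : uniq [seq path_of l | l <- f].
  rewrite map_inj_in_uniq.
    have := families_heads hf.
    move=> e; apply: (@map_uniq _ _ (head (0, 0)%N)); rewrite e.
    by rewrite map_inj_uniq ?source_uniq // => a b [].
  by move=> l l' hl hl' e; rewrite -(hcode l hl) e hcode.
have -> : \prod_(p in path_set f) path_weight p = \prod_(p <- [seq path_of l | l <- f]) path_weight p.
  by rewrite [RHS]big_uniq //; apply: eq_bigl => p; rewrite inE.
rewrite big_map /term_value.
transitivity (\prod_(l <- f) \prod_(j < 16)
    face_variable j ^+ below_right l (nth (0, 0)%N face_order j)).
  by apply: eq_big_seq => l /(disjoint_families_grid hf)[]; apply: path_weight_code.
rewrite exchange_big; apply: eq_bigr => j _ /=.
rewrite /family_exponents (nth_map (0, 0)%N); last first.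
  by have -> : size face_order = 16%N by vm_compute.
elim: (f) => [|l f' IHf]; first by rewrite big_nil.
by rewrite big_cons IHf /= exprD.
Qed.

(** Hence the polynomials of the statement are the sums of terms that are used in
    the computations. *)
Lemma face_pluckerE : face_plucker I = face_value face_variable k.
Proof.
rewrite /face_plucker.
have -> : \sum_(F : {set gpath} | disjoint_family I F) \prod_(p in F) path_weight p
    = \sum_(F <- enum [pred F : {set gpath} | disjoint_family I F]) \prod_(p in F) path_weight p.
  by rewrite big_enum.
rewrite (perm_big _ perm_families) big_map /face_value /terms exponent_tableE.
rewrite (nth_map [::]) /exponents ?big_map; last by have -> : size sets4 = 70 by vm_compute.
by apply: eq_big_seq => f; apply: family_weight.
Qed.
End FacePlucker.

(** * Subtraction-free products *)

Definition coefs_ge0 (p : @mpoly.mpoly 16 int) : Prop := forall m, 0 <= mcoeff m p.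

Lemma coefs_ge0_cone : nonneg_cone coefs_ge0.
Proof.
split=> [m|m|p q hp hq m|p q hp hq m]; first by rewrite mcoeff0.
- by rewrite mcoeff1 ler0n.
- by rewrite mcoeffD addr_ge0.
- by rewrite mcoeffM sumr_ge0 // => k _; rewrite mulr_ge0.
Qed.

Lemma face_variable_ge0 j : coefs_ge0 (face_variable j).
Proof. by move=> m; rewrite mcoeffX ler0n. Qed.

Definition fraction_ge0 (x : plucker_fraction) : Prop :=
  let p := \prod_(I <- x.1) face_plucker I in
  let q := \prod_(I <- x.2) face_plucker I in
  [/\ coefs_ge0 p, coefs_ge0 q & coefs_ge0 (q - p)].

Lemma fraction_ge0_1 : fraction_ge0 frac1.
Proof.
have [c0 c1 _ _] := coefs_ge0_cone.
by rewrite /fraction_ge0 /= !big_nil subrr; split.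
Qed.

(** By q q' - p p' = q (q' - p') + p' (q - p). *)
Lemma fraction_ge0_mul x y : fraction_ge0 x -> fraction_ge0 y -> fraction_ge0 (frac_mul x y).
Proof.
have [_ _ cD cM] := coefs_ge0_cone.
move=> [px qx dx] [py qy dy]; rewrite /fraction_ge0 /= !big_cat /=; split; try exact: cM.
set p1 := \prod_(I <- x.1) _ in px dx *; set q1 := \prod_(I <- x.2) _ in qx dx *.
set p2 := \prod_(I <- y.1) _ in py dy *; set q2 := \prod_(I <- y.2) _ in qy dy *.
have -> : q1 * q2 - p1 * p2 = q1 * (q2 - p2) + p2 * (q1 - p1) by ring.
by apply: cD; apply: cM.
Qed.

Lemma fraction_ge0_generator (i : 'I_20) : fraction_ge0 (generator i).
Proof.
rewrite /generator generating_ratiosE (nth_map ([::], [::])); last first.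
  by have -> : size generator_ranks = 20%N by vm_compute.
set r := nth _ _ _.
have /andP[h1 h2] : all (ltn^~ 70%N) r.1 && all (ltn^~ 70%N) r.2.
  have : all (fun r => all (ltn^~ 70%N) r.1 && all (ltn^~ 70%N) r.2) generator_ranks.
    by vm_compute.
  by move/allP; apply; apply: mem_nth; have -> : size generator_ranks = 20%N by vm_compute.
have e m : all (ltn^~ 70%N) m ->
    \prod_(I <- [seq plucker_set k | k <- m]) face_plucker I = monomial (face_value face_variable) m.
  move=> /allP hm; rewrite big_map /monomial; apply: eq_big_seq => k /hm hk.
  exact: face_pluckerE.
have hF k : coefs_ge0 (face_value face_variable k).
  by apply: face_value_ge0; [exact: coefs_ge0_cone|exact: face_variable_ge0].
rewrite /fraction_ge0 /= !e //; split.
- exact: (cone_prod _ coefs_ge0_cone hF).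
- exact: (cone_prod _ coefs_ge0_cone hF).
exact: (generator_subtraction_free coefs_ge0_cone face_variable_ge0 (ltn_ord i)).
Qed.

Lemma fraction_ge0_subtraction_free x : fraction_ge0 x -> subtraction_free x.
Proof.
move=> [_ _ h] d m; rewrite mcoeff_msupp => hm.
by rewrite lt0r hm; apply: h.
Qed.

Theorem theorem4p15 (R : realType) :
  (forall a : {set 'I_8} -> int,
     ratio_bounded R a -> ratio_bounded_by_one R a)
  /\
  (forall e : 'I_20 -> nat,
     ratio_bounded R (laurent (generator_product e)) ->
     subtraction_free (generator_product e)).
Proof.
split=> [a|e _]; first exact: bounded_by_one.
apply: fraction_ge0_subtraction_free; rewrite /generator_product.
apply: (big_ind fraction_ge0); [exact: fraction_ge0_1|exact: fraction_ge0_mul|move=> i _].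
elim: (e i) => [|n IHn]; first exact: fraction_ge0_1.
by apply: fraction_ge0_mul => //; apply: fraction_ge0_generator.
Qed.
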